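(* Let $X\subseteq K^m$-type set $X$ (a subset of $\mathrm{VF}^m$) be existentially definable and let $f\colon X\to \mathrm{VF}$ be an existentially definable function, where ''existentially definable'' means defined by an existential $\mathcal{L}_{\mathrm{RV}}$-formula either (a) without parameters, or (b) with parameters from a fixed non-Archimedean local field $K_0$ of characteristic zero. In case (a), for every non-Archimedean local field $K$ of characteristic zero, and in case (b), for every finite field extension $K$ of $K_0$, one has for every finite field extension $L\geq K$: \[\operatorname{ind}^L_X(|f|)\leq \operatorname{ind}^K_X(|f|).\]
   Context: Valued fields and $\mathcal{L}_{\mathrm{RV}}$: for a valued field $K$ with valuation ring $\mathcal{O}_K$, maximal ideal $\mathcal{M}_K$, value group $\Gamma$ and valuation $\mathrm{ord}$, and a positive integer $N$, put $\mathrm{RV}_N^\times=K^\times/(1+N\mathcal{M}_K)$, $\mathrm{RV}_N=\mathrm{RV}_N^\times\cup\{0\}$, $\mathrm{rv}_N\colon K\to\mathrm{RV}_N$ the projection with $\mathrm{rv}_N(0)=0$ (and also the induced maps $\mathrm{RV}_M\to\mathrm{RV}_N$ for $N\mid M$). For $\xi_0,\dots,\xi_d\in\mathrm{RV}_N$ let $\sum_i\xi_i=\{\mathrm{rv}_N(\sum_i x_i)\mid x_i\in K,\mathrm{rv}_N(x_i)=\xi_i\}$; for $A\subseteq\mathrm{RV}_N$ write $\mathrm{ord}(A)\le\delta$ if every element of $A$ has order $\le\delta$. The multisorted language $\mathcal{L}_{\mathrm{RV}}$ has sorts $\mathrm{VF}$ and $\mathrm{RV}_N$ ($N\geq1$):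 the ring language on $\mathrm{VF}$; on each $\mathrm{RV}_N$ constants $0,1$, a binary function $\cdot$, a binary relation $\mid$ and a ternary relation $\oplus$; function symbols $\mathrm{rv}_N\colon\mathrm{VF}\to\mathrm{RV}_N$ and $\mathrm{rv}_{N,M}\colon \mathrm{RV}_M\to\mathrm{RV}_N$ ($N\mid M$); and relation symbols $P_{N,d}$ on $\mathrm{RV}_N\times\mathrm{RV}_{N^2}^{d+1}$. In a valued field $K$ these are interpreted naturally: $\cdot$ is the group multiplication on $\mathrm{RV}_N^\times$ extended by $0$, $1=\mathrm{rv}_N(1)$, $\mathrm{rv}_N(x)\mid\mathrm{rv}_N(y)$ iff $\mathrm{ord}\,x\le\mathrm{ord}\,y$, $\oplus(\xi_1,\xi_2,\xi_3)$ iff there are $x_i\in K$ with $\mathrm{rv}_N(x_i)=\xi_i$ and $x_1+x_2=x_3$, and $P_{N,d}(\xi,\zeta_0,\dots,\zeta_d)$ iff $\xi\in\mathrm{RV}_N^\times$ and for some (equivalently all) $a_i\in K$ with $\mathrm{rv}_{N^2}(a_i)=\zeta_i$: $\mathrm{ord}(\sum_{i=1}^d\mathrm{rv}_N(ia_i)\xi^{i-1})\le\min_{1\le i\le d}\mathrm{ord}(a_i\xi^{i-1})+\mathrm{ord}\,N$ and there is $\tilde\xi\in\mathrm{RV}_{N^2}$ with $\mathrm{rv}_N(\tilde\xi)=\xi$ and $0\in\sum_{i=0}^d\mathrm{rv}_{N^2}(a_i)\tilde\xi^i$. An existential formula is one of the form $\exists y\,\varphi(x,y)$ with $\varphi$ quantifier-free.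 A definable set $X$ is the family $(X_K)_K$ of sets defined by a formula in each field $K$; a definable function $f\colon X\to Y$ is a family of functions $f_K\colon X_K\to Y_K$ with domain exactly $X_K$ whose graphs are defined by one formula; it is existentially definable if its graph is given by an existential formula. $K$-index: for a non-Archimedean local field $K$ with residue field of cardinality $q_K$ and uniformizer $\pi$, let $|\cdot|_K$ be the absolute value with $|\pi|_K=q_K^{-1}$, and equip $K^m$ with the Haar measure normalized so that $\mathcal{O}_K^m$ has measure 1. Then $\operatorname{ind}^K_X(|f|)$ is the supremum of all $s\in\mathbb{R}_{>0}$ with $\int_{X_K}|f_K(x)|_K^s\,dx<+\infty$, set to $0$ if no such $s$ exists and to $+\infty$ if the set of such $s$ is unbounded. *)

(* Defs.v *)
From HB Require Import structures.
From mathcomp Require Import all_boot all_order all_algebra.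
From mathcomp Require Import all_classical all_reals all_analysis.

Set Implicit Arguments.
Unset Strict Implicit.
Unset Printing Implicit Defensive.

Import Order.TTheory GRing.Theory Num.Theory.
Local Open Scope classical_set_scope.
Local Open Scope ring_scope.

(* (The value of ord at 0 is irrelevant; ord 0 = +oo is handled by the      *)
(* auxiliary predicates below.)                                             *)

Definition in_O (F : fieldType) (ord : F -> int) (x : F) : Prop :=
  x = 0 \/ (0 <= ord x).
Definition in_M (F : fieldType) (ord : F -> int) (x : F) : Prop :=
  x = 0 \/ (0 < ord x).
(* "ord x >= k" with ord 0 = +oo *)
Definition ord_ge (F : fieldType) (ord : F -> int) (x : F) (k : int) : Prop :=
  x = 0 \/ (k <= ord x).

Record NALocalField0 := {
  lf_car :> fieldType;
  lf_ord : lf_car -> int;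
  lf_q : nat;
  lf_char0 : forall n : nat, (n%:R : lf_car) = 0 -> n = 0%N;
  lf_ordM : forall x y : lf_car, x != 0 -> y != 0 ->
      lf_ord (x * y) = lf_ord x + lf_ord y;
  lf_ordD : forall x y : lf_car, x != 0 -> y != 0 -> x + y != 0 ->
      Num.min (lf_ord x) (lf_ord y) <= lf_ord (x + y);
  lf_unif : exists pi : lf_car, pi != 0 /\ lf_ord pi = 1;
  lf_complete : forall u : nat -> lf_car,
      (forall k : int, exists n0, forall i j, (n0 <= i)%N -> (n0 <= j)%N ->
          ord_ge lf_ord (u i - u j) k) ->
      exists l, forall k : int, exists n0, forall i, (n0 <= i)%N ->
          ord_ge lf_ord (u i - l) k;
  lf_residue : exists s : seq lf_car,
      size s = lf_q /\
      (forall x, x \in s -> in_O lf_ord x) /\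
      (forall i j, (i < lf_q)%N -> (j < lf_q)%N -> i <> j ->
          ~ in_M lf_ord (nth 0 s i - nth 0 s j)) /\
      (forall x, in_O lf_ord x -> exists2 y, y \in s & in_M lf_ord (x - y))
}.

(* "ord x <= ord y", with the convention ord 0 = +oo *)
Definition ord_le (K : NALocalField0) (x y : K) : Prop :=
  y = 0 \/ (x <> 0 /\ lf_ord x <= lf_ord y).

(* rv_N x = rv_N y, i.e. equality in RV_N = (K^x / (1 + N M_K)) u {0} *)
Definition rv_eq (K : NALocalField0) (N : nat) (x y : K) : Prop :=
  (x = 0 /\ y = 0) \/
  (x <> 0 /\ y <> 0 /\ exists z : K, in_M (@lf_ord K) z /\ x / y = 1 + N%:R * z).

Definition finite_ext (K L : NALocalField0) (j : {rmorphism K -> L}) : Prop :=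
  (exists b : seq L, forall y : L,
      exists c : 'I_(size b) -> K, y = \sum_(i < size b) j (c i) * b`_i) /\
  (exists e : nat, (0 < e)%N /\
      forall x : K, x != 0 -> lf_ord (j x) = e%:Z * lf_ord x).

(* The language L_RV.  Sorts: VF, and RV_N for N >= 1.  The sort RV_N is    *)
(* indexed below by n : nat with N = n.+1.  Terms may contain parameters    *)
(* from a type P (P = void: no parameters; P = K0: parameters from K0).     *)

Inductive vterm (P : Type) : Type :=
  | VVar of nat
  | VPar of P
  | VZero | VOne
  | VAdd of vterm P & vterm P
  | VOpp of vterm P
  | VMul of vterm P & vterm P.

(* sort index n <-> RV_(n.+1) *)
Definition sq_sort (n : nat) : nat := ((n.+1) ^ 2).-1.

Inductive rterm (P : Type) : nat -> Type :=
  | RVar (n : nat) (i : nat) : rterm P n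
  | RZero (n : nat) : rterm P n
  | ROne (n : nat) : rterm P n
  | RMul (n : nat) : rterm P n -> rterm P n -> rterm P n
  | Rrv (n : nat) : vterm P -> rterm P n
  | Rrvr (n k : nat) : (n.+1 %| k.+1)%N -> rterm P k -> rterm P n.

Inductive qformula (P : Type) : Type :=
  | FTrue | FFalse
  | VEq of vterm P & vterm P
  | REq (n : nat) of rterm P n & rterm P n
  | RDvd (n : nat) of rterm P n & rterm P n
  | ROplus (n : nat) of rterm P n & rterm P n & rterm P n
  | RPred (n d : nat) of rterm P n & ('I_d.+1 -> rterm P (sq_sort n))
  | FNot of qformula P
  | FAnd of qformula P & qformula P
  | FOr of qformula P & qformula P.

Arguments VZero {P}. Arguments VOne {P}.
Arguments FTrue {P}. Arguments FFalse {P}.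

Section Semantics.
Variables (P : Type) (K : NALocalField0) (par : P -> K).
(* environments: VF variables, and RV variables of each sort, the latter
   given by representatives in K (an element rv_N(x) is represented by x) *)
Variables (venv : nat -> K) (renv : nat -> nat -> K).

Fixpoint veval (t : vterm P) : K :=
  match t with
  | VVar i => venv i
  | VPar c => par c
  | VZero => 0
  | VOne => 1
  | VAdd a b => veval a + veval b
  | VOpp a => - veval a
  | VMul a b => veval a * veval b
  end.

(* a representative in K of the value of an RV term *)
Fixpoint reval (n : nat) (t : rterm P n) : K :=
  match t with
  | RVar n i => renv n i
  | RZero _ => 0
  | ROne _ => 1
  | RMul _ a b => reval a * reval b
  | Rrv _ s => veval s
  | Rrvr _ _ _ s => reval s
  end.

(* P_{N,d}(xi, zeta_0, ..., zeta_d), on representatives x, a_0, ..., a_d *)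
Definition Pnd (N d : nat) (x : K) (a : 'I_d.+1 -> K) : Prop :=
  x <> 0 /\
  (forall y : 'I_d -> K,
     (forall i : 'I_d, rv_eq N (y i) ((i.+1)%:R * a (lift ord0 i) * x ^+ i)) ->
     forall i : 'I_d,
       ord_le (\sum_(k < d) y k) (a (lift ord0 i) * x ^+ i * N%:R)) /\
  (exists xt : K, rv_eq N xt x /\
     exists z : 'I_d.+1 -> K,
       (forall i : 'I_d.+1, rv_eq (N ^ 2) (z i) (a i * xt ^+ i)) /\
       \sum_(i < d.+1) z i = 0).

Fixpoint qsat (f : qformula P) : Prop :=
  match f with
  | FTrue => True
  | FFalse => False
  | VEq s t => veval s = veval t
  | REq n a b => rv_eq n.+1 (reval a) (reval b)
  | RDvd n a b => ord_le (reval a) (reval b)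
  | ROplus n a b c => exists x1 x2 x3 : K,
      [/\ rv_eq n.+1 x1 (reval a), rv_eq n.+1 x2 (reval b),
          rv_eq n.+1 x3 (reval c) & x1 + x2 = x3]
  | RPred n d xi zs => Pnd n.+1 (reval xi) (fun i => reval (zs i))
  | FNot g => ~ qsat g
  | FAnd g h => qsat g /\ qsat h
  | FOr g h => qsat g \/ qsat h
  end.

End Semantics.

(* Existentially definable sets and functions.  The existential formula     *)
(* "exists y, phi(x, y)" (phi quantifier free) is represented by phi: the   *)
(* VF variables 0..m-1 are the free variables x (and, for a graph, the VF   *)
(* variable m is the output variable); all other variables are             *)
(* existentially quantified.                                                *)

Definition vec (F : fieldType) (m : nat) : Type := 'I_m -> F.
HB.instance Definition _ (F : fieldType) m := Choice.on (vec F m).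
HB.instance Definition _ (F : fieldType) m :=
  isPointed.Build (vec F m) (fun _ => 0%R).

Definition def_set (P : Type) (K : NALocalField0) (par : P -> K) (m : nat)
    (phi : qformula P) : set (vec K m) :=
  [set x | exists (venv : nat -> K) (renv : nat -> nat -> K),
     (forall i : 'I_m, venv i = x i) /\ qsat par venv renv phi].

Definition def_graph (P : Type) (K : NALocalField0) (par : P -> K) (m : nat)
    (phi : qformula P) (x : vec K m) (y : K) : Prop :=
  exists (venv : nat -> K) (renv : nat -> nat -> K),
     (forall i : 'I_m, venv i = x i) /\ venv m = y /\ qsat par venv renv phi.

Arguments def_set {P K} par m phi.
Arguments def_graph {P K} par m phi x y.

Definition is_def_fun (P : Type) (K : NALocalField0) (par : P -> K) (m : nat)
    (phiX phiF : qformula P) : Prop :=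
  forall x : vec K m,
    (def_set par m phiX x <-> exists y, def_graph par m phiF x y) /\
    (forall y1 y2, def_graph par m phiF x y1 -> def_graph par m phiF x y2 ->
        y1 = y2).

(* the value f_K(x) of the function defined by phiF (meaningful on X_K) *)
Definition def_fun (P : Type) (K : NALocalField0) (par : P -> K) (m : nat)
    (phiF : qformula P) (x : vec K m) : K :=
  xget 0 [set y | def_graph par m phiF x y].

Arguments is_def_fun {P K} par m phiX phiF.
Arguments def_fun {P K} par m phiF x.

Section Index.
Variable R : realType.

Definition absK (K : NALocalField0) (x : K) : R :=
  if x == 0 then 0 else ((lf_q K)%:R : R) ^ (- lf_ord x).

(* boxes prod_i (a_i + pi^(k_i) O_K); they generate the Borel sigma-algebra *)
Definition box (K : NALocalField0) (m : nat) (a : 'I_m -> K) (k : 'I_m -> int)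
  : set (vec K m) :=
  [set x | forall i : 'I_m, ord_ge (@lf_ord K) (x i - a i) (k i)].

Definition boxes (K : NALocalField0) (m : nat) : set (set (vec K m)) :=
  [set B | exists a k, B = box a k].

Arguments boxes : clear implicits.

Definition haar_measure (K : NALocalField0) (m : nat)
    (mu : {measure set (g_sigma_algebraType (boxes K m)) -> \bar R}) : Prop :=
  forall a k, mu (box a k) =
     (((lf_q K)%:R : R) ^ (- \sum_(i < m) k i))%:E.

Definition ind_K (K : NALocalField0) (m : nat)
    (mu : {measure set (g_sigma_algebraType (boxes K m)) -> \bar R})
    (X : set (vec K m)) (f : vec K m -> K) : \bar R :=
  let S := [set s : R | 0 < s /\
     (\int[mu]_(x in (X : set (g_sigma_algebraType (boxes K m))))
         ((absK (f x)) `^ s)%:E < +oo)%E] in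
  if `[< S !=set0 >] then ereal_sup (EFin @` S) else 0%E.

End Index.

Arguments boxes : clear implicits.

(* Main.v *)
(* Two points of K^m are compared through the leading terms, up to a fixed relative precision,
   of the values of finitely many polynomials.  Hensel's lemma shows that a point of a set
   defined by an existential formula can be shifted: multiplying the leading terms by powers of
   a uniformizer gives leading terms which are realized by points of the same set in any
   extension L of K, as soon as the vector of shifts is admissible (large orders may only
   increase, very negative ones only decrease, and the others are kept).  A class of points of
   K^m with orders o has measure at most B q_K^(- kap o), and the points of L^m obtained from it
   by the shift v have measure at least q_L^(- e (kap o + kap v + C)), for an additive form kap;
   the order of f is shifted by an additive form of v as well.  If the integral of |f|^s over
   L^m is finite, the form lam = kap + s ord f must therefore be positive on every admissible
   shift that moves the class, and by Dickson's lemma the sum over all classes in K^m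
   of q_K^(- lam o), which bounds the integral over K^m, is finite. *)
Require Import Defs.
From HB Require Import structures.
From mathcomp Require Import all_boot all_order all_algebra.
From mathcomp Require Import all_classical all_reals all_analysis measurable_realfun.
From mathcomp Require Import zify ring lra.

Set Implicit Arguments.
Unset Strict Implicit.
Unset Printing Implicit Defensive.

Import Order.TTheory GRing.Theory Num.Theory.
Local Open Scope classical_set_scope.
Local Open Scope ring_scope.

(** * Orders and Hensel's lemma *)

(** RV-variables are quantified through representatives in K, so the witnesses are points of a power
    of K, and every atomic formula, the predicates [P_{N,d}] included, becomes a boolean combination
    of comparisons of orders of polynomials. A comparison survives a shift of leading terms under
    which the difference of the two orders moves admissibly. Coordinates are transferred one at a
    time, the value of the function and the witnesses after the free ones. The obstacle is
    cancellation: the leading term of P(a + t) need not be determined by those of the Taylor terms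
    at a. The remedy is to expand around a nearest root a in K of a family closed under derivation,
    since cancellation beyond a constant would produce a nearer root. Such centres are algebraic
    over the preceding coordinates, so roots must be transferred as well, by induction on the
    degree; the orders at the centres are stored in an auxiliary group. All precisions, thresholds
    and constants are chosen before the point, because one bound has to serve the sum over all
    classes. *)

Definition vge (K : NALocalField0) (x : K) (k : int) : Prop :=
  x = 0 \/ k <= lf_ord x.

Section Valuation.
Variable K : NALocalField0.
Implicit Types (x y : K) (k : int).

Lemma ord_one : lf_ord (1 : K) = 0.
Proof.
have := @lf_ordM K 1 1 (oner_neq0 _) (oner_neq0 _).
by rewrite mulr1 => /eqP; rewrite -subr_eq0 opprD addrA subrr add0r oppr_eq0 => /eqP.
Qed.

Lemma ordX x n : x != 0 -> lf_ord (x ^+ n) = n%:Z * lf_ord x.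
Proof.
move=> x0; elim: n => [|n IH]; first by rewrite expr0 ord_one mul0r.
by rewrite exprS lf_ordM ?expf_neq0// IH -addn1 PoszD mulrDl mul1r addrC.
Qed.

Lemma ordV x : x != 0 -> lf_ord x^-1 = - lf_ord x.
Proof.
move=> x0; have := @lf_ordM K x x^-1 x0; rewrite invr_eq0 => /(_ x0).
by rewrite divff// ord_one => h; apply/eqP; rewrite -addr_eq0 addrC -h.
Qed.

Lemma ordXz x (k : int) : x != 0 -> lf_ord (x ^ k) = k * lf_ord x.
Proof.
move=> x0; case: k => n; first by rewrite /exprz /= ordX.
by rewrite /exprz /= ordV ?expf_neq0// ordX// NegzE mulNr.
Qed.

Lemma ordN x : lf_ord (- x) = lf_ord x.
Proof.
have [->|x0] := eqVneq x 0; first by rewrite oppr0.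
have N1 : (-1 : K) != 0 by rewrite oppr_eq0 oner_neq0.
have h : lf_ord (-1 : K) = 0.
  have := @lf_ordM K (-1) (-1) N1 N1; rewrite mulrNN mulr1 ord_one; lia.
by rewrite -mulN1r lf_ordM// h add0r.
Qed.

Lemma vge0 k : vge (0 : K) k. Proof. by left. Qed.

Lemma vge_le x k l : l <= k -> vge x k -> vge x l.
Proof. by move=> lk [->|h]; [left|right; apply: le_trans h]. Qed.

Lemma vge_ord x : vge x (lf_ord x). Proof. by right. Qed.

Lemma vgeD x y k : vge x k -> vge y k -> vge (x + y) k.
Proof.
have [->|x0] := eqVneq x 0; first by rewrite add0r.
have [->|y0] := eqVneq y 0; first by rewrite addr0.
have [->|xy0] := eqVneq (x + y) 0; first by left.
move=> [/eqP|hx]; first by rewrite (negPf x0).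
move=> [/eqP|hy]; first by rewrite (negPf y0).
by right; apply: le_trans (lf_ordD x0 y0 xy0); rewrite le_min hx.
Qed.

Lemma vgeN x k : vge x k -> vge (- x) k.
Proof. by move=> [->|h]; [left; rewrite oppr0|right; rewrite ordN]. Qed.

Lemma vgeB x y k : vge x k -> vge y k -> vge (x - y) k.
Proof. by move=> hx hy; apply: vgeD => //; apply: vgeN. Qed.

Lemma vgeM x y k l : vge x k -> vge y l -> vge (x * y) (k + l).
Proof.
have [->|x0] := eqVneq x 0; first by rewrite mul0r; left.
have [->|y0] := eqVneq y 0; first by rewrite mulr0; left.
move=> [/eqP|hx]; first by rewrite (negPf x0).
move=> [/eqP|hy]; first by rewrite (negPf y0).
by right; rewrite lf_ordM// lerD.
Qed.

Lemma vge1 : vge (1 : K) 0. Proof. by right; rewrite ord_one. Qed.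

Lemma vgeX x n k : vge x k -> vge (x ^+ n) (n%:Z * k).
Proof.
move=> h; elim: n => [|n IH]; first by rewrite expr0 mul0r; apply: vge1.
rewrite exprS -addn1 PoszD mulrDl mul1r addrC; exact: vgeM.
Qed.

Lemma vge_sum (I : Type) (r : seq I) (P : pred I) (f : I -> K) k :
  (forall i, P i -> vge (f i) k) -> vge (\sum_(i <- r | P i) f i) k.
Proof. by move=> h; elim/big_ind: _ => //; [left|move=> *; exact: vgeD]. Qed.

Lemma vge_natr n : vge (n%:R : K) 0.
Proof. by elim: n => [|n IH]; [left|rewrite -addn1 natrD; apply: vgeD => //; apply: vge1]. Qed.

Lemma vgeMn x n k : vge x k -> vge (x *+ n) k.
Proof. by move=> h; rewrite -mulr_natl -[k]add0r; apply: vgeM => //; apply: vge_natr. Qed.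

Lemma vge_eq0 x : (forall k, vge x k) -> x = 0.
Proof. by move=> /(_ (lf_ord x + 1)) [//|h]; lia. Qed.

Lemma not_vge x k : ~ vge x k -> x != 0 /\ lf_ord x < k.
Proof.
move=> h; split; first by apply/eqP => x0; apply: h; left.
by rewrite ltNge; apply/negP => h'; apply: h; right.
Qed.

Lemma vge_ordP x k : x != 0 -> vge x k -> k <= lf_ord x.
Proof. by move=> x0 [/eqP|//]; rewrite (negPf x0). Qed.

Lemma vge_divl x y k : x != 0 -> vge y (lf_ord x + k) -> vge (y / x) k.
Proof.
move=> x0 h; have -> : k = (lf_ord x + k) - lf_ord x by lia.
by apply: vgeM => //; right; rewrite ordV.
Qed.

(** The strict case of the ultrametric law: otherwise x = (x + y) - y would have order above ord
    x. *)
Lemma ord_dom x y : x != 0 -> vge y (lf_ord x + 1) ->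
  x + y != 0 /\ lf_ord (x + y) = lf_ord x.
Proof.
move=> x0 hy; have xy0 : x + y != 0.
  apply/eqP => /eqP; rewrite addr_eq0 => /eqP e.
  by move: x0 hy; rewrite e ordN oppr_eq0 => x0 /(vge_ordP x0) h; lia.
split=> //; apply/eqP; rewrite eq_le; apply/andP; split.
  rewrite leNgt; apply/negP => h.
  have : vge ((x + y) - y) (lf_ord x + 1) by apply: vgeB => //; right; lia.
  by rewrite addrK => /(vge_ordP x0) h2; lia.
by apply: (vge_ordP xy0); apply: vgeD; [right|apply: vge_le hy; lia].
Qed.

Lemma ord_unit (u : K) k : 0 < k -> vge u k -> 1 + u != 0 /\ lf_ord (1 + u) = 0.
Proof.
move=> k0 hu; have [] := @ord_dom (1 : K) u (oner_neq0 _); last by rewrite ord_one.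
by apply: vge_le hu; rewrite ord_one; lia.
Qed.

Lemma natr_neq0 n : (0 < n)%N -> (n%:R : K) != 0.
Proof. by move=> n0; apply/eqP => /lf_char0; lia. Qed.

End Valuation.
#[global] Hint Resolve vge0 vge_ord vge1 : core.

Section Hensel.
Variable F : NALocalField0.

Lemma complete_series (u : nat -> F) (r : int) :
  (forall n, vge (u n.+1 - u n) (r + n%:Z)) ->
  exists l, forall k : int, exists n0, forall n, (n0 <= n)%N -> vge (l - u n) k.
Proof.
move=> hu.
have hd n p : vge (u (p + n)%N - u n) (r + n%:Z).
  elim: p => [|p IH]; first by rewrite add0n subrr; left.
  have -> : u (p.+1 + n)%N - u n = (u (p + n).+1 - u (p + n)%N) + (u (p + n)%N - u n).
    by rewrite addrA subrK.
  by apply: vgeD => //; apply: vge_le (hu _); lia.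
have hd' (k : int) i j : (`|k - r| <= i)%N -> (`|k - r| <= j)%N -> vge (u i - u j) k.
  move=> hi hj; wlog ij : i j hi hj / (j <= i)%N.
    move=> H; have [ij|/ltnW ij] := leqP j i; first exact: H.
    by rewrite -opprB; apply: vgeN; apply: H.
  by rewrite -(subnK ij); apply: vge_le (hd _ _); lia.
have [l hl] : exists l, forall k : int, exists n0, forall i, (n0 <= i)%N ->
    ord_ge (@lf_ord F) (u i - l) k.
  by apply: lf_complete => k; exists `|k - r|%N => i j hi hj; exact: hd'.
exists l => k; have [n0 h] := hl k; exists n0 => n hn.
by rewrite -opprB; apply: vgeN; exact: h.
Qed.

(** Besides w - w' the difference has a factor homogeneous of degree i + 1 in w and w', of order at
    least (i + 1) r >= r. *)
Lemma vge_subX (w w' : F) (r m : int) i : 0 <= r -> vge w r -> vge w' r ->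
  vge (w - w') m -> vge (w ^+ i.+2 - w' ^+ i.+2) (m + r).
Proof.
move=> r0 hw hw' hm; rewrite subrXX; apply: vgeM => //.
apply: vge_sum => j _.
apply: (vge_le (k := ((i.+2.-1 - j)%N%:Z * r + j%:Z * r))); last first.
  by apply: vgeM; apply: vgeX.
rewrite -mulrDl -PoszD /=.
have -> : (i.+1 - j + j)%N = i.+1 by have := ltn_ord j; lia.
by rewrite -addn1 PoszD mulrDl mul1r lerDr mulr_ge0.
Qed.

(** First-order Taylor estimate: by [vge_subX], each term of degree at least two gains a factor of
    order r beyond that of w - w'. *)
Lemma poly_diff (h : {poly F}) (nu r m : int) (w w' : F) :
  (forall i, vge h`_i nu) -> 0 <= r -> vge w r -> vge w' r -> vge (w - w') m ->
  vge (h.[w] - h.[w'] - h`_1 * (w - w')) (nu + m + r).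
Proof.
move=> hh r0 hw hw' hm.
have e x : h.[x] = \sum_(i < (size h).+2) h`_i * x ^+ i.
  by apply: horner_coef_wide; lia.
rewrite !e -sumrB !big_ord_recl /= !expr0 !expr1 /bump /=.
have -> (a b c : F) : h`_0 * 1 - h`_0 * 1 + (a * b - a * c + \sum_(i < size h)
    (h`_(1 + (1 + i)) * w ^+ (1 + (1 + i)) - h`_(1 + (1 + i)) * w' ^+ (1 + (1 + i)))) - a * (b - c)
    = \sum_(i < size h) (h`_(1 + (1 + i)) * w ^+ (1 + (1 + i))
    - h`_(1 + (1 + i)) * w' ^+ (1 + (1 + i))) by ring.
apply: vge_sum => i _; rewrite -mulrBr -addrA !add1n; apply: vgeM => //.
exact: vge_subX.
Qed.

(* The map w |-> w - h(w) / h_1 is a contraction of the ball of radius r. *)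
Lemma hensel (h : {poly F}) (nu b r : int) :
  (forall i, vge h`_i nu) -> h`_1 != 0 -> lf_ord h`_1 <= nu + b ->
  0 <= b -> b < r -> vge h`_0 (nu + b + r) ->
  exists w, h.[w] = 0 /\ vge w r.
Proof.
move=> hh h1 oh1 b0 br h0.
pose g w := w - h.[w] / h`_1.
have gd w w' m : vge w r -> vge w' r -> vge (w - w') m ->
    vge (g w - g w') (m + 1).
  move=> hw hw' hm.
  have -> : g w - g w' = - ((h.[w] - h.[w'] - h`_1 * (w - w')) / h`_1).
    by rewrite /g; field.
  apply: vgeN; apply: vge_divl => //.
  apply: vge_le (poly_diff hh _ hw hw' hm); lia.
pose u n := iter n g 0.
have g0 : vge (g 0) r.
  rewrite /g sub0r; apply: vgeN; apply: vge_divl => //.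
  rewrite horner_coef0; apply: vge_le h0; lia.
have hu n : vge (u n) r.
  elim: n => [|n IH] /=; first by left.
  have -> : g (u n) = (g (u n) - g 0) + g 0 by rewrite subrK.
  apply: vgeD => //; apply: (vge_le (k := r + 1)); first by lia.
  by apply: gd => //; rewrite subr0.
have hs n : vge (u n.+1 - u n) (r + n%:Z).
  elim: n => [|n IH]; first by rewrite /= subr0 addr0.
  by apply: vge_le (gd _ _ _ (hu n.+1) (hu n) IH); lia.
have [l hl] := complete_series hs.
have hlr : vge l r.
  have [n /(_ n (leqnn _)) h'] := hl r.
  by rewrite -(subrK (u n) l); apply: vgeD.
exists l; split=> //; apply: vge_eq0 => k.
have [n0 hn0] := hl (k - nu).
pose n := (n0 + `|(k - lf_ord h`_1 - r)%R|)%N.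
(* The last summand is h(u_n), because the step u_{n+1} - u_n equals - h(u_n) / h_1; the chosen n
   makes all three summands of order at least k. *)
have -> : h.[l] = (h.[l] - h.[u n] - h`_1 * (l - u n)) + h`_1 * (l - u n)
    + (- (h`_1 * (u n.+1 - u n))).
  by rewrite /= /g; field.
have hln : vge (l - u n) (k - nu) by apply: hn0; rewrite /n; lia.
apply: vgeD; first apply: vgeD.
- by apply: vge_le (poly_diff hh _ hlr (hu n) hln); lia.
- have -> : k = nu + (k - nu) by lia.
  exact: vgeM.
- apply: vgeN; apply: (vge_le (k := lf_ord h`_1 + (r + n%:Z))); last exact: vgeM.
  rewrite /n; lia.
Qed.

End Hensel.

(** * Leading terms *)

(** An embedding with ramification index [vx_e]. The identity [idv] is an instance, so that one
    relation [mt] describes both the classes in K and the shifted points in F. *)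
Record vext (K F : NALocalField0) := Vext {
  vx_mor :> {rmorphism K -> F};
  vx_e : nat;
  vx_e0 : (0 < vx_e)%N;
  vx_ord : forall x : K, x != 0 -> lf_ord (vx_mor x) = vx_e%:Z * lf_ord x
}.

Lemma idv_ord (K : NALocalField0) (x : K) : x != 0 ->
  lf_ord ((@idfun K : {rmorphism K -> K}) x) = 1%N%:Z * lf_ord x.
Proof. by rewrite mul1r. Qed.

Definition idv (K : NALocalField0) : vext K K := Vext (ltn0Sn 0) (@idv_ord K).

Definition unif (K : NALocalField0) : K := projT1 (cid (lf_unif K)).

Lemma unif_neq0 K : unif K != 0.
Proof. by rewrite /unif; case: cid => p []. Qed.

Lemma ord_unif K : lf_ord (unif K) = 1.
Proof. by rewrite /unif; case: cid => p []. Qed.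

Lemma unifXz_neq0 K (s : int) : unif K ^ s != 0.
Proof. by rewrite expfz_neq0// unif_neq0. Qed.

Lemma ord_unifXz K (s : int) : lf_ord (unif K ^ s) = s.
Proof. by rewrite ordXz ?unif_neq0// ord_unif mulr1. Qed.
#[global] Hint Resolve unifXz_neq0 unif_neq0 : core.

Section Match.
Variables (K F : NALocalField0) (j : vext K F).
Local Notation e := (vx_e j)%:Z.

(* [b] has leading term [unif ^ s * a] up to relative precision [N]. *)
Definition mt (N : nat) (s : int) (a : K) (b : F) : Prop :=
  exists u : F, vge u (e * N%:Z) /\ b = j (unif K ^ s * a) * (1 + u).

Lemma vx_gt0 : 0 < e. Proof. by rewrite ltz_nat vx_e0. Qed.

Lemma vge_vx (a : K) k : vge a k -> vge (j a) (e * k).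
Proof.
have [->|a0] := eqVneq a 0; first by rewrite rmorph0; left.
move=> /(vge_ordP a0) h; right; rewrite vx_ord// ler_wpM2l// ltW// vx_gt0.
Qed.

Lemma vge_sh (a : K) s k : vge a k -> vge (j (unif K ^ s * a)) (e * (k + s)).
Proof.
move=> h; apply: vge_vx; rewrite addrC; apply: vgeM => //.
by right; rewrite ord_unifXz.
Qed.

Lemma sh_neq0 (a : K) s : a != 0 -> j (unif K ^ s * a) != 0.
Proof. by move=> a0; rewrite fmorph_eq0 mulf_eq0 negb_or unifXz_neq0. Qed.

Lemma ord_sh (a : K) s : a != 0 -> lf_ord (j (unif K ^ s * a)) = e * (lf_ord a + s).
Proof.
move=> a0; rewrite vx_ord ?lf_ordM ?ord_unifXz ?unifXz_neq0//; first by rewrite addrC.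
by rewrite mulf_eq0 negb_or unifXz_neq0.
Qed.

Lemma mt_unit N (u : F) : (0 < N)%N -> vge u (e * N%:Z) ->
  1 + u != 0 /\ lf_ord (1 + u) = 0.
Proof.
move=> N0 hu; apply: (ord_unit _ hu); rewrite mulr_gt0// ?ltz_nat//; exact: vx_gt0.
Qed.

Lemma mt_eq0 N s a b : (0 < N)%N -> mt N s a b -> (b == 0) = (a == 0).
Proof.
move=> N0 [u [/(mt_unit N0)[hu _] ->]].
by rewrite mulf_eq0 (negPf hu) orbF fmorph_eq0 mulf_eq0 (negPf (unifXz_neq0 _ _)).
Qed.

Lemma mt_ord N s a b : (0 < N)%N -> a != 0 -> mt N s a b ->
  lf_ord b = e * (lf_ord a + s).
Proof.
move=> N0 a0 [u [/(mt_unit N0)[hu ou] ->]].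
by rewrite lf_ordM// ?sh_neq0// ord_sh// ou addr0.
Qed.

Lemma mt_le N M s a b : (M <= N)%N -> mt N s a b -> mt M s a b.
Proof.
move=> MN [u [hu ->]]; exists u; split=> //; apply: vge_le hu.
by rewrite ler_wpM2l// ltW//; exact: vx_gt0.
Qed.

Lemma mt_vge N s a b k : mt N s a b -> vge a k -> vge b (e * (k + s)).
Proof.
move=> [u [hu ->]] ha; have -> : e * (k + s) = e * (k + s) + 0 by rewrite addr0.
apply: vgeM; first exact: vge_sh.
by apply: vgeD => //; apply: vge_le hu; rewrite mulr_ge0// ltW//; exact: vx_gt0.
Qed.

Lemma mt_err N s a b k : mt N s a b -> vge a k ->
  vge (b - j (unif K ^ s * a)) (e * (k + s + N%:Z)).
Proof.
move=> [u [hu ->]] ha; rewrite mulrDr mulr1 addrC addKr mulrDr.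
by apply: vgeM => //; exact: vge_sh.
Qed.

Lemma mt_intro N s a b : a != 0 ->
  vge (b - j (unif K ^ s * a)) (e * (lf_ord a + s + N%:Z)) -> mt N s a b.
Proof.
move=> a0 h; exists ((b - j (unif K ^ s * a)) / j (unif K ^ s * a)); split.
  by apply: vge_divl; rewrite ?sh_neq0// ord_sh// -mulrDr.
have h0 := sh_neq0 s a0.
by rewrite mulrDr mulr1 [X in _ + X]mulrC divfK// addrC subrK.
Qed.

Lemma mt_zero N s : mt N s 0 0.
Proof. by exists 0; split; [left|rewrite mulr0 rmorph0 mul0r]. Qed.

Lemma mt_sh N s a : mt N s a (j (unif K ^ s * a)).
Proof. by exists 0; split; [left|rewrite addr0 mulr1]. Qed.

Lemma mtM N s t a b a' b' : mt N s a b -> mt N t a' b' ->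
  mt N (s + t) (a * a') (b * b').
Proof.
move=> [u [hu ->]] [v [hv ->]]; exists (u + v + u * v); split.
  apply: vgeD; first exact: vgeD.
  apply: (vge_le (k := e * N%:Z + e * N%:Z)); last exact: vgeM.
  by rewrite lerDl mulr_ge0// ltW//; exact: vx_gt0.
by rewrite expfzDr// !rmorphM; ring.
Qed.

Lemma mtX N s a b n : mt N s a b -> mt N (n%:Z * s) (a ^+ n) (b ^+ n).
Proof.
move=> h; elim: n => [|n IH].
  rewrite mul0r !expr0; exists 0; split; first by left.
  by rewrite expr0z !mul1r rmorph1 addr0 mulr1.
by rewrite !exprS -addn1 PoszD mulrDl mul1r addrC; apply: mtM.
Qed.

Lemma mtV N s a b : (0 < N)%N -> mt N s a b -> mt N (- s) a^-1 b^-1.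
Proof.
move=> N0 [u [hu ->]]; have [hu0 ou] := mt_unit N0 hu.
have [->|a0] := eqVneq a 0; first by rewrite mulr0 rmorph0 mul0r !invr0; apply: mt_zero.
exists (- u / (1 + u)); split.
  by apply: vge_divl => //; rewrite ou add0r; apply: vgeN.
rewrite -invr_expz !rmorphM !fmorphV.
have : j (unif K ^ s) != 0 by rewrite fmorph_eq0 unifXz_neq0.
have : j a != 0 by rewrite fmorph_eq0.
by move=> h1 h2; field; rewrite h1 h2 hu0.
Qed.

End Match.

(* [o] is a difference of two orders and [v] its change under a shift of the leading terms. *)
Definition adm1 (T : int) (o v : int) : Prop :=
  [/\ T <= o -> 0 <= v, o <= - T -> v <= 0 & `|o| < T -> v = 0].

Section SumMatch.
Variables (K F : NALocalField0) (j : vext K F).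
Local Notation e := (vx_e j)%:Z.

(** Terms of order less than T above mu are shifted by exactly tau, so they agree up to precision
    N1. The others have order at least mu + T before the shift and move up relative to tau, so they
    disappear in the error. *)
Lemma sum_err (n : nat) (a : nat -> K) (b : nat -> F) (s : nat -> int)
    (tau mu : int) (N N1 : nat) (T : int) :
  N%:Z <= T -> (N <= N1)%N ->
  (forall l, (l < n)%N -> mt j N1 (s l) (a l) (b l)) ->
  (forall l, (l < n)%N -> vge (a l) mu) ->
  (forall l, (l < n)%N -> a l != 0 -> adm1 T (lf_ord (a l) - mu) (s l - tau)) ->
  vge (\sum_(l < n) b l - j (unif K ^ tau * \sum_(l < n) a l)) (e * (mu + tau + N%:Z)).
Proof.
move=> NT NN hm ha hadm; rewrite mulr_sumr rmorph_sum -sumrB.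
apply: vge_sum => -[l ln] _ /=; have [a0|a0] := eqVneq (a l) 0.
  have [u [_ ->]] := hm l ln; rewrite a0 !mulr0 rmorph0 mul0r subr0; by left.
have [h1 h2 h3] := hadm l ln a0; have hl := hm l ln.
have := vge_ordP a0 (ha l ln) => hmu.
have e0 := vx_gt0 j.
have [hT|hT] := ltP `|lf_ord (a l) - mu| T.
  have -> : tau = s l by have := h3 hT; lia.
  by apply: vge_le (mt_err hl (vge_ord _)); rewrite ler_pM2l//; lia.
have hT' : T <= lf_ord (a l) - mu by lia.
have st := h1 hT'.
apply: vgeB.
  by apply: vge_le (mt_vge hl (vge_ord _)); rewrite ler_pM2l//; lia.
by apply: vge_le (vge_sh j tau (vge_ord (a l))); rewrite ler_pM2l//; lia.
Qed.

(** The bound N0 on the cancellation turns the absolute error into a relative one: terms near S lose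
    at most N0 of their precision N1 >= N + N0, and the remaining ones lie at least T >= N + N0
    above S. *)
Lemma mt_sum (n : nat) (a : nat -> K) (b : nat -> F) (s : nat -> int)
    (tau : int) (N N0 N1 : nat) (T : int) :
  (N + N0)%N%:Z <= T -> (N + N0 <= N1)%N -> (0 < N)%N ->
  let S := \sum_(l < n) a l in
  (forall l, (l < n)%N -> mt j N1 (s l) (a l) (b l)) ->
  (forall l, (l < n)%N -> a l != 0 -> S != 0 /\ lf_ord S <= lf_ord (a l) + N0%:Z) ->
  (forall l, (l < n)%N -> a l != 0 -> adm1 T (lf_ord (a l) - lf_ord S) (s l - tau)) ->
  mt j N tau S (\sum_(l < n) b l).
Proof.
move=> NT NN N_gt0 S hm hnc hadm.
have [S0|S0] := eqVneq S 0.
  have a0 l : (l < n)%N -> a l = 0.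
    move=> ln; apply/eqP/negPn/negP => /(hnc l ln)[]; by rewrite S0 eqxx.
  rewrite S0 big1; first exact: mt_zero.
  move=> [l ln] _ /=; have [u [_ ->]] := hm l ln.
  by rewrite a0// mulr0 rmorph0 mul0r.
apply: mt_intro => //.
rewrite mulr_sumr rmorph_sum -sumrB.
apply: vge_sum => -[l ln] _ /=; have [a0|a0] := eqVneq (a l) 0.
  have [u [_ ->]] := hm l ln; rewrite a0 !mulr0 rmorph0 mul0r subr0; by left.
have [h1 h2 h3] := hadm l ln a0; have hl := hm l ln; have [_ hN0] := hnc l ln a0.
have e0 := vx_gt0 j.
have [hT|hT] := ltP `|lf_ord (a l) - lf_ord S| T.
  have -> : tau = s l by have := h3 hT; lia.
  by apply: vge_le (mt_err hl (vge_ord _)); rewrite ler_pM2l//; lia.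
(* The alternative, a term T below S, is excluded by the cancellation bound N0 < T. *)
have hT' : T <= lf_ord (a l) - lf_ord S by lia.
have st := h1 hT'.
apply: vgeB.
  by apply: vge_le (mt_vge hl (vge_ord _)); rewrite ler_pM2l//; lia.
by apply: vge_le (vge_sh j tau (vge_ord (a l))); rewrite ler_pM2l//; lia.
Qed.

Lemma mtid_sym N (a b : K) : (0 < N)%N -> mt (idv K) N 0 a b -> mt (idv K) N 0 b a.
Proof.
move=> N0 [u [hu]]; rewrite /= expr0z mul1r => ->.
have [hu0 ou] := mt_unit N0 hu.
exists (- u / (1 + u)); split; last by rewrite expr0z mul1r /=; field.
by apply: vge_divl => //; rewrite ou add0r; apply: vgeN.
Qed.

(** Replaces the reference point in K by another point of its class. *)
Lemma mt_comp N s (a a' : K) (b : F) : mt (idv K) N 0 a a' ->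
  mt j N s a' b -> mt j N s a b.
Proof.
move=> [u [hu]]; rewrite /= expr0z mul1r => -> [v [hv ->]].
have hju : vge (j u) (e * N%:Z) by apply: vge_vx; move: hu; rewrite mul1r.
exists (j u + v + j u * v); split; last by rewrite !rmorphM rmorphD rmorph1; ring.
apply: vgeD; first exact: vgeD.
apply: (vge_le (k := e * N%:Z + e * N%:Z)); last exact: vgeM.
by rewrite lerDl mulr_ge0// ltW//; exact: vx_gt0.
Qed.

End SumMatch.

(** * Roots and Taylor terms *)

Lemma roots_seq (A : idomainType) (p : {poly A}) : p != 0 ->
  exists s : seq A, (size s < size p)%N /\ forall x, root p x -> x \in s.
Proof.
move: {2}(size p) (leqnn (size p)) => n; elim: n p => [|n IH] p.
  by rewrite leqn0 size_poly_eq0 => ->.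
move=> hs p0; have [[x px]|nx] := pselect (exists x, root p x); last first.
  exists [::]; split; first by rewrite /= lt0n size_poly_eq0.
  by move=> x px; case: nx; exists x.
have /factor_theorem [q eq] := px.
have q0 : q != 0 by apply: contraNneq p0 => q0; rewrite eq q0 mul0r.
have sp : size p = (size q).+1.
  by rewrite eq size_Mmonic ?monicXsubC// size_XsubC addn2.
have [||s [ss hs']] := IH q => //; first by rewrite -ltnS -sp.
exists (x :: s); split; first by rewrite /= sp ltnS.
move=> y; rewrite eq rootM root_XsubC in_cons => /orP[/hs' ->|->//].
by rewrite orbT.
Qed.

(** Both sides are the multinomial coefficient (n + i + l)! / (n! i! l!). *)
Lemma bin_mul_bin n i l :
  ('C(n + (i + l), i + l) * 'C(i + l, i) = 'C(n + (i + l), i) * 'C(n + l, l))%N.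
Proof.
have h1 := @bin_fact (n + (i + l)) (i + l) (leq_addl _ _).
have h2 := @bin_fact (i + l) i (leq_addr _ _).
have h3 : ('C(n + (i + l), i) * (i`! * (n + l)`!) = (n + (i + l))`!)%N.
  rewrite -(@bin_fact (n + (i + l)) i); last by rewrite addnCA leq_addr.
  by have -> : (n + (i + l) - i = n + l)%N by lia.
have h4 := @bin_fact (n + l) l (leq_addl _ _).
have e1 : (n + (i + l) - (i + l) = n)%N by lia.
have e2 : (i + l - i = l)%N by lia.
have e4 : (n + l - l = n)%N by lia.
rewrite e1 in h1; rewrite e2 in h2; rewrite e4 in h4.
have f1 := fact_gt0 n; have f2 := fact_gt0 i; have f3 := fact_gt0 l.
apply/eqP; rewrite -(eqn_pmul2r f1) -(eqn_pmul2r f2) -(eqn_pmul2r f3); apply/eqP.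
have key (a b c d g1 g2 g3 g4 g5 g6 : nat) : (a * (g4 * g1) = g6 ->
    b * (g2 * g3) = g4 -> c * (g2 * g5) = g6 -> d * (g3 * g1) = g5 ->
    a * b * g1 * g2 * g3 = c * d * g1 * g2 * g3)%N.
  by move=> k1 k2 k3 k4; transitivity g6; [rewrite -k1 -k2|rewrite -k3 -k4]; ring.
exact: key h1 h2 h3 h4.
Qed.

Lemma nderivn_comp (A : nzRingType) (p : {poly A}) i l :
  (p^`N(i))^`N(l) = p^`N(i + l) *+ 'C(i + l, i).
Proof.
apply/polyP => n; rewrite coef_nderivn coefMn !coef_nderivn -!mulrnA addnA.
have h := bin_mul_bin n i l.
congr (_ *+ _); rewrite [(i + l + n)%N]addnC [(l + n)%N]addnC h.
by congr ('C(_, _) * _)%N; lia.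
Qed.

Section Collision.
Variable K : NALocalField0.

Definition tterm (P : {poly K}) (c t : K) (l : nat) : K := P^`N(l).[c] * t ^+ l.

Lemma taylor (P : {poly K}) c t n : (size P <= n)%N ->
  P.[c + t] = \sum_(l < n) tterm P c t l.
Proof. by move=> h; rewrite (nderiv_taylor_wide _ h)//; exact: mulrC. Qed.

Lemma tterm_big (P : {poly K}) c t l : (size P <= l)%N -> tterm P c t l = 0.
Proof. by move=> h; rewrite /tterm nderivn_poly0// horner0 mul0r. Qed.

Lemma size_nderivn_le (P : {poly K}) i : (size P^`N(i) <= size P)%N.
Proof. by apply: leq_trans (size_poly _ _) (leq_subr _ _). Qed.

Lemma tterm_nderivn (P : {poly K}) c t i l :
  tterm P^`N(i) c t l * t ^+ i = tterm P c t (i + l) *+ 'C(i + l, i).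
Proof. by rewrite /tterm nderivn_comp hornerMn exprD; ring. Qed.

(** By [tterm_nderivn], the Taylor terms at c + t are integer combinations of those at c. Together
    with [tterm_unshift], a common lower bound on the orders holds at both centres or at neither. *)
Lemma tterm_shift (P : {poly K}) c t mu :
  (forall l, vge (tterm P c t l) mu) -> forall i, vge (tterm P (c + t) t i) mu.
Proof.
move=> h i; rewrite {1}/tterm (taylor _ _ (size_nderivn_le P i)) mulr_suml.
apply: vge_sum => l _; rewrite tterm_nderivn; exact: vgeMn.
Qed.

Lemma vge_ttermN (P : {poly K}) c t l mu :
  vge (tterm P c (- t) l) mu -> vge (tterm P c t l) mu.
Proof.
rewrite /tterm exprNn mulrCA => h.
have -> : P^`N(l).[c] * t ^+ l = (-1) ^+ l * ((-1) ^+ l * (P^`N(l).[c] * t ^+ l)).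
  by rewrite mulrA -expr2 sqrr_sign mul1r.
rewrite -[mu]add0r; apply: vgeM => //.
by rewrite -(mulr0 l%:Z); apply: vgeX; apply: vgeN.
Qed.

Lemma tterm_unshift (P : {poly K}) c t mu :
  (forall l, vge (tterm P (c + t) t l) mu) -> forall i, vge (tterm P c t i) mu.
Proof.
move=> h i; apply: vge_ttermN; rewrite -{1}(addrK t c).
apply: tterm_shift => l; apply: vge_ttermN; rewrite opprK; exact: h.
Qed.

Lemma ord_natr_bound n : exists D : nat, forall k, (k <= n)%N -> lf_ord (k%:R : K) <= D%:Z.
Proof.
exists (\max_(k < n.+1) `|lf_ord (k%:R : K)|)%N => k kn.
have := @leq_bigmax _ (fun i : 'I_n.+1 => `|lf_ord (i%:R : K)|%N) (Ordinal (kn : (k < n.+1)%N)).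
move=> /= h; lia.
Qed.

(** Strong cancellation at c + t has a cause in K itself: a derivative with a root closer to c + t
    than c is. The constant depends only on K and n. *)
Definition collides (n N0 : nat) : Prop := forall (P : {poly K}) (c t : K) l0,
  (size P <= n)%N -> t != 0 -> tterm P c t l0 != 0 ->
  vge P.[c + t] (lf_ord (tterm P c t l0) + N0%:Z + 1) ->
  exists i beta, [/\ (i < n)%N, P^`N(i) != 0, root P^`N(i) beta &
                   vge (beta - (c + t)) (lf_ord t + 1)].

(* Thresholds growing geometrically as the order of derivation decreases single out a
   derivative to which Hensel's lemma applies at [c + t]. *)
Lemma collision n : exists N0 : nat, collides n N0.
Proof.
have [D hD] := ord_natr_bound n.
(* The factor 4 gives 2 M(i+1) + 2 D <= M(i), which is Hensel's condition for the derivative of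
   order i; D bounds the order of the integer i + 1 appearing in its linear coefficient. *)
pose M i := (4 ^ (n - i) * (2 * D + 1))%N.
exists (M 0%N) => P c t l0 sP t0 b0 hP.
have ln l : tterm P c t l != 0 -> (l < n)%N.
  by move=> h; rewrite ltnNge; apply: contraNN h => nl; rewrite tterm_big// (leq_trans sP).
pose Q (l : 'I_n) := tterm P c t l != 0.
pose o (l : 'I_n) := lf_ord (tterm P c t l).
have [l1 Ql1 hl1] := @arg_minP _ _ _ (Ordinal (ln _ b0)) Q o b0.
set nu := o l1 in hl1.
have hb l : vge (tterm P c t l) nu.
  have [->|hl] := eqVneq (tterm P c t l) 0; first by left.
  right; exact: (hl1 (Ordinal (ln _ hl)) hl).
have he := tterm_shift hb.
pose bad i := ~ vge (tterm P (c + t) t i) (nu + (M i)%:Z).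
(* If all Taylor terms at c + t had order above nu, so would those at c, against the choice of
   l1. *)
have ex_bad : exists i, (i < n)%N && `[< bad i >].
  apply: contrapT => nb.
  have h i : vge (tterm P (c + t) t i) (nu + 1).
    have [ni|lt_in] := leqP n i; first by rewrite tterm_big ?(leq_trans sP)//; left.
    have : ~ bad i by move=> hbi; apply: nb; exists i; rewrite lt_in; apply/asboolP.
    move=> /contrapT; apply: vge_le.
    have : (0 < M i)%N by rewrite muln_gt0 expn_gt0 addn1.
    lia.
  by have := tterm_unshift h l1 => /(vge_ordP Ql1); rewrite -/(o l1) -/nu; lia.
(* The least bad index is positive, since the term of index 0 is P(c + t), small by hypothesis.
   After renaming, index i is good and i + 1 is bad. *)
case: (ex_minnP ex_bad) => i /andP[lt_in /asboolP hbad] hmin.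
have i0 : (0 < i)%N.
  rewrite lt0n; apply/eqP => ei; apply: hbad; rewrite ei /tterm nderivn0 expr0 mulr1.
  by apply: vge_le hP; have := hl1 (Ordinal (ln _ b0)) b0; rewrite /o /=; lia.
case: i i0 lt_in hbad hmin => // i _ lt_in hbad hmin.
have good : vge (tterm P (c + t) t i) (nu + (M i)%:Z).
  apply: contrapT => hb'; have := hmin i; rewrite (ltn_trans _ lt_in)//=.
  by rewrite ltnn => h; have : false by apply: h; apply/asboolP.
have MM : (2 * M i.+1 + 2 * D <= M i)%N.
  rewrite /M; have -> : (n - i = (n - i.+1).+1)%N by lia.
  rewrite expnS; have : (0 < 4 ^ (n - i.+1))%N by rewrite expn_gt0.
  move: (4 ^ (n - i.+1))%N => X X0.
  have : (D <= X * D)%N by rewrite leq_pmull.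
  have -> : (X * (2 * D + 1) = 2 * (X * D) + X)%N by ring.
  have -> : (4 * X * (2 * D + 1) = 8 * (X * D) + 4 * X)%N by ring.
  by move: (X * D)%N => Y; lia.
have [e0 oe] := not_vge hbad.
have M1 : (2 * D + 1 <= M i.+1)%N by rewrite /M leq_pmull// expn_gt0.
(* The derivative of order i at c + t + t w, as a polynomial in w. *)
pose h := \poly_(l < size P) tterm P^`N(i) (c + t) t l.
have hl l : h`_l = tterm P^`N(i) (c + t) t l.
  rewrite coef_poly; case: ltnP => // sl.
  by rewrite tterm_big// (leq_trans (size_nderivn_le P i)).
have ti0 : t ^+ i != 0 by rewrite expf_neq0.
have hlt l : h`_l = (tterm P (c + t) t (i + l) *+ 'C(i + l, i)) / t ^+ i.
  by rewrite hl -tterm_nderivn mulfK.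
pose w := lf_ord (t ^+ i).
(* Badness of i + 1 bounds the order of that Taylor term by nu + M(i+1) - 1; D accounts for the
   factor i + 1. *)
pose b : int := (M i.+1)%:Z - 1 + D%:Z.
have h1 : h`_1 != 0.
  rewrite hlt addn1 binSn -mulr_natl mulf_neq0 ?invr_eq0//.
  by rewrite mulf_neq0// natr_neq0.
have [||||||wr [hw hwr]] := @hensel K h (nu - w) b (b + 1).
- move=> l; rewrite hlt; apply: vge_divl => //; apply: vgeMn.
  by have -> : lf_ord (t ^+ i) + (nu - w) = nu by rewrite /w; lia.
- exact: h1.
- rewrite hlt addn1 binSn -mulr_natl.
  have n1 : (i.+1%:R : K) != 0 by rewrite natr_neq0.
  have n2 : i.+1%:R * tterm P (c + t) t i.+1 != 0 by rewrite mulf_neq0.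
  have n3 : (t ^+ i)^-1 != 0 by rewrite invr_eq0.
  rewrite (lf_ordM n2 n3) (lf_ordM n1 e0) ordV// -/w.
  by have := hD i.+1 (ltnW lt_in); rewrite /b; lia.
- by rewrite /b; lia.
- by lia.
- rewrite hlt addn0 binn mulr1n; apply: vge_divl => //; apply: vge_le good.
  by rewrite -/w /b; lia.
exists i, (c + t + t * wr); split.
- exact: ltn_trans lt_in.
- apply/eqP => P0; move: h1; by rewrite hl P0 tterm_big ?size_poly0// eqxx.
- apply/rootP; rewrite (taylor _ _ (size_nderivn_le P i)) -[RHS]hw [RHS]horner_poly.
  by apply: eq_bigr => l _; rewrite /tterm exprMn mulrA.
- rewrite addrAC subrr add0r; apply: vge_le (vgeM (vge_ord t) hwr).
  by rewrite /b; lia.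
Qed.

End Collision.

(** * Transfer of one coordinate *)

Section AllProp.
Variable X : Type.

(** Used for lists of functions, whose type has no decidable equality for [\in]. *)
Fixpoint allp (Q : X -> Prop) (s : seq X) : Prop :=
  if s is x :: s' then Q x /\ allp Q s' else True.

Lemma allp_cat Q s t : allp Q (s ++ t) <-> allp Q s /\ allp Q t.
Proof. by elim: s => [|x s IH] /=; [tauto|rewrite IH; tauto]. Qed.

Lemma allp_impl (Q Q' : X -> Prop) s : (forall x, Q x -> Q' x) -> allp Q s -> allp Q' s.
Proof. by move=> h; elim: s => //= x s IH [/h ? /IH]. Qed.

End AllProp.

Lemma allp_map X Y (g : Y -> X) Q s : allp Q (map g s) = allp (fun y => Q (g y)) s.
Proof. by elim: s => //= y s ->. Qed.

Lemma allp_mem (Y : eqType) (Q : Y -> Prop) s : allp Q s <-> forall y, y \in s -> Q y.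
Proof.
elim: s => [|x s IH] /=; first by split.
split=> [[qx /IH h] y|h].
  by rewrite in_cons => /orP[/eqP->|/h].
split; first by apply: h; rewrite mem_head.
by apply/IH => y ys; apply: h; rewrite in_cons ys orbT.
Qed.

Lemma allp_pairs X (Y Z : eqType) (g : Y -> Z -> X) Q (s : seq Y) (t : seq Z) :
  allp Q [seq g y z | y <- s, z <- t] <->
  forall y z, y \in s -> z \in t -> Q (g y z).
Proof.
elim: s => [|x s IH] /=; first by split.
rewrite allp_cat IH allp_map allp_mem; split.
  by move=> [h1 h2] y z; rewrite in_cons => /orP[/eqP-> /h1|/h2 h /h].
move=> h; split=> [z zt|y z ys zt]; apply: h => //; first exact: mem_head.
by rewrite in_cons ys orbT.
Qed.

Definition adm (E : Type) (L : seq (E -> int)) (T : int) (o v : E) : Prop :=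
  allp (fun f => adm1 T (f o) (f v)) L.

Definition addform (E : zmodType) (f : E -> int) : Prop :=
  forall u v, f (u + v) = f u + f v.

Lemma adm1_le T T' o v : 0 < T' -> T' <= T -> adm1 T o v -> adm1 T' o v.
Proof.
move=> T0 TT [h1 h2 h3]; split=> h.
- by have [/h1//|h'] := leP T o; rewrite h3//; lia.
- by have [/h2//|h'] := leP o (- T); rewrite h3//; lia.
- by apply: h3; lia.
Qed.

Lemma adm_le E (L : seq (E -> int)) T T' o v :
  0 < T' -> T' <= T -> adm L T o v -> adm L T' o v.
Proof. by move=> T0 TT; apply: allp_impl => f; apply: adm1_le. Qed.

Section Closest.
Variable K : NALocalField0.

(* No cancellation in the Taylor expansion of [P] at [c], up to [N0]. *)
Definition nc (N0 : nat) (P : {poly K}) (c t : K) : Prop :=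
  forall l, tterm P c t l != 0 ->
    P.[c + t] != 0 /\ lf_ord P.[c + t] <= lf_ord (tterm P c t l) + N0%:Z.

Definition rootin (R : seq {poly K}) (x : K) : Prop :=
  exists P, [/\ P \in R, P != 0 & root P x].

Lemma roots_all (R : seq {poly K}) : exists s : seq K,
  (size s <= \sum_(P <- R) size P)%N /\ forall x, rootin R x -> x \in s.
Proof.
elim: R => [|P R [s [hs1 hs2]]]; first by exists [::]; rewrite big_nil; split=> // x [P []].
have [->|P0] := eqVneq P 0.
  exists s; rewrite big_cons size_poly0; split=> // x [Q [+ Q0 rQ]].
  rewrite in_cons => /orP[/eqP e|QR]; first by move: Q0; rewrite e eqxx.
  by apply: hs2; exists Q.
have [s' [hs' hs'']] := roots_seq P0.
exists (s' ++ s); rewrite size_cat big_cons; split; first by rewrite leq_add// ltnW.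
move=> x [Q [+ Q0 rQ]]; rewrite mem_cat in_cons => /orP[/eqP e|QR].
  by rewrite hs''// -e.
by rewrite (hs2 x) ?orbT//; exists Q.
Qed.

(** For the root nearest to y, cancellation beyond N0 would, by [collides] and the closure of R
    under derivation, give a root still nearer. The polynomial ['X] makes 0 a candidate, whence ord
    y <= ord (y - a). *)
Lemma closest_root (R : seq {poly K}) (y : K) n N0 :
  collides K n N0 ->
  (forall P, P \in R -> (size P <= n)%N) ->
  (forall P i x, P \in R -> (i < n)%N -> P^`N(i) != 0 -> root P^`N(i) x -> rootin R x) ->
  'X \in R -> ~ rootin R y ->
  exists a, [/\ rootin R a, y != a, lf_ord y <= lf_ord (y - a) &
    forall P, P \in R -> nc N0 P a (y - a)].
Proof.
move=> hcol hsz hcl hX hy.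
have [s [_ hs]] := roots_all R.
have r0 : rootin R 0 by exists 'X; split; rewrite ?polyX_eq0//; apply/rootP; rewrite hornerX.
have [a [ra ha]] : exists a, rootin R a /\
    forall b, rootin R b -> lf_ord (y - b) <= lf_ord (y - a).
  have : exists a, rootin R a /\
    forall b, b \in s -> rootin R b -> lf_ord (y - b) <= lf_ord (y - a).
    elim: s {hs} => [|x s [a [ra ha]]]; first by exists 0.
    have [[rx h]|h] := pselect (rootin R x /\ lf_ord (y - a) < lf_ord (y - x)).
      exists x; split=> // b; rewrite in_cons => /orP[/eqP->//|bs] rb.
      exact: le_trans (ha _ bs rb) (ltW h).
    exists a; split=> // b; rewrite in_cons => /orP[/eqP->|bs] rb; last exact: ha.
    by rewrite leNgt; apply/negP => h'; apply: h.
  by move=> [a [ra ha]]; exists a; split=> // b rb; apply: ha => //; apply: hs.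
have neq b : rootin R b -> y - b != 0.
  by move=> rb; rewrite subr_eq0; apply/eqP => e; apply: hy; rewrite e.
exists a; split=> //.
- by rewrite -subr_eq0 neq.
- by rewrite -{1}[y]subr0; apply: ha.
move=> P PR l hl; have e : a + (y - a) = y by rewrite addrC subrK.
have [h|/not_vge[h1 h2]] := pselect (vge P.[a + (y - a)]
    (lf_ord (tterm P a (y - a) l) + N0%:Z + 1)); last by split=> //; lia.
exfalso; have [i [b [hi hP hb hv]]] := hcol P a (y - a) l (hsz _ PR) (neq _ ra) hl h.
have rb := hcl P i b PR hi hP hb.
have := ha b rb; move: hv; rewrite e -opprB => hv.
have /vge_ordP : y - b != 0 by apply: neq.
by move=> /(_ (lf_ord (y - a) + 1)); rewrite -[y - b]opprK => /(_ (vgeN hv)); lia.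
Qed.

End Closest.

Section Transfer.
Variables (A : comNzRingType) (K : NALocalField0).
Implicit Type (S : {rmorphism A -> K} -> K -> Prop).

Local Notation ap phi P y := ((map_poly phi P).[y]).

(* The points [y] with [S phi y] can be transferred along matched, shifted
   coefficients: [o] records the orders of the quantities at hand on the [K]-side
   (with auxiliary ones in [W]) and [v] the shifts of these orders. *)
Definition TRat S (Phi : seq {poly A}) (N : nat) :=
  exists (Psi : seq A) (N' : nat) (W : zmodType)
    (L : seq ((A -> int) * W * ({poly A} -> int) -> int)) (T : int),
  [/\ (0 < N')%N, 0 < T, allp (@addform _) L &
   forall (phi : {rmorphism A -> K}) (y : K), S phi y -> exists w : W,
   forall (oA : A -> int) (oB : {poly A} -> int),
     (forall a, a \in Psi -> oA a = lf_ord (phi a)) ->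
     (forall P, P \in Phi -> oB P = lf_ord (ap phi P y)) ->
   forall (F : NALocalField0) (j : vext K F) (phi' : {rmorphism A -> F})
     (s : A -> int) (u : W) (tau : {poly A} -> int),
     (forall a, a \in Psi -> mt j N' (s a) (phi a) (phi' a)) ->
     adm L T (oA, w, oB) (s, u, tau) ->
   exists y' : F, forall P, P \in Phi -> mt j N (tau P) (ap phi P y) (ap phi' P y')].

Definition TR S := forall (Phi : seq {poly A}) (N : nat), (0 < N)%N -> TRat S Phi N.

Lemma TRat_sub S S' Phi N : (forall phi y, S phi y -> S' phi y) ->
  TRat S' Phi N -> TRat S Phi N.
Proof.
move=> h [Psi [N' [W [L [T [h1 h2 h3 h4]]]]]].
by exists Psi, N', W, L, T; split=> // phi y /h; apply: h4.
Qed.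

Lemma TR_sub S S' : (forall phi y, S phi y -> S' phi y) -> TR S' -> TR S.
Proof. by move=> h H Phi N N0; apply: TRat_sub h (H Phi N N0). Qed.

(** The auxiliary groups are multiplied, and the component belonging to the other case is set to
    0. *)
Lemma TRat_or S1 S2 Phi N : TRat S1 Phi N -> TRat S2 Phi N ->
  TRat (fun phi y => S1 phi y \/ S2 phi y) Phi N.
Proof.
move=> [Psi1 [N1 [W1 [L1 [T1 [h1 h2 h3 h4]]]]]].
move=> [Psi2 [N2 [W2 [L2 [T2 [g1 g2 g3 g4]]]]]].
pose E := ((A -> int) * (W1 * W2)%type * ({poly A} -> int))%type.
pose p1 (v : E) := (v.1.1, v.1.2.1, v.2).
pose p2 (v : E) := (v.1.1, v.1.2.2, v.2).
exists (Psi1 ++ Psi2), (maxn N1 N2), (W1 * W2)%type.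
exists ([seq (fun v => f (p1 v)) | f <- L1] ++ [seq (fun v => f (p2 v)) | f <- L2]).
exists (Num.max T1 T2); split.
- by rewrite leq_max h1.
- by rewrite lt_max h2.
- rewrite allp_cat !allp_map; split.
    by apply: allp_impl h3 => f hf u v; rewrite -hf.
  by apply: allp_impl g3 => f hf u v; rewrite -hf.
move=> phi y [/h4[w hw]|/g4[w hw]].
- exists (w, 0) => oA oB hA hB F j phi' s u tau hs.
  rewrite /adm allp_cat !allp_map => -[hadm _].
  apply: (hw oA oB _ hB F j phi' s u.1 tau).
  + by move=> a ha; apply: hA; rewrite mem_cat ha.
  + move=> a ha; apply: (mt_le (leq_maxl N1 N2)); apply: hs; by rewrite mem_cat ha.
  + by apply: (adm_le h2 _ hadm); rewrite le_max lexx.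
- exists (0, w) => oA oB hA hB F j phi' s u tau hs.
  rewrite /adm allp_cat !allp_map => -[_ hadm].
  apply: (hw oA oB _ hB F j phi' s u.2 tau).
  + by move=> a ha; apply: hA; rewrite mem_cat ha orbT.
  + move=> a ha; apply: (mt_le (leq_maxr N1 N2)); apply: hs; by rewrite mem_cat ha orbT.
  + by apply: (adm_le g2 _ hadm); rewrite le_max lexx orbT.
Qed.

Lemma TR_or S1 S2 : TR S1 -> TR S2 -> TR (fun phi y => S1 phi y \/ S2 phi y).
Proof. by move=> H1 H2 Phi N N0; apply: TRat_or; [exact: H1|exact: H2]. Qed.

Lemma TR_false S : (forall phi y, ~ S phi y) -> TR S.
Proof.
move=> hS Phi N N0; exists [::], 1%N, int, [::], 1; split=> // phi y h.
by case: (hS _ _ h).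
Qed.

Lemma TR_seq (X : eqType) (Q : seq X) (S : X -> {rmorphism A -> K} -> K -> Prop) :
  (forall x, x \in Q -> TR (S x)) -> TR (fun phi y => exists x, x \in Q /\ S x phi y).
Proof.
elim: Q => [|x Q IH] h; first by apply: TR_false => phi y [x []].
apply: (@TR_sub _ (fun phi y => S x phi y \/ exists x, x \in Q /\ S x phi y)).
  move=> phi y [z []]; rewrite in_cons => /orP[/eqP->|zQ] hz; first by left.
  by right; exists z.
apply: TR_or; first by apply: h; rewrite mem_head.
by apply: IH => z zQ; apply: h; rewrite in_cons zQ orbT.
Qed.

(** Listing as a form the difference of two orders that agree forces their shifts to agree; this is
    how identities between orders are imposed on shifts. *)
Lemma adm1_zero T v : 0 < T -> adm1 T 0 v -> v = 0.
Proof. by move=> T0 [_ _]; apply; rewrite normr0. Qed.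

Lemma TR_zero : TR (fun phi y => y = 0).
Proof.
move=> Phi N N0; exists [seq P`_0 | P : {poly A} <- Phi], N, int.
exists [seq (fun v : (A -> int) * int * ({poly A} -> int) => v.2 P - v.1.1 P`_0)
  | P : {poly A} <- Phi], 1; split=> //.
  rewrite allp_map allp_mem => P _ u v /=.
  by rewrite /= opprD addrACA.
move=> phi y ->; exists 0 => oA oB hA hB F j phi' s u tau hs hadm.
exists 0 => P PPhi; rewrite !horner_coef0 !coef_map /=.
move: hadm; rewrite /adm allp_map allp_mem => /(_ P PPhi) /=.
have P0 : P`_0 \in [seq P`_0 | P : {poly A} <- Phi] by apply/mapP; exists P.
rewrite hB// hA// horner_coef0 coef_map subrr => /(adm1_zero ltr01)/eqP.
by rewrite subr_eq0 => /eqP ->; apply: hs.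
Qed.

End Transfer.

Local Notation ap phi P y := ((map_poly phi P).[y]).

Section Points.
Variables (A : comNzRingType) (B : NALocalField0) (phi : {rmorphism A -> B}).
Implicit Types (P : {poly A}) (a t : B).

Lemma size_map_le P : (size (map_poly phi P) <= size P)%N.
Proof. exact: size_poly. Qed.

Lemma ttermE P a t l : tterm (map_poly phi P) a t l = ap phi P^`N(l) a * t ^+ l.
Proof. by rewrite /tterm nderivn_map. Qed.

Lemma ord_tterm P a t l : tterm (map_poly phi P) a t l != 0 ->
  lf_ord (tterm (map_poly phi P) a t l) = lf_ord (ap phi P^`N(l) a) + l%:Z * lf_ord t.
Proof.
rewrite ttermE mulf_eq0 negb_or => /andP[h1 h2]; rewrite lf_ordM//.
case: l h1 h2 => [|l] h1 h2; first by rewrite expr0 ord_one mul0r.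
by rewrite ordX//; move: h2; rewrite expf_eq0.
Qed.

End Points.

Lemma deriv_taylor (B : NALocalField0) (P : {poly B}) (c t : B) n :
  (size P <= n)%N -> P^`N(1).[c + t] * t = \sum_(l < n) tterm P c t l *+ l.
Proof.
case: n => [|n] hn.
  move: hn; rewrite leqn0 size_poly_eq0 => /eqP ->.
  by rewrite big_ord0 nderivn_poly0 ?size_poly0// horner0 mul0r.
rewrite big_ord_recl mulr0n add0r (@taylor _ _ _ _ n); last first.
  by apply: leq_trans (size_poly _ _) _; lia.
rewrite mulr_suml; apply: eq_bigr => l _.
by rewrite -{2}[t]expr1 tterm_nderivn add1n bin1.
Qed.

Section Step.
Variables (A : comNzRingType) (K F : NALocalField0) (j : vext K F).
Variables (phi : {rmorphism A -> K}) (phi' : {rmorphism A -> F}).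
Local Notation e := (vx_e j)%:Z.

(** The Taylor terms match with shifts [sb l + l%:Z * kap], and [nc] supplies the cancellation bound
    required by [mt_sum]. *)
Lemma step_sum (P : {poly A}) (a t : K) (a' t' : F) (sb : nat -> int)
    (kap tau : int) (n N N0 N1 : nat) (T : int) :
  (size P <= n)%N -> (0 < N)%N -> (N + N0 <= N1)%N -> (N + N0)%N%:Z <= T ->
  (forall l, (l < n)%N -> mt j N1 (sb l) (ap phi P^`N(l) a) (ap phi' P^`N(l) a')) ->
  mt j N1 kap t t' -> nc N0 (map_poly phi P) a t ->
  (forall l, (l < n)%N -> adm1 T
     (lf_ord (ap phi P^`N(l) a) + l%:Z * lf_ord t - lf_ord (ap phi P (a + t)))
     (sb l + l%:Z * kap - tau)) ->
  mt j N tau (ap phi P (a + t)) (ap phi' P (a' + t')).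
Proof.
move=> sP N_gt0 hN1 hT hb ht hnc hadm.
have s1 := leq_trans (size_map_le phi P) sP.
have s2 := leq_trans (size_map_le phi' P) sP.
have e1 := taylor a t s1; have e2 := taylor a' t' s2.
rewrite e1 e2; apply: (mt_sum (N0 := N0) (N1 := N1) (T := T)
  (a := fun l => tterm (map_poly phi P) a t l)
  (b := fun l => tterm (map_poly phi' P) a' t' l)
  (s := fun l => sb l + l%:Z * kap)) => //.
- by move=> l ln; rewrite !ttermE; apply: mtM; [exact: hb|exact: mtX].
- by move=> l ln /hnc; rewrite -e1.
- by move=> l ln h; rewrite ord_tterm// -e1; exact: hadm.
Qed.

Lemma mt_natr N n : mt j N 0 n%:R n%:R.
Proof. by exists 0; split; [left|rewrite expr0z mul1r addr0 mulr1 rmorph_nat]. Qed.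

(** Serves to pass from Taylor terms to their integer multiples, which have larger orders and the
    same shifts. *)
Lemma adm1_mono T o o1 v : 0 < T -> 0 <= o -> o <= o1 -> adm1 T o v -> adm1 T o1 v.
Proof.
move=> T0 o0 oo [h1 h2 h3]; split.
- by move=> _; have [/h1//|h] := leP T o; rewrite h3//; lia.
- lia.
- by move=> h; apply: h3; lia.
Qed.

(* Newton approximation transfers a simple root [a + t] from [K] to [F]. *)
Lemma step_root (P : {poly A}) (a t : K) (a' : F) (sb : nat -> int)
    (kap : int) (n N0 N1 D : nat) (T : int) :
  (size P <= n)%N -> (2 * (N0 + D) < N1)%N -> N1%:Z <= T ->
  (forall k, (k < n)%N -> lf_ord (k%:R : K) <= D%:Z) ->
  t != 0 -> ap phi P (a + t) = 0 -> ap phi P^`N(1) (a + t) != 0 ->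
  nc N0 (map_poly phi P^`N(1)) a t ->
  (forall l, (l < n)%N -> mt j N1 (sb l) (ap phi P^`N(l) a) (ap phi' P^`N(l) a')) ->
  (forall l l', (l < n)%N -> (l' < n)%N -> adm1 T
     ((lf_ord (ap phi P^`N(l) a) + l%:Z * lf_ord t) -
      (lf_ord (ap phi P^`N(l') a) + l'%:Z * lf_ord t))
     ((sb l + l%:Z * kap) - (sb l' + l'%:Z * kap))) ->
  exists t' : F, mt j (N1 - (N0 + D)) kap t t' /\ ap phi' P (a' + t') = 0.
Proof.
move=> sP hN1 hT hD t0 hroot hder hnc hb hadm.
set p := map_poly phi P; set p' := map_poly phi' P.
have s1 : (size p <= n)%N := leq_trans (size_map_le phi P) sP.
have s2 : (size p' <= n)%N := leq_trans (size_map_le phi' P) sP.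
have e0 := vx_gt0 j; have T0 : 0 < T by lia.
pose bt l := tterm p a t l.
have btE l : bt l = ap phi P^`N(l) a * t ^+ l by rewrite /bt ttermE.
pose D1 := p^`N(1).[a + t] * t.
have D1E : D1 = \sum_(l < n) bt l *+ l := deriv_taylor a t s1.
have D1_neq0 : D1 != 0 by rewrite /D1 nderivn_map mulf_neq0.
have ex_l : exists l : 'I_n, (bt l != 0) && (0 < l)%N.
  apply: contrapT => hn; move: D1_neq0; rewrite D1E big1 ?eqxx// => l _.
  case: (posnP l) => [->|l0]; first by rewrite mulr0n.
  have [->|bl] := eqVneq (bt l) 0; first by rewrite mul0rn.
  by case: hn; exists l; rewrite bl.
have [lx Qlx] := ex_l.
pose Q (l : 'I_n) := (bt l != 0) && (0 < l)%N.
have [l0 /andP[bl0 l0_gt0] hmin] := @arg_minP _ _ _ lx Q (fun l => lf_ord (bt l)) Qlx.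
set mu := lf_ord (bt l0) in hmin.
have hmin' l : (0 < l)%N -> vge (bt l) mu.
  move=> l_gt0; have [->|bl] := eqVneq (bt l) 0; first by left.
  have ln : (l < n)%N.
    rewrite ltnNge; apply: contraNN bl => nl.
    by rewrite /bt tterm_big// (leq_trans s1).
  by right; apply: (hmin (Ordinal ln)); rewrite /Q bl.
have sum0 : \sum_(l < n) bt l = 0 by rewrite -(taylor a t s1).
have n_gt0 : (0 < n)%N by apply: leq_trans (ltn_ord l0).
(* At a root the Taylor terms sum to zero, so the constant term is bounded by those of positive
   degree. *)
have hbt l : vge (bt l) mu.
  case: (posnP l) => [->|l_gt0]; last exact: hmin'.
  move: sum0; rewrite (bigD1 (Ordinal n_gt0))//= => /eqP; rewrite addr_eq0 => /eqP ->.
  by apply: vgeN; apply: vge_sum => i i0; apply: hmin'; rewrite lt0n; apply: contraNneq i0 => i0; apply/eqP/val_inj.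
pose st := sb l0 + l0%:Z * kap.
(* First approximation to the increment; Hensel's lemma corrects it to T1 (1 + w). *)
pose T1 := j (unif K ^ kap * t).
have hT1 : mt j N1 kap t T1 by apply: mt_sh.
have hbt' l : (l < n)%N -> mt j N1 (sb l + l%:Z * kap) (bt l) (tterm p' a' T1 l).
  by move=> ln; rewrite btE ttermE; apply: mtM; [exact: hb|exact: mtX].
have hadm' l : (l < n)%N -> bt l != 0 ->
    adm1 T (lf_ord (bt l) - mu) (sb l + l%:Z * kap - st).
  move=> ln bl; rewrite /mu /bt !ord_tterm//; exact: hadm.
have err0 : vge p'.[a' + T1] (e * (mu + st + N1%:Z)).
  have := sum_err hT (leqnn _) hbt' (fun l _ => hbt l) hadm'.
  by rewrite sum0 mulr0 rmorph0 subr0 (taylor a' T1 s2).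
pose D1' := p'^`N(1).[a' + T1] * T1.
have D1'E : D1' = \sum_(l < n) tterm p' a' T1 l *+ l := deriv_taylor a' T1 s2.
have err1 : vge (D1' - j (unif K ^ st * D1)) (e * (mu + st + N1%:Z)).
  rewrite D1'E D1E.
  apply: (@sum_err _ _ j n (fun l => bt l *+ l) (fun l => tterm p' a' T1 l *+ l)
     (fun l => sb l + l%:Z * kap) st mu N1 N1 T hT (leqnn _)).
  - move=> l ln; rewrite -mulr_natl -[X in mt _ _ _ _ X]mulr_natl -[X in mt _ _ X]add0r.
    by apply: mtM; [exact: mt_natr|exact: hbt'].
  - by move=> l _; apply: vgeMn.
  - move=> l ln; rewrite -mulr_natl mulf_eq0 negb_or => /andP[l1 l2].
    apply: adm1_mono (hadm' l ln l2) => //.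
      by rewrite subr_ge0; apply: vge_ordP.
    rewrite (lf_ordM l1 l2) lerD2r lerDr; apply: (vge_ordP l1); exact: vge_natr.
(* The term of index l0 reappears in the derivative multiplied by l0, which costs D, and the absence
   of cancellation in the derivative costs N0. *)
have D1_le : lf_ord D1 <= mu + (N0 + D)%N%:Z.
  pose l1 := l0.-1; have l1E : (l1.+1 = l0)%N by rewrite /l1 prednK.
  have e1 : tterm p^`N(1) a t l1 * t = bt l0 *+ l0.
    by rewrite -{2}[t]expr1 tterm_nderivn add1n bin1 l1E.
  have nz : bt l0 *+ l0 != 0 by rewrite -mulr_natl mulf_neq0// natr_neq0.
  have nz1 : tterm p^`N(1) a t l1 != 0.
    by apply: contraNneq nz; rewrite -e1 => ->; rewrite mul0r.
  have [hd1 hd2] : p^`N(1).[a + t] != 0 /\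
      lf_ord p^`N(1).[a + t] <= lf_ord (tterm p^`N(1) a t l1) + N0%:Z.
    by move: nz1; rewrite /p nderivn_map; apply: hnc.
  have := congr1 (@lf_ord K) e1.
  rewrite (lf_ordM nz1 t0) -mulr_natl (lf_ordM (natr_neq0 K l0_gt0) bl0).
  rewrite /D1 (lf_ordM hd1 t0) -/mu => eo.
  by have := hD l0 (ltn_ord l0); lia.
have D1s : j (unif K ^ st * D1) != 0 by apply: sh_neq0.
have oD1s : lf_ord (j (unif K ^ st * D1)) <= e * (mu + st) + e * (N0 + D)%N%:Z.
  by rewrite ord_sh// -mulrDr ler_pM2l//; lia.
have [D1'_neq0 oD1'] : D1' != 0 /\ lf_ord D1' = lf_ord (j (unif K ^ st * D1)).
  have [] := @ord_dom _ (j (unif K ^ st * D1)) (D1' - j (unif K ^ st * D1)) D1s.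
    apply: vge_le err1; apply: (le_trans (lerD oD1s (lexx 1))).
    rewrite -mulrDr; apply: (@le_trans _ _ (e * (mu + st + (N0 + D)%N%:Z) + e)).
      by rewrite lerD2l; lia.
    by rewrite -[X in _ + X]mulr1 -mulrDr ler_pM2l//; lia.
  by rewrite addrC subrK.
pose h := \poly_(l < size p') tterm p' (a' + T1) T1 l.
have hl l : h`_l = tterm p' (a' + T1) T1 l.
  by rewrite coef_poly; case: ltnP => // sl; rewrite tterm_big.
have hv l : vge (tterm p' a' T1 l) (e * (mu + st)).
  have [ln|nl] := ltnP l n; last by rewrite tterm_big ?(leq_trans s2)//; left.
  have [bl|bl] := eqVneq (bt l) 0.
    have [u [_ ->]] := hbt' l ln; rewrite bl mulr0 rmorph0 mul0r; by left.
  have [h1 _ h3] := hadm' l ln bl; have := vge_ordP bl (hbt l) => hmu.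
  have st0 : 0 <= sb l + l%:Z * kap - st.
    by have [/h1//|hT'] := leP T (lf_ord (bt l) - mu); rewrite h3//; lia.
  by apply: vge_le (mt_vge (hbt' l ln) (vge_ord _)); rewrite ler_pM2l//; lia.
have h1E : h`_1 = D1' by rewrite hl /tterm expr1.
(* Here Hensel's condition reads N0 + D < N1 - (N0 + D), and the right-hand side is the precision
   left to the increment. *)
have [||||||w [hw1 hw2]] := @hensel F h (e * (mu + st)) (e * (N0 + D)%N%:Z)
    (e * (N1 - (N0 + D))%N%:Z).
- by move=> l; rewrite hl; apply: tterm_shift.
- by rewrite h1E.
- by rewrite h1E oD1'.
- by rewrite mulr_ge0// ltW.
- by rewrite ltr_pM2l//; lia.
- rewrite hl /tterm nderivn0 expr0 mulr1; apply: vge_le err0.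
  by rewrite -!mulrDr ler_pM2l//; lia.
exists (T1 * (1 + w)); split; first by exists w.
rewrite -[RHS]hw1 [RHS]horner_poly mulrDr mulr1 addrA (taylor _ _ (leqnn _)).
by apply: eq_bigr => l _; rewrite /tterm exprMn mulrA.
Qed.

End Step.

Lemma fct_addE X (u v : X -> int) x : (u + v) x = u x + v x. Proof. by []. Qed.
Lemma pair_add1 (U V : zmodType) (u v : U * V) : (u + v).1 = u.1 + v.1. Proof. by []. Qed.
Lemma pair_add2 (U V : zmodType) (u v : U * V) : (u + v).2 = u.2 + v.2. Proof. by []. Qed.

(** * Transfer of roots of polynomials *)

Section Root.
Variables (A : comNzRingType) (K : NALocalField0).

Definition dcl (n : nat) (s : seq {poly A}) : seq {poly A} :=
  [seq G^`N(l) | G <- s, l <- iota 0 n].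

Definition isroot (P : {poly A}) (phi : {rmorphism A -> K}) (y : K) :=
  map_poly phi P != 0 /\ root (map_poly phi P) y.

Definition center (R : seq {poly A}) (phi : {rmorphism A -> K}) (a : K) :=
  a = 0 \/ exists Q, Q \in R /\ isroot Q phi a.

Lemma mem_dcl n s G l : G \in s -> (l < n)%N -> G^`N(l) \in dcl n s.
Proof. by move=> Gs ln; apply/allpairsP; exists (G, l); rewrite mem_iota. Qed.

Lemma dclP n s Q : Q \in dcl n s -> exists G l, [/\ G \in s, (l < n)%N & Q = G^`N(l)].
Proof.
by move=> /allpairsP[[G l] /= [Gs + ->]]; rewrite mem_iota => /andP[_ ln]; exists G, l.
Qed.

Lemma sub_dcl n s G : (0 < n)%N -> G \in s -> G \in dcl n s.
Proof. by move=> n0 Gs; rewrite -[G]nderivn0; apply: mem_dcl. Qed.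

Lemma rootin_map (phi : {rmorphism A -> K}) R y :
  rootin (map (map_poly phi) R) y <-> exists Q, Q \in R /\ isroot Q phi y.
Proof.
split=> [[p [/mapP[Q QR ->] p0 rp]]|[Q [QR [q0 rq]]]]; first by exists Q.
by exists (map_poly phi Q); split=> //; apply: map_f.
Qed.

Lemma dcl_closed n (s : seq {poly A}) (phi : {rmorphism A -> K}) (p : {poly K}) i x :
  (forall G, G \in s -> (size G <= n)%N) ->
  p \in map (map_poly phi) (dcl n s) -> p^`N(i) != 0 -> root p^`N(i) x ->
  rootin (map (map_poly phi) (dcl n s)) x.
Proof.
move=> hs /mapP[_ /dclP[G [l [Gs ln ->]]] ->].
rewrite nderivn_map nderivn_comp rmorphMn /= => p0 rp.
have p1 : map_poly phi G^`N(l + i) != 0 by apply: contraNneq p0 => ->; rewrite mul0rn.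
have c0 : (0 < 'C(l + i, l))%N.
  by rewrite lt0n; apply: contraNneq p0 => ->; rewrite mulr0n.
exists (map_poly phi G^`N(l + i)); split=> //.
  apply/map_f/mem_dcl => //; rewrite ltnNge; apply: contraNN p1 => h.
  by rewrite nderivn_poly0 ?raddf0// (leq_trans (hs _ Gs)).
move: rp; rewrite /root hornerMn -mulr_natl mulf_eq0 => /orP[|//].
by rewrite (negPf (natr_neq0 K c0)).
Qed.

(** Adjoining ['X] to the family adds only the root 0: its further derivatives are 1, without roots,
    and the zero polynomial. This explains the extra case of [center]. *)
Lemma closest_center n (s : seq {poly A}) N0 (phi : {rmorphism A -> K}) y :
  collides K n N0 ->
  (1 < n)%N -> (forall G, G \in s -> (size G <= n)%N) ->
  y != 0 -> ~ (exists Q, Q \in dcl n s /\ isroot Q phi y) ->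
  exists a, [/\ center (dcl n s) phi a, y != a, lf_ord y <= lf_ord (y - a) &
    forall P, P \in dcl n s -> nc N0 (map_poly phi P) a (y - a)].
Proof.
move=> hcol n1 hs y0 hy.
have hs' G : G \in 'X :: s -> (size G <= n)%N.
  by rewrite in_cons => /orP[/eqP->|/hs//]; rewrite size_polyX.
have hX a : rootin (map (map_poly phi) (dcl n ('X :: s))) a <-> center (dcl n s) phi a.
  rewrite rootin_map; split.
    move=> [Q [/dclP[G [l [+ ln ->]]] hQ]]; rewrite in_cons => /orP[/eqP eG|Gs]; last first.
      by right; exists G^`N(l); split=> //; apply: mem_dcl.
    left; move: hQ; rewrite /isroot eG -nderivn_map map_polyX -['X]expr1 nderivnXn.
    case: l {ln} => [|[|l]].
    - by rewrite subn0 bin0 expr1 => -[_ /rootP]; rewrite hornerX.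
    - by rewrite subnn binn expr0 => -[_ /rootP/eqP]; rewrite hornerC oner_eq0.
    - by rewrite bin_small// mulr0n eqxx => -[].
  move=> [->|[Q [/dclP[G [l [Gs ln ->]]] hQ]]].
    exists 'X; split; first by apply: sub_dcl; rewrite ?mem_head// ltnW.
    by rewrite /isroot map_polyX polyX_eq0; split=> //; apply/rootP; rewrite hornerX.
  by exists G^`N(l); split=> //; apply: mem_dcl => //; rewrite in_cons Gs orbT.
have [||||a [h1 h2 h3 h4]] := @closest_root K (map (map_poly phi) (dcl n ('X :: s))) y n N0 hcol.
- move=> p /mapP[_ /dclP[G [l [Gs ln ->]]] ->].
  apply: leq_trans (size_map_le _ _) _; apply: leq_trans (size_poly _ _) _.
  exact: leq_trans (leq_subr _ _) (hs' _ Gs).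
- by move=> p i x hp _; apply: dcl_closed.
- apply/mapP; exists 'X; last by rewrite map_polyX.
  by apply: sub_dcl; rewrite ?mem_head// ltnW.
- by move/hX => [/eqP|//]; rewrite (negPf y0).
exists a; split=> //; first exact/hX.
move=> P /dclP[G [l [Gs ln ->]]]; apply: h4; apply/map_f/mem_dcl => //.
by rewrite in_cons Gs orbT.
Qed.

Section Main.
Variables (P : {poly A}) (Phi : seq {poly A}) (N N0 D : nat).
Hypothesis N_gt0 : (0 < N)%N.
Hypothesis hD : forall k, (k <= size P)%N -> lf_ord (k%:R : K) <= D%:Z.
Local Notation n := (size P).
Hypothesis n_gt1 : (1 < n)%N.

(* Besides the derivatives, pseudo-remainders modulo [P] are needed: at a root of [P] they determine
   the values of the polynomials of [Phi], and their degrees are smaller than that of [P]. *)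
Definition root_base : seq {poly A} :=
  [seq P^`N(i) | i <- iota 1 n] ++ [seq Pdiv.Ring.rmodp Q P | Q : {poly A} <- Phi].
Local Notation R := (dcl n root_base).

Lemma size_root_base G : G \in root_base -> (size G < n)%N.
Proof.
have n0 : (0 < n)%N := ltnW n_gt1.
have P0 : P != 0 by rewrite -size_poly_gt0.
rewrite mem_cat => /orP[/mapP[i + ->]|/mapP[Q _ ->]].
  rewrite mem_iota => /andP[i1 _]; apply: leq_ltn_trans (size_poly _ _) _.
  by rewrite ltn_subrL i1.
exact: Pdiv.Ring.ltn_rmodpN0.
Qed.

Lemma size_root_dcl G : G \in R -> (size G < n)%N.
Proof.
move=> /dclP[H [l [/size_root_base h _ ->]]].
exact: leq_ltn_trans (size_poly _ _) (leq_ltn_trans (leq_subr _ _) h).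
Qed.

(** The generic case: a simple root of P, distinct from its centre, where the formal leading
    coefficient survives. Every other root of P is a root of the truncation or of the derivative of
    P, or is itself a centre. *)
Definition root_gen (phi : {rmorphism A -> K}) (c : K) := exists a,
  [/\ center R phi a, c != a, phi (lead_coef P) != 0, ap phi P c = 0 &
      ap phi P^`N(1) c != 0 /\ forall Q, Q \in R -> nc N0 (map_poly phi Q) a (c - a)].

(** The centre transfers by hypothesis, and the increment c - a by [step_root]. A value Q(c) is then
    that of the pseudo-remainder of Q modulo P, divided by a power of the leading coefficient. *)
Lemma TRat_root_gen : TR (center R) -> TRat root_gen Phi N.
Proof.
(* Newton's condition asks for more than 2 (N0 + D); finding the increment costs N0 + D, and
   evaluating at the root another N0, which leaves at least N. *)
pose N1 := (N + N0 + 2 * (N0 + D) + 1)%N.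
have N1_gt0 : (0 < N1)%N by rewrite /N1; lia.
move=> /(_ (P :: R) N1 N1_gt0) [Psi [N' [W [L [T [h1 h2 h3 h4]]]]]].
(* Auxiliary orders: those for the centre, the values of polynomials at the centre a, the increment
   c - a, and the values of polynomials at c. *)
pose W' := (W * ({poly A} -> int) * int * ({poly A} -> int))%type.
pose E := ((A -> int) * W' * ({poly A} -> int))%type.
pose sA (v : E) := v.1.1. pose sW (v : E) := v.1.2.1.1.1.
pose sa (v : E) := v.1.2.1.1.2. pose st (v : E) := v.1.2.1.2.
pose sc (v : E) := v.1.2.2. pose sB (v : E) := v.2.
pose f0 f (v : E) : int := f (sA v, sW v, sa v).
pose f1 (l l' : nat) (v : E) : int :=
  (sa v P^`N(l) + l%:Z * st v) - (sa v P^`N(l') + l'%:Z * st v).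
pose f2 (G : {poly A}) (l : nat) (v : E) : int := sa v G^`N(l) + l%:Z * st v - sc v G.
(* By pseudo-division this form vanishes on the actual orders when Q(c) is nonzero, which determines
   the shift of Q. *)
pose f3 (Q : {poly A}) (v : E) : int := sB v Q - sc v (Pdiv.Ring.rmodp Q P)
    + (Pdiv.Ring.rscalp Q P)%:Z * sA v (lead_coef P).
pose L' := map f0 L ++ [seq f1 l l' | l <- iota 0 n, l' <- iota 0 n]
  ++ [seq f2 G l | G <- root_base, l <- iota 0 n] ++ map f3 Phi.
pose T' := Num.max T N1%:Z.
exists (lead_coef P :: Psi), (maxn N' N), W', L', T'; split.
- by rewrite leq_max h1.
- by rewrite lt_max h2.
- rewrite !allp_cat !allp_map !allp_pairs; split; [|split; [|split]].
  + by apply: allp_impl h3 => f hf u v; rewrite /f0 -hf.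
  + move=> l l' _ _ u v; rewrite /f1 /sa /st !(pair_add1, pair_add2, fct_addE); ring.
  + move=> G l _ _ u v; rewrite /f2 /sa /st /sc !(pair_add1, pair_add2, fct_addE); ring.
  + apply/allp_mem => Q _ u v; rewrite /f3 /sA /sB /sc !(pair_add1, pair_add2, fct_addE); ring.
move=> phi c [a [ha ca lc0 Pc [Pc' hnc]]].
have [w hw] := h4 phi a ha.
pose t := c - a; have act : a + t = c by rewrite addrC subrK.
have t0 : t != 0 by rewrite subr_eq0.
pose oa (G : {poly A}) := lf_ord (ap phi G a); pose oc (G : {poly A}) := lf_ord (ap phi G c).
exists (w, oa, lf_ord t, oc) => oA oB hA hB F j phi' s [[[uW ua] ut] uc] tau hs.
rewrite /adm !allp_cat !allp_map !allp_pairs => -[ad0 [ad1 [ad2 /allp_mem ad3]]].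
have hA' x : x \in Psi -> oA x = lf_ord (phi x).
  by move=> hx; apply: hA; rewrite in_cons hx orbT.
have hs' x : x \in Psi -> mt j N' (s x) (phi x) (phi' x).
  by move=> hx; apply: (mt_le (leq_maxl N' N)); apply: hs; rewrite in_cons hx orbT.
have ad0' : adm L T (oA, w, oa) (s, uW, ua).
  by apply: (adm_le h2 (T := T')); [rewrite le_max lexx|rewrite /adm; exact: ad0].
have [a' ha'] := hw oA oa hA' (fun Q _ => erefl) F j phi' s uW ua hs' ad0'.
have hb l : (l < n)%N -> mt j N1 (ua P^`N(l)) (ap phi P^`N(l) a) (ap phi' P^`N(l) a').
  move=> ln; apply: ha'; case: l ln => [|l] ln; first by rewrite nderivn0 mem_head.
  rewrite in_cons; apply/orP; right; apply: sub_dcl; first lia.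
  by rewrite mem_cat; apply/orP; left; apply: map_f; rewrite mem_iota; lia.
have T'_ge : N1%:Z <= T' by rewrite le_max lexx orbT.
have P1R : P^`N(1) \in R.
  apply: sub_dcl; first lia.
  by rewrite mem_cat; apply/orP; left; apply: map_f; rewrite mem_iota; lia.
have [||||||||||t' [ht' hroot]] := @step_root A K F j phi phi' P a t a' (fun l => ua P^`N(l))
   ut n N0 N1 D T'.
- by [].
- by rewrite /N1; lia.
- by [].
- by move=> k kn; apply: hD; apply: ltnW.
- by [].
- by rewrite act.
- by rewrite act.
- exact: hnc.
- by [].
- move=> l l' ln ln'; have := ad1 l l'; rewrite !mem_iota /= !add0n => /(_ ln ln').
  by [].
pose c' := a' + t'; exists c' => Q QPhi.
have hG G : G \in root_base -> mt j N (uc G) (ap phi G c) (ap phi' G c').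
  move=> Gs; rewrite -act; apply: (@step_sum A K F j phi phi' G a t a' t'
    (fun l => ua G^`N(l)) ut (uc G) n N N0 (N1 - (N0 + D)) T') => //.
  - exact: ltnW (size_root_base Gs).
  - by rewrite /N1; lia.
  - by apply: le_trans T'_ge; rewrite /N1; lia.
  - move=> l ln; apply: (mt_le (leq_subr (N0 + D) N1)); apply: ha'.
    by rewrite in_cons mem_dcl ?orbT.
  - by apply: hnc; apply: sub_dcl => //; lia.
  - by move=> l ln; have := ad2 G l Gs; rewrite mem_iota /= add0n => /(_ ln); rewrite act.
pose r := Pdiv.Ring.rmodp Q P; pose k := Pdiv.Ring.rscalp Q P.
have rs : r \in root_base by rewrite mem_cat; apply/orP; right; apply: map_f.
have lcm : mt j N (s (lead_coef P)) (phi (lead_coef P)) (phi' (lead_coef P)).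
  by apply: (mt_le (leq_maxr N' N)); apply: hs; rewrite mem_head.
have divE (B : NALocalField0) (psi : {rmorphism A -> B}) x : psi (lead_coef P) != 0 ->
    ap psi P x = 0 -> ap psi Q x = ap psi r x * (psi (lead_coef P) ^+ k)^-1.
  move=> l0 Px; have := congr1 (fun q => ap psi q x) (Pdiv.ComRing.rdivp_eq P Q).
  rewrite /= map_polyZ rmorphD rmorphM /= hornerZ hornerD hornerM Px mulr0 add0r.
  by rewrite rmorphXn => <-; rewrite mulrC mulKf// expf_neq0.
have lc0' : phi' (lead_coef P) != 0 by rewrite (mt_eq0 N_gt0 lcm).
have -> := divE F phi' c' lc0' hroot; rewrite (divE K phi c lc0 Pc).
have hr := hG r rs.
have hm := mtM hr (mtV N_gt0 (mtX k lcm)).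
have [r0|r0] := eqVneq (ap phi r c) 0.
  have : ap phi' r c' == 0 by rewrite (mt_eq0 N_gt0 hr) r0.
  by move=> /eqP ->; rewrite r0 !mul0r; apply: mt_zero.
have ex : phi (lead_coef P) ^+ k != 0 by rewrite expf_neq0.
have := ad3 Q QPhi; rewrite /f3 /sA /sB /sc /= hB// hA ?mem_head// (divE K phi c lc0 Pc) -/r -/k.
rewrite lf_ordM ?invr_eq0// ordV// ordX// /oc.
have TT' : T <= T' by rewrite le_max lexx.
move=> /(adm1_le h2 TT').
have -> (x y : int) : x + - y - x + y = 0 by ring.
move=> /(adm1_zero h2) e; have -> : tau Q = uc r - k%:Z * s (lead_coef P).
  by lia.
exact: hm.
Qed.

End Main.

(** Replaces P where [phi] kills its formal leading coefficient; the induction runs on the degree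
    over A, not over K. *)
Definition ptrunc (P : {poly A}) : {poly A} := \poly_(i < (size P).-1) P`_i.

Lemma map_ptrunc (phi : {rmorphism A -> K}) P :
  phi (lead_coef P) = 0 -> map_poly phi P = map_poly phi (ptrunc P).
Proof.
rewrite lead_coefE => l0; apply/polyP => i; rewrite !coef_map coef_poly.
case: ltnP => // h; apply: (@etrans _ _ 0); last by symmetry; exact: rmorph0.
have [->|ne] := eqVneq i (size P).-1; first exact: l0.
rewrite nth_default; first exact: rmorph0.
by move: ne h; move: (size P) => m /eqP; lia.
Qed.

(** A root of P is a root of the truncation, a root of the derivative, a centre, or generic. The
    polynomials behind each case, including those defining the centre in the generic one, have
    smaller formal degree. *)
Lemma TR_isroot d : forall P : {poly A}, (size P <= d)%N -> TR (isroot P).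
Proof.
elim: d => [|d IH] P sP.
  apply: TR_false => phi y; move: sP; rewrite leqn0 size_poly_eq0 => /eqP ->.
  by rewrite /isroot raddf0 eqxx => -[].
have [s1|s1] := leqP (size P) 1.
  apply: TR_false => phi y [p0 ry].
  have /size1_polyC e := leq_trans (size_map_le phi P) s1.
  by move: p0 ry; rewrite e polyC_eq0 rootC => /negPf ->.
have P0 : P != 0 by rewrite -size_poly_eq0; lia.
move=> Phi N N_gt0; have [N0 hcol] := collision K (size P).
have [D hD] := ord_natr_bound K (size P).
pose R := dcl (size P) (root_base P Phi).
have TRroots : TR (fun phi c => exists Q, Q \in R /\ isroot Q phi c).
  apply: TR_seq => Q QR; apply: IH; rewrite -ltnS; apply: leq_trans sP.
  exact: (size_root_dcl s1 QR).
have TRR : TR (center R) by apply: TR_or => //; exact: TR_zero.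
have TRt : TR (isroot (ptrunc P)).
  apply: IH; rewrite -ltnS; apply: leq_trans sP; apply: leq_ltn_trans (size_poly _ _) _; lia.
have TRd : TR (isroot P^`N(1)).
  apply: IH; rewrite -ltnS; apply: leq_trans sP; apply: leq_ltn_trans (size_poly _ _) _; lia.
apply: (@TRat_sub _ _ _ (fun phi c => isroot (ptrunc P) phi c \/ isroot P^`N(1) phi c \/
  center R phi c \/ root_gen P Phi N0 phi c)); last first.
  apply: TRat_or; first exact: (TRt Phi N N_gt0).
  apply: TRat_or; first exact: (TRd Phi N N_gt0).
  apply: TRat_or; first exact: (TRR Phi N N_gt0).
  exact: (@TRat_root_gen P Phi N N0 D N_gt0 hD s1 TRR).
move=> phi c [p0 /rootP rc].
have [l0|l0] := eqVneq (phi (lead_coef P)) 0.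
  by left; rewrite /isroot -map_ptrunc//; split=> //; apply/rootP.
right; have [d0|d0] := eqVneq (ap phi P^`N(1) c) 0.
  left; split; last exact/rootP.
  (* The derivative is not the zero polynomial: its top coefficient is a nonzero integer multiple of
     the leading coefficient, the characteristic being zero. *)
  apply/eqP => e; have := congr1 (fun q : {poly K} => q`_((size P).-2)) e.
  rewrite coef0 coef_map coef_nderivn add1n bin1.
  have -> : (size P).-2.+1 = (size P).-1 by lia.
  move=> e2; have : phi (lead_coef P) *+ (size P).-1 = 0.
    by rewrite -[RHS]e2; symmetry; exact: rmorphMn.
  move=> /eqP; rewrite -mulr_natl mulf_eq0 (negPf l0) orbF; apply/negP.
  by apply: (@natr_neq0 K); lia.
right; have [hc|hc] := pselect (center R phi c); [by left|right].
have [||||a [a1 a2 a3 a4]] := @closest_center (size P) (root_base P Phi) N0 phi c hcol.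
- by [].
- by move=> G /(size_root_base s1) h; apply: ltnW.
- by apply/eqP => c0; apply: hc; left.
- by move=> h; apply: hc; right.
by exists a; split.
Qed.

End Root.

(** * Transfer of arbitrary points and of balls *)

Section Level.
Variables (A : comNzRingType) (K : NALocalField0).

(* Outside finitely many roots, [y] lies in a ball of radius [kap w] around one of
   these roots, and it transfers together with a whole ball of comparable radius. *)
Lemma level (Phi : seq {poly A}) (N : nat) : (0 < N)%N ->
  exists (R : seq {poly A}) (Psi : seq A) (N' : nat) (W : zmodType)
    (L : seq ((A -> int) * W * ({poly A} -> int) -> int)) (T : int)
    (kap : W -> int) (C : nat),
  [/\ {subset Phi <= R} /\ 'X \in R, (0 < N')%N /\ 0 < T, allp (@addform _) L, addform kap &
   forall (phi : {rmorphism A -> K}) (y : K),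
   (exists Q, Q \in R /\ isroot Q phi y) \/ exists w : W,
   [/\ exists a, [/\ exists Q, Q \in R /\ isroot Q phi a, kap w = lf_ord (y - a) & y != a],
    y != 0 /\ lf_ord y <= kap w &
   forall (oA : A -> int) (oB : {poly A} -> int),
     (forall a, a \in Psi -> oA a = lf_ord (phi a)) ->
     (forall P, P \in R -> oB P = lf_ord (ap phi P y)) ->
   forall (F : NALocalField0) (j : vext K F) (phi' : {rmorphism A -> F})
     (s : A -> int) (u : W) (tau : {poly A} -> int),
     (forall a, a \in Psi -> mt j N' (s a) (phi a) (phi' a)) ->
     adm L T (oA, w, oB) (s, u, tau) ->
   exists y' : F, forall y'', vge (y'' - y') ((vx_e j)%:Z * (kap w + kap u + C%:Z)) ->
     forall P, P \in R -> mt j N (tau P) (ap phi P y) (ap phi' P y'')]].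
Proof.
move=> N_gt0; pose s0 := 'X :: Phi.
pose n := (\max_(G <- s0) size G).+2.
have hs G : G \in s0 -> (size G <= n)%N.
  move=> Gs; have := @leq_bigmax_seq _ s0 xpredT (fun G : {poly A} => size G) G Gs isT.
  by move=> h; rewrite (leq_trans h)// /n -addn2 leq_addr.
pose R := dcl n s0.
have hR G : G \in R -> (size G <= n)%N.
  move=> /dclP[H [l [/hs h _ ->]]]; exact: leq_trans (size_poly _ _) (leq_trans (leq_subr _ _) h).
have XR : 'X \in R by apply: sub_dcl; rewrite ?mem_head.
have [N0 hcol] := collision K n.
pose N1 := (N + N0)%N; have N1_gt0 : (0 < N1)%N by rewrite /N1; lia.
have TRR : TR (fun phi (c : K) => exists Q, Q \in R /\ isroot Q phi c).
  by apply: TR_seq => Q _; exact: (@TR_isroot A K (size Q) Q (leqnn _)).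
have [Psi [N' [W [L [T [h1 h2 h3 h4]]]]]] := TRR (dcl n R) N1 N1_gt0.
pose W' := (W * ({poly A} -> int) * int)%type.
pose E := ((A -> int) * W' * ({poly A} -> int))%type.
pose sA (v : E) := v.1.1. pose sW (v : E) := v.1.2.1.1.
pose sa (v : E) := v.1.2.1.2. pose st (v : E) := v.1.2.2. pose sB (v : E) := v.2.
pose f0 f (v : E) : int := f (sA v, sW v, sa v).
pose f2 (G : {poly A}) (l : nat) (v : E) : int := sa v G^`N(l) + l%:Z * st v - sB v G.
pose L' := map f0 L ++ [seq f2 G l | G <- R, l <- iota 0 n].
pose T' := Num.max T N1%:Z.
exists R, Psi, N', W', L', T', (fun w => w.2), N1; split.
- by split=> // G Gs; apply: sub_dcl => //; rewrite in_cons Gs orbT.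
- by split=> //; rewrite lt_max h2.
- rewrite allp_cat allp_map allp_pairs; split.
  + by apply: allp_impl h3 => f hf u v; rewrite /f0 -hf.
  + move=> G l _ _ u v; rewrite /f2 /sa /st /sB !(pair_add1, pair_add2, fct_addE); ring.
- by [].
move=> phi y; have [hy|hy] := pselect (exists Q, Q \in R /\ isroot Q phi y); [by left|right].
have y0 : y != 0.
  apply/eqP => y0; apply: hy; exists 'X; split=> //.
  by rewrite /isroot map_polyX polyX_eq0 y0; split=> //; apply/rootP; rewrite hornerX.
have [a [ha ya oya hnc]] := closest_center hcol (isT : (1 < n)%N) hs y0 hy.
have {}ha : exists Q, Q \in R /\ isroot Q phi a.
  case: ha => // ->; exists 'X; split=> //.
  by rewrite /isroot map_polyX polyX_eq0; split=> //; apply/rootP; rewrite hornerX.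
have [w hw] := h4 phi a ha.
pose t := y - a; have act : a + t = y by rewrite addrC subrK.
have t0 : t != 0 by rewrite subr_eq0.
pose oa (G : {poly A}) := lf_ord (ap phi G a).
exists (w, oa, lf_ord t); split=> //; first by exists a.
move=> oA oB hA hB F j phi' s [[uW ua] ut] tau hs'.
rewrite /adm allp_cat allp_map allp_pairs => -[ad0 ad2].
have ad0' : adm L T (oA, w, oa) (s, uW, ua).
  by apply: (adm_le h2 (T := T')); [rewrite le_max lexx|rewrite /adm; exact: ad0].
have [a' ha'] := hw oA oa hA (fun Q _ => erefl) F j phi' s uW ua hs' ad0'.
have T'_ge : N1%:Z <= T' by rewrite le_max lexx orbT.
(* Every y'' in the ball has an increment y'' - a' that still matches t to precision N1; hence the
   constant C = N1. *)
pose T1 := j (unif K ^ ut * t); exists (a' + T1) => y'' /= hy'' P PR.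
have ht : mt j N1 ut t (y'' - a').
  by apply: mt_intro => //; rewrite -/T1 -addrA -opprD.
rewrite -act; have -> : y'' = a' + (y'' - a') by rewrite addrC subrK.
apply: (@step_sum A K F j phi phi' P a t a' (y'' - a')
    (fun l => ua P^`N(l)) ut (tau P) n N N0 N1 T') => //.
- exact: hR.
- by move=> l ln; apply: ha'; apply: mem_dcl.
- exact: hnc.
- move=> l ln; have := ad2 P l PR; rewrite mem_iota /= add0n => /(_ ln).
  by rewrite /f2 /sB /= hB// act.
Qed.

(** Roots are handled by [TR_isroot], all other points by [level]. Since [level] needs the orders of
    all of R, these are stored in the auxiliary group and tied to the given ones on Phi by forms
    that vanish. *)
Lemma TR_all : TR (fun (phi : {rmorphism A -> K}) y => True).
Proof.
move=> Phi N N_gt0.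
have [R [Psi [N' [W [L [T [kap [C [[hR _] [h1 h2] h3 _ h4]]]]]]]]] := level Phi N_gt0.
pose S1 (phi : {rmorphism A -> K}) (c : K) := exists Q, Q \in R /\ isroot Q phi c.
have TRR : TR S1.
  by apply: TR_seq => Q _; exact: (@TR_isroot A K (size Q) Q (leqnn _)).
apply: (@TRat_sub _ _ _ (fun phi c => S1 phi c \/ ~ S1 phi c)).
  by move=> phi y _; exact: EM.
suff H : TRat (fun phi c => S1 phi c \/ ~ S1 phi c) R N.
  have [Psi' [M [W' [L' [T' [g1 g2 g3 g4]]]]]] := H.
  pose E := ((A -> int) * (W' * ({poly A} -> int)) * ({poly A} -> int))%type.
  pose pr (v : E) := (v.1.1, v.1.2.1, v.1.2.2).
  exists Psi', M, (W' * ({poly A} -> int))%type,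
    ([seq (fun v => f (pr v)) | f <- L'] ++
     [seq (fun v : E => v.2 P - v.1.2.2 P) | P : {poly A} <- Phi]), T'; split=> //.
    rewrite allp_cat !allp_map; split.
      by apply: allp_impl g3 => f hf u v; rewrite -hf.
    by apply/allp_mem => P _ u v; rewrite !(pair_add1, pair_add2, fct_addE); ring.
  move=> phi y hy; have [w hw] := g4 phi y hy.
  exists (w, fun P => lf_ord (ap phi P y)) => oA oB hA hB F j phi' s [u tau'] tau hs.
  rewrite /adm allp_cat !allp_map => -[ad1 /allp_mem ad2].
  have [y' hy'] := hw oA (fun P => lf_ord (ap phi P y)) hA (fun _ _ => erefl) F j phi' s u tau' hs ad1.
  exists y' => P PPhi; have := ad2 P PPhi; rewrite /= hB// subrr => /(adm1_zero g2)/eqP.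
  by rewrite subr_eq0 => /eqP ->; apply: hy'; apply: hR.
apply: TRat_or; first exact: TRR.
exists Psi, N', W, L, T; split=> // phi y hy.
have [//|[w [_ _ hw]]] := h4 phi y.
exists w => oA oB hA hB F j phi' s u tau hs hadm.
have [y' hy'] := hw oA oB hA hB F j phi' s u tau hs hadm.
by exists y' => P PR; apply: hy' => //; rewrite subrr; left.
Qed.

End Level.

(** * Transfer of several coordinates *)

(** Polynomials in m variables, the last variable outermost, so that the transfer of one coordinate
    applies with coefficient ring [ip K m]. *)
Fixpoint ip (K : fieldType) (m : nat) : idomainType :=
  if m is m'.+1 then {poly (ip K m')} : idomainType else K.

Fixpoint ev (K F : fieldType) (j : {rmorphism K -> F}) (m : nat) (z : nat -> F) :
    {rmorphism ip K m -> F} :=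
  match m return {rmorphism ip K m -> F} with
  | 0%N => j
  | m'.+1 => (horner_eval (z m') \o map_poly (ev j m' z))
  end.

Definition upd (F : Type) (z : nat -> F) (m : nat) (y : F) (i : nat) : F :=
  if i == m then y else z i.

Section Eval.
Variables (K F : fieldType) (j : {rmorphism K -> F}).

Lemma evS m (z : nat -> F) (P : ip K m.+1) :
  ev j m.+1 z P = (map_poly (ev j m z) P).[z m].
Proof. by []. Qed.

Lemma ev_ext m (z z' : nat -> F) (P : ip K m) :
  (forall i, (i < m)%N -> z i = z' i) -> ev j m z P = ev j m z' P.
Proof.
elim: m P => [//|m IH] P h; rewrite !evS h//.
congr (horner _ _); apply/polyP => i; rewrite !coef_map /=.
by apply: IH => k km; apply: h; apply: ltnW.
Qed.

Lemma ev_upd m (z : nat -> F) y (P : ip K m) : ev j m (upd z m y) P = ev j m z P.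
Proof. by apply: ev_ext => i im; rewrite /upd ltn_eqF. Qed.

Lemma evS_upd m (z : nat -> F) y (P : ip K m.+1) :
  ev j m.+1 (upd z m y) P = (map_poly (ev j m z) P).[y].
Proof.
rewrite evS /upd eqxx; congr (horner _ _); apply/polyP => i; rewrite !coef_map /=.
exact: ev_upd.
Qed.

Lemma evC m (z : nat -> F) (P : ip K m) : ev j m.+1 z (P%:P) = ev j m z P.
Proof. by rewrite evS map_polyC hornerC. Qed.

Fixpoint ivar (m i : nat) : ip K m :=
  match m return ip K m with
  | 0%N => 0
  | m'.+1 => if i == m' then 'X else (ivar m' i)%:P
  end.

Fixpoint icst (m : nat) (c : K) : ip K m :=
  match m return ip K m with
  | 0%N => c
  | m'.+1 => (icst m' c)%:P
  end.

Lemma ev_ivar m (z : nat -> F) i : (i < m)%N -> ev j m z (ivar m i) = z i.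
Proof.
elim: m => // m IH; rewrite ltnS leq_eqVlt.
have -> : ivar m.+1 i = if i == m then 'X else (ivar m i)%:P by [].
case: eqP => [->|ne] h; first by rewrite evS map_polyX hornerX.
by rewrite evC IH.
Qed.

Lemma ev_icst m (z : nat -> F) c : ev j m z (icst m c) = j c.
Proof. by elim: m => // m IH; rewrite [icst _ _]/(_%:P) evC. Qed.

End Eval.

Section Forth.
Variable K : NALocalField0.
Local Notation evK m z := (ev (idv K) m z).

(** The transfers of single coordinates are composed; the orders of the intermediate coefficient
    polynomials become part of the auxiliary group. The last d coordinates will be the value of the
    function and the witnesses. *)
Lemma forth_multi (m d : nat) (Phi : seq (ip K (d + m))) (N : nat) : (0 < N)%N ->
  exists (Psi : seq (ip K m)) (N' : nat) (W : zmodType)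
    (L : seq ((ip K m -> int) * W * (ip K (d + m) -> int) -> int)) (T : int),
  [/\ (0 < N')%N, 0 < T, allp (@addform _) L &
   forall (z : nat -> K), exists w : W,
   forall (oA : ip K m -> int) (oB : ip K (d + m) -> int),
     (forall a, a \in Psi -> oA a = lf_ord (evK m z a)) ->
     (forall P, P \in Phi -> oB P = lf_ord (evK (d + m) z P)) ->
   forall (F : NALocalField0) (j : vext K F) (z' : nat -> F)
     (s : ip K m -> int) (u : W) (tau : ip K (d + m) -> int),
     (forall a, a \in Psi -> mt j N' (s a) (evK m z a) (ev j m z' a)) ->
     adm L T (oA, w, oB) (s, u, tau) ->
   exists z'' : nat -> F, (forall i, (i < m)%N -> z'' i = z' i) /\
     forall P, P \in Phi -> mt j N (tau P) (evK (d + m) z P) (ev j (d + m) z'' P)].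
Proof.
elim: d Phi N => [|d IH] Phi N N_gt0.
  exists Phi, N, int, [seq (fun v : (ip K m -> int) * int * (ip K m -> int) => v.2 P - v.1.1 P)
     | P : ip K m <- Phi], 1; split=> //.
    rewrite allp_map; apply/allp_mem => P _ u v.
    by rewrite !(pair_add1, pair_add2, fct_addE); ring.
  move=> z; exists 0 => oA oB hA hB F j z' s u tau hs.
  rewrite /adm allp_map => /allp_mem hadm; exists z'; split=> // P PPhi.
  have := hadm P PPhi; rewrite /= hA// hB// subrr => /(adm1_zero ltr01)/eqP.
  by rewrite subr_eq0 => /eqP ->; apply: hs.
have [Psi1 [N1 [W1 [L1 [T1 [h1 h2 h3 h4]]]]]] := @TR_all (ip K (d + m)) K Phi N N_gt0.
have [Psi [N' [W [L [T [g1 g2 g3 g4]]]]]] := IH Psi1 N1 h1.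
pose W' := (W * (ip K (d + m) -> int) * W1)%type.
pose E := ((ip K m -> int) * W' * (ip K (d.+1 + m) -> int))%type.
pose p1 (v : E) := (v.1.1, v.1.2.1.1, v.1.2.1.2).
pose p2 (v : E) := (v.1.2.1.2, v.1.2.2, v.2).
exists Psi, N', W', ([seq (fun v => f (p1 v)) | f <- L] ++ [seq (fun v => f (p2 v)) | f <- L1]),
  (Num.max T T1); split=> //.
- by rewrite lt_max h2 orbT.
- rewrite allp_cat !allp_map; split.
    by apply: allp_impl g3 => f hf u v; rewrite -hf.
  by apply: allp_impl h3 => f hf u v; rewrite -hf.
move=> z; have [w hw] := g4 z.
have [w1 hw1] := h4 (evK (d + m) z) (z (d + m)%N) I.
pose ob (P : ip K (d + m)) := lf_ord (evK (d + m) z P).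
exists (w, ob, w1) => oA oB hA hB F j z' s [[u b] u1] tau hs.
rewrite /adm allp_cat !allp_map => -[ad0 ad1].
have ad0' : adm L T (oA, w, ob) (s, u, b).
  by apply: (adm_le g2 (T := Num.max T T1)); [rewrite le_max lexx|exact: ad0].
have [z1 [hz1 hz1']] := hw oA ob hA (fun _ _ => erefl) F j z' s u b hs ad0'.
have ad1' : adm L1 T1 (ob, w1, oB) (b, u1, tau).
  by apply: (adm_le h2 (T := Num.max T T1)); [rewrite le_max lexx orbT|exact: ad1].
have [y' hy'] := hw1 ob oB (fun _ _ => erefl) hB F j (ev j (d + m) z1) b u1 tau hz1' ad1'.
exists (upd z1 (d + m) y'); split.
  by move=> i im; rewrite /upd ltn_eqF ?hz1// (leq_trans im)// leq_addl.
move=> P PPhi; have -> : ev j (d.+1 + m) (upd z1 (d + m) y') P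
    = (map_poly (ev j (d + m) z1) P).[y'] by exact: (evS_upd j (m := d + m) z1 y' P).
exact: hy'.
Qed.

End Forth.

(** * Haar measures *)

Section Vectors.
Variable T : Type.

(** The new coordinate comes last, like the outermost variable of [ip], and is a vector of length
    one, so that the line carries the same kind of measure. *)
Definition vcons m (x : 'I_m -> T) (t : 'I_1 -> T) : 'I_m.+1 -> T :=
  fun i => if unlift ord_max i is Some k then x k else t ord0.
Definition vinit m (x : 'I_m.+1 -> T) : 'I_m -> T := fun k => x (lift ord_max k).
Definition vlast m (x : 'I_m.+1 -> T) : 'I_1 -> T := fun _ => x ord_max.

Lemma vcons_lift m x t (k : 'I_m) : vcons x t (lift ord_max k) = x k.
Proof. by rewrite /vcons liftK. Qed.

Lemma vcons_max m (x : 'I_m -> T) t : vcons x t ord_max = t ord0.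
Proof. by rewrite /vcons unlift_none. Qed.

Lemma vinitK m (x : 'I_m -> T) t : vinit (vcons x t) = x.
Proof. by apply/funext => k; rewrite /vinit vcons_lift. Qed.

Lemma vcons_eta m (x : 'I_m.+1 -> T) : vcons (vinit x) (vlast x) = x.
Proof.
by apply/funext => i; case: (unliftP ord_max i) => [k ->|->]; rewrite ?vcons_lift ?vcons_max.
Qed.

Lemma forall_vcons m (Q : 'I_m.+1 -> Prop) :
  (forall i, Q i) <-> (forall k, Q (lift ord_max k)) /\ Q ord_max.
Proof.
split=> [h|[h1 h2] i]; first by split.
by case: (unliftP ord_max i) => [k ->|->].
Qed.

End Vectors.

Lemma sum_vcons m (k : 'I_m.+1 -> int) :
  \sum_(i < m.+1) k i = \sum_(i < m) vinit k i + k ord_max.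
Proof.
rewrite big_ord_recr; congr (_ + _); apply: eq_bigr => i _.
by rewrite /vinit; congr (k _); apply: val_inj; rewrite -[RHS]/(nat_of_ord (lift ord_max i)) lift_max.
Qed.

Section Haar.
Variables (F : NALocalField0) (R : realType).
Local Notation TT m := (g_sigma_algebraType (boxes F m)).
Local Notation q := ((lf_q F)%:R : R).

(** 0 and 1 lie in different residue classes. *)
Lemma q_gt1 : (1 < lf_q F)%N.
Proof.
have [s [s1 [s2 [s3 s4]]]] := lf_residue F.
have [y0 y0s h0] := s4 0 (or_introl erefl).
have [y1 y1s h1] := s4 1 (or_intror (eq_ind_r (fun z => 0 <= z) (lexx 0) (ord_one F))).
rewrite ltnNge; apply/negP => q1.
have e : y0 = y1.
  case: s s1 y0s y1s {s2 s3 s4} => [|a [|b s]] //= s1; last by move: q1; rewrite -s1.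
  by rewrite !mem_seq1 => /eqP -> /eqP ->.
have : vge (1 : F) 1.
  have -> : (1 : F) = (1 - y1) - (0 - y0) by rewrite e; ring.
  apply: vgeB.
    by case: h1 => h; [left|right].
  by case: h0 => h; [left|right].
by move=> /(vge_ordP (oner_neq0 _)); rewrite ord_one.
Qed.

Lemma qR_gt1 : 1 < q. Proof. by rewrite ltr1n q_gt1. Qed.
Lemma qR_gt0 : 0 < q. Proof. exact: lt_trans ltr01 qR_gt1. Qed.

Lemma box_measurable m a k : @measurable _ (TT m) (box a k).
Proof. by apply: sub_sigma_algebra; exists a, k. Qed.

Lemma vge_exists (x : F) : exists n : nat, forall N, (n <= N)%N -> vge x (- N%:Z).
Proof. by exists `|lf_ord x|%N => N h; right; lia. Qed.

Lemma vge_exists_ord m (x : vec F m) :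
  exists n : nat, forall i, vge (x i) (- n%:Z).
Proof.
exists (\max_(i < m) `|lf_ord (x i)|)%N => i; right.
have /= := @leq_bigmax _ (fun i : 'I_m => `|lf_ord (x i)|%N) i.
by move: (\max_(i < m) _)%N => M; lia.
Qed.

(** The preimage of a box leaves the last coordinate free and is a countable union of boxes of
    growing radius. *)
Lemma vinit_measurable m : measurable_fun setT (@vinit F m : TT m.+1 -> TT m).
Proof.
apply: (@measurability _ _ (TT m.+1) (TT m) setT _ (boxes F m)); first by [].
move=> _ [_ [a [k ->]] <-].
rewrite setTI.
have -> : (@vinit F m : TT m.+1 -> TT m) @^-1` box a k =
    \bigcup_n box (vcons a (fun _ => 0)) (vcons k (fun _ => - n%:Z)).
  apply/seteqP; split=> x /=.
    move=> hx; have [n hn] := vge_exists (x ord_max).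
    exists n => //; apply/forall_vcons; split=> [i|]; rewrite ?vcons_lift ?vcons_max ?subr0.
      exact: hx.
    exact: hn.
  by move=> [n _ /forall_vcons[h _]] i; have := h i; rewrite !vcons_lift.
by apply: bigcup_measurable => n _; exact: box_measurable.
Qed.

Lemma vlast_measurable m : measurable_fun setT (@vlast F m : TT m.+1 -> TT 1).
Proof.
apply: (@measurability _ _ (TT m.+1) (TT 1) setT _ (boxes F 1)); first by [].
move=> _ [_ [a [k ->]] <-].
rewrite setTI.
have -> : (@vlast F m : TT m.+1 -> TT 1) @^-1` box a k =
    \bigcup_n box (vcons (fun _ => 0) a) (vcons (fun _ => - n%:Z) k).
  apply/seteqP; split=> x /=.
    move=> hx; have [n hn] := vge_exists_ord (vinit x).
    exists n => //; apply/forall_vcons; split=> [i|]; rewrite ?vcons_lift ?vcons_max ?subr0.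
      exact: hn.
    exact: hx.
  by move=> [n _ /forall_vcons[_ h]] i; rewrite (ord1 i); move: h; rewrite !vcons_max.
by apply: bigcup_measurable => n _; exact: box_measurable.
Qed.

Lemma vcons_measurable m :
  measurable_fun setT (fun p : TT m * TT 1 => vcons p.1 p.2 : TT m.+1).
Proof.
apply: (@measurability _ _ (TT m * TT 1)%type (TT m.+1) setT _ (boxes F m.+1)); first by [].
move=> _ [_ [a [k ->]] <-].
rewrite setTI.
have -> : (fun p : TT m * TT 1 => vcons p.1 p.2 : TT m.+1) @^-1` box a k =
    box (vinit a) (vinit k) `*` box (vlast a) (vlast k).
  apply/seteqP; split=> -[x t] /=.
    move=> /forall_vcons[h1 h2]; split=> [i|i]; first by have := h1 i; rewrite vcons_lift.
    by rewrite (ord1 i); move: h2; rewrite vcons_max.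
  move=> [h1 h2]; apply/forall_vcons; split=> [i|]; rewrite ?vcons_lift ?vcons_max.
    exact: h1.
  exact: h2.
by apply: measurableX; exact: box_measurable.
Qed.

(** Every point of an ultrametric ball is a centre, so two boxes with a common point c can both be
    centred at c. *)
Lemma boxI m (a b : vec F m) k l : box a k `&` box b l = set0 \/
  exists c r, box a k `&` box b l = box c r.
Proof.
have [[c [c1 c2]]|h] := pselect (exists c, (box a k `&` box b l) c); last first.
  by left; apply/seteqP; split=> // x hx; apply: h; exists x.
right; exists c, (fun i => Num.max (k i) (l i)).
have mv (u v w : F) (r : int) : vge (u - v) r -> vge (w - v) r -> vge (w - u) r.
  move=> h1 h2; have -> : w - u = (w - v) - (u - v) by ring.
  exact: vgeB.
have mv' (u v w : F) (r : int) : vge (u - v) r -> vge (w - u) r -> vge (w - v) r.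
  move=> h1 h2; have -> : w - v = (w - u) + (u - v) by ring.
  exact: vgeD.
apply/seteqP; split=> x /=.
  move=> [x1 x2] i; rewrite /Num.max; case: ifP => _.
    exact: mv (c2 i) (x2 i).
  exact: mv (c1 i) (x1 i).
move=> hx; split=> i.
  by apply: mv' (c1 i) _; apply: vge_le (hx i); rewrite le_max lexx.
by apply: mv' (c2 i) _; apply: vge_le (hx i); rewrite le_max lexx orbT.
Qed.

Lemma haar_sigma_finite m (mu : {measure set (TT m) -> \bar R}) :
  haar_measure mu -> sigma_finite setT mu.
Proof.
move=> hmu; exists (fun n => box (fun _ => 0) (fun _ => - n%:Z)).
  apply/esym/seteqP; split=> // x _.
  have [n hn] := vge_exists_ord x; exists n => // i; rewrite subr0; exact: hn.
move=> n; split; first exact: box_measurable.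
by rewrite hmu ltry.
Qed.

(** Boxes, with the empty set added, form a generating system closed under intersection and contain
    an exhaustion by boxes of finite measure. *)
Lemma haar_unique m (mu nu : {measure set (TT m) -> \bar R}) :
  haar_measure mu -> haar_measure nu -> forall A, measurable A -> mu A = nu A.
Proof.
move=> hmu hnu A mA.
apply: (@measure_unique _ R (TT m) (boxes F m `|` [set set0])
   (fun n => box (fun _ => 0) (fun _ => - n%:Z)) _ _ _ _ mu nu) => //.
- apply/seteqP; split.
    by apply: sub_sigma_algebra2 => B hB; left.
  apply: smallest_sub; first exact: sigma_algebra_measurable.
  move=> B [hB|hB]; first exact: sub_sigma_algebra.
  rewrite [B]hB; exact: (@measurable0 _ (TT m)).
- move=> A1 A2 [[a [k ->]]|h1]; last by move=> _; right; rewrite [A1]h1 set0I.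
  move=> [[b [l ->]]|h2]; last by right; rewrite [A2]h2 setI0.
  by have [->|[c [r ->]]] := boxI a b k l; [right|left; exists c, r].
- by move=> n; left; exists (fun=> 0), (fun=> - n%:Z).
- apply/seteqP; split=> // x _.
  have [n hn] := vge_exists_ord x; exists n => // i; rewrite subr0; exact: hn.
- move=> A1 [[a [k ->]]|h1]; first by rewrite hmu hnu.
  by rewrite [A1]h1 !measure0.
- by move=> k; rewrite hmu ltry.
Qed.

End Haar.

(** * Fubini's theorem and measures of fibred sets *)

Section Fubini.
Variables (F : NALocalField0) (R : realType).
Local Notation TT m := (g_sigma_algebraType (boxes F m)).
Local Notation q := ((lf_q F)%:R : R).

Lemma slab_measurable m : @measurable _ (TT m.+1) [set x | vge (x ord_max) 0].
Proof.
have -> : [set x : TT m.+1 | vge (x ord_max) 0] =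
    (@vlast F m) @^-1` box (fun _ => 0) (fun _ => 0).
  apply/seteqP; split=> x /= h; first by move=> i; rewrite /vlast subr0; exact: h.
  by have := h ord0; rewrite /vlast subr0.
rewrite -[X in measurable X]setTI; apply: vlast_measurable => //; exact: box_measurable.
Qed.

Lemma cube_measurable m : @measurable _ (TT m.+1) [set x | forall k, vge (vinit x k) 0].
Proof.
have -> : [set x : TT m.+1 | forall k, vge (vinit x k) 0] =
    (@vinit F m) @^-1` box (fun _ => 0) (fun _ => 0).
  by apply/seteqP; split=> x /= h k; have := h k; rewrite subr0.
rewrite -[X in measurable X]setTI; apply: vinit_measurable => //; exact: box_measurable.
Qed.

(** The part of mu where the last coordinate is integral, pushed to the first m coordinates; with
    [haar_last] it supplies the lower-dimensional measures needed in inductions on m. *)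
Lemma haar_init m (mu : {measure set (TT m.+1) -> \bar R}) : haar_measure mu ->
  exists nu : {measure set (TT m) -> \bar R}, haar_measure nu.
Proof.
move=> hmu; pose f : TT m.+1 -> TT m := @vinit F m.
exists (pushforward (mrestr mu (@slab_measurable m)) f) => a k.
transitivity (mu (box (vcons a (fun=> 0)) (vcons k (fun=> 0)))).
  congr (mu _); apply/seteqP; split=> x /=.
    move=> [h1 h2]; apply/forall_vcons; split=> [i|]; rewrite ?vcons_lift ?vcons_max ?subr0//.
    exact: h1.
  move=> /forall_vcons[h1 h2]; split=> [i|]; first by have := h1 i; rewrite !vcons_lift.
  by move: h2; rewrite !vcons_max subr0.
by rewrite hmu sum_vcons vcons_max addr0 vinitK.
Unshelve. exact: vinit_measurable.
Qed.

Lemma haar_last m (mu : {measure set (TT m.+1) -> \bar R}) : haar_measure mu ->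
  exists nu : {measure set (TT 1) -> \bar R}, haar_measure nu.
Proof.
move=> hmu; pose f : TT m.+1 -> TT 1 := @vlast F m.
exists (pushforward (mrestr mu (@cube_measurable m)) f) => a k.
transitivity (mu (box (vcons (fun=> 0) a) (vcons (fun=> 0) k))).
  congr (mu _); apply/seteqP; split=> x /=.
    move=> [h1 h2]; apply/forall_vcons; split=> [i|]; rewrite ?vcons_lift ?vcons_max ?subr0//.
      exact: h2.
    exact: h1.
  move=> /forall_vcons[h1 h2]; split=> [i|i]; last by have := h1 i; rewrite !vcons_lift subr0.
  by rewrite (ord1 i); move: h2; rewrite !vcons_max.
by rewrite hmu sum_vcons vcons_max vinitK big1// add0r big_ord_recl big_ord0 addr0.
Unshelve. exact: vlast_measurable.
Qed.

Section SigmaFinite.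
Variables (nu : {measure set (TT 1) -> \bar R}) (hnu : haar_measure nu).

(** A copy of [nu] whose type remembers the proof of [haar_measure], so that the sigma-finite
    structure required by product measures can be attached. *)
Definition line_measure of haar_measure nu : set (TT 1) -> \bar R := nu.
Local Notation lm := (line_measure hnu).

Let lm0 : lm set0 = 0%E. Proof. exact: measure0. Qed.
Let lm_ge0 A : (0 <= lm A)%E. Proof. exact: measure_ge0. Qed.
Let lm_sigma : semi_sigma_additive lm. Proof. exact: measure_semi_sigma_additive. Qed.
HB.instance Definition _ := isMeasure.Build _ _ _ lm lm0 lm_ge0 lm_sigma.
HB.instance Definition _ := Measure_isSigmaFinite.Build _ _ _ lm (haar_sigma_finite hnu).

End SigmaFinite.

Section Bounds.
Variables (m : nat) (mu : {measure set (TT m.+1) -> \bar R}).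
Variables (mu' : {measure set (TT m) -> \bar R}) (mu1 : {measure set (TT 1) -> \bar R}).
Hypotheses (hmu : haar_measure mu) (hmu' : haar_measure mu') (hmu1 : haar_measure mu1).

Definition fibre (A : set (vec F m.+1)) (x : vec F m) : set (vec F 1) :=
  [set t | A (vcons x t)].

Lemma haar_fubini (A : set (TT m.+1)) : measurable A ->
  (forall x, measurable (fibre A x : set (TT 1))) /\
  measurable_fun setT (fun x : TT m => mu1 (fibre A x)) /\
  mu A = (\int[mu']_x mu1 (fibre A x))%E.
Proof.
move=> mA.
pose s1 : {sigma_finite_measure set (TT 1) -> \bar R} := line_measure hmu1.
pose f : TT m * TT 1 -> TT m.+1 := fun p => vcons p.1 p.2.
have hp B : f @^-1` B = [set p | B (vcons p.1 p.2)] by [].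
have hx (B : set (TT m.+1)) x : xsection (f @^-1` B) x = fibre B x.
  by apply/seteqP; split=> t; rewrite /xsection /= inE.
have mfA (B : set (TT m.+1)) : measurable B -> measurable (f @^-1` B).
  by move=> mB; rewrite -[X in measurable X]setTI; apply: vcons_measurable.
split=> [x|]; first by rewrite -hx; apply: measurable_xsection; exact: mfA.
split.
  have := @measurable_fun_xsection _ _ (TT m) (TT 1) R s1 _ (mfA _ mA).
  apply: eq_measurable_fun => x _; by rewrite /= hx.
have -> : (\int[mu']_x mu1 (fibre A x))%E = pushforward (mu' \x s1)%E f A.
  rewrite /pushforward /product_measure1; apply: eq_integral => x _ /=.
  by rewrite hx.
apply: (haar_unique hmu _ mA); first exact: vcons_measurable.
move=> ? a k; have e : f @^-1` box a k = box (vinit a) (vinit k) `*` box (vlast a) (vlast k).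
  apply/seteqP; split=> -[x t] /=.
    move=> /forall_vcons[h1 h2]; split=> [i|i]; first by have := h1 i; rewrite /f vcons_lift.
    by rewrite (ord1 i); move: h2; rewrite /f vcons_max.
  move=> [h1 h2]; apply/forall_vcons; split=> [i|]; rewrite /f ?vcons_lift ?vcons_max.
    exact: h1.
  exact: h2.
rewrite -[LHS]/((mu' \x s1)%E (f @^-1` box a k)) e.
rewrite product_measure1E; [|exact: box_measurable|exact: box_measurable].
rewrite hmu' /= hmu1 -EFinM -expfzDr ?gt_eqF ?qR_gt0//.
by rewrite (sum_vcons k) big_ord1 opprD.
Qed.

Lemma ball_measure (a : F) (k : int) :
  mu1 (box (fun _ => a) (fun _ => k)) = (q ^ (- k))%:E.
Proof. by rewrite hmu1 big_ord_recl big_ord0 addr0. Qed.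

Lemma balls_measure (s : seq F) (k : int) (B : set (TT 1)) : measurable B ->
  (forall t, B t -> exists2 a, a \in s & vge (t ord0 - a) k) ->
  (mu1 B <= ((size s)%:R * q ^ (- k))%:E)%E.
Proof.
elim: s B => [|a s IH] B mB hB.
  have -> : B = set0 by apply/seteqP; split=> // t /hB[].
  by rewrite measure0 mul0r.
pose C : set (TT 1) := box (fun _ => a) (fun _ => k).
have mC : measurable C := box_measurable _ _.
have -> : B = (B `&` C) `|` (B `\` C) by rewrite setUIDK.
apply: le_trans (measureU2 _ _ _) _; [exact: measurableI|exact: measurableD|].
have -> : (size (a :: s))%:R * q ^ (- k) = q ^ (- k) + (size s)%:R * q ^ (- k).
  by rewrite /= -natr1 mulrDl mul1r addrC.
rewrite EFinD; apply: leeD.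
  by rewrite -(ball_measure a); apply: le_measure; rewrite ?inE//; exact: measurableI.
apply: IH; first exact: measurableD.
move=> t [Bt nCt]; have [b + hb] := hB t Bt.
rewrite in_cons => /orP[/eqP e|bs]; last by exists b.
by exfalso; apply: nCt => i; rewrite (ord1 i) -e.
Qed.

(** The balls will be centred at roots of finitely many polynomials, which makes their number D
    uniform over A'. *)
Lemma haar_upper (A : set (TT m.+1)) (A' : set (TT m)) (D : nat) (k : int) :
  measurable A -> measurable A' -> (forall x, A x -> A' (vinit x)) ->
  (forall x, A' x -> exists s : seq F, (size s <= D)%N /\
     forall t, A (vcons x t) -> exists2 a, a \in s & vge (t ord0 - a) k) ->
  (mu A <= (D%:R * q ^ (- k))%:E * mu' A')%E.
Proof.
move=> mA mA' hA hs; have [h1 [h2 ->]] := haar_fubini mA.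
rewrite -(setIT A') -integral_indic//.
have c0 : (0 <= D%:R * q ^ (- k)) by rewrite mulr_ge0// exprz_ge0// ltW// qR_gt0.
rewrite -ge0_integralZl//; last exact/measurable_EFinP.
apply: ge0_le_integral => //.
  by apply: measurable_funeM; exact/measurable_EFinP.
move=> x _; rewrite indicE; have [xA|xA] := boolP (x \in A').
  rewrite mule1; have [s [sD hs']] := hs x (set_mem xA).
  apply: le_trans (balls_measure (h1 x) hs') _.
  by rewrite lee_fin ler_wpM2r// ?ler_nat// exprz_ge0// ltW// qR_gt0.
rewrite mule0; have -> : fibre A x = set0; last by rewrite measure0.
apply/seteqP; split=> // t /= /hA; rewrite vinitK => xA'.
by move: xA; rewrite (mem_set xA').
Qed.

Lemma haar_lower (A : set (TT m.+1)) (A' : set (TT m)) (k : int) :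
  measurable A -> measurable A' ->
  (forall x, A' x -> exists a, forall t, vge (t ord0 - a) k -> A (vcons x t)) ->
  ((q ^ (- k))%:E * mu' A' <= mu A)%E.
Proof.
move=> mA mA' hA; have [h1 [h2 ->]] := haar_fubini mA.
rewrite -(setIT A') -integral_indic//.
have c0 : 0 <= q ^ (- k) by rewrite exprz_ge0// ltW// qR_gt0.
rewrite -ge0_integralZl//; last exact/measurable_EFinP.
apply: ge0_le_integral => //.
- by move=> x _; rewrite -EFinM lee_fin mulr_ge0.
- by apply: measurable_funeM; exact/measurable_EFinP.
move=> x _; rewrite indicE; have [xA|xA] := boolP (x \in A'); last by rewrite mule0.
rewrite mule1; have [a ha] := hA x (set_mem xA).
rewrite -(ball_measure a); apply: le_measure; rewrite ?inE//; first exact: box_measurable.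
by move=> t ht; apply: ha; have := ht ord0.
Qed.

(** Finite fibres are covered by balls of arbitrarily small radius. *)
Lemma haar_null (A : set (TT m.+1)) (D : nat) : measurable A ->
  (forall x, exists s : seq F, (size s <= D)%N /\
     forall t, A (vcons x t) -> t ord0 \in s) -> mu A = 0%E.
Proof.
move=> mA hA; have [h1 [h2 ->]] := haar_fubini mA.
apply: integral0_eq => x _; have [s [_ hs]] := hA x.
apply/eqP; rewrite eq_le measure_ge0 andbT; apply/lee_addgt0Pr => eps eps0.
rewrite add0e; pose M := ((size s)%:R / eps : R).
have M0 : 0 <= M by rewrite divr_ge0// ltW.
pose n := Num.truncn M; have qn : M <= q ^+ n.+1.
  apply: ltW; apply: (lt_trans (truncnS_gt M)); rewrite -natrX ltr_nat.
  by apply: ltn_expl; exact: q_gt1.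
apply: (@le_trans _ _ (((size s)%:R * q ^ (- n.+1%:Z))%:E)).
  by apply: balls_measure => // t ht; exists (t ord0); [exact: hs|rewrite subrr; left].
rewrite lee_fin -invr_expz ler_pdivrMr; last by rewrite exprn_gt0// qR_gt0.
by rewrite mulrC -ler_pdivrMr.
Qed.

End Bounds.
End Fubini.

(** * Measurability *)

(** Extends a vector by zeros to a sequence, the argument expected by [ev], which reads only the
    first m entries. *)
Definition vz (F : NALocalField0) m (x : vec F m) (i : nat) : F :=
  if insub i is Some k then x k else 0.

Lemma vz_ord (F : NALocalField0) m (x : vec F m) (k : 'I_m) : vz x k = x k.
Proof. by rewrite /vz valK. Qed.

Lemma vz_vcons_lt (F : NALocalField0) m (x : vec F m) t i : (i < m)%N ->
  vz (vcons x t : vec F m.+1) i = vz x i.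
Proof.
move=> im; pose k := Ordinal im.
have -> : i = lift ord_max k :> nat by rewrite lift_max.
by rewrite vz_ord vcons_lift lift_max vz_ord.
Qed.

Lemma vz_vcons_max (F : NALocalField0) m (x : vec F m) t :
  vz (vcons x t : vec F m.+1) m = t ord0.
Proof. by have := vz_ord (vcons x t : vec F m.+1) ord_max; rewrite /= => ->; rewrite vcons_max. Qed.

Section Density.
Variable F : NALocalField0.
Local Notation TT m := (g_sigma_algebraType (boxes F m)).

(** The finite expansions in powers of the uniformizer, with representatives of the residue field as
    digits, are dense and countable. *)
Lemma dense_seq (I := (nat * seq nat)%type) : exists d : I -> F,
  forall x k, exists i, vge (x - d i) k.
Proof.
have [s [s1 [s2 [s3 s4]]]] := lf_residue F.
pose dval := fix dval (l : seq nat) : F :=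
  if l is i :: l' then nth 0 s i + unif F * dval l' else 0.
have hO (n : nat) x : vge x 0 -> exists l, vge (x - dval l) n%:Z.
  elim: n x => [|n IH] x hx; first by exists [::]; rewrite subr0.
  have [y ys hy] := s4 x hx.
  have hm : vge ((x - y) / unif F) 0.
    apply: vge_divl; first exact: unif_neq0.
    by rewrite ord_unif; case: hy => h; [left|right].
  have [l hl] := IH _ hm; exists (index y s :: l); rewrite /= nth_index//.
  have -> : x - (y + unif F * dval l) = unif F * ((x - y) / unif F - dval l).
    by have := unif_neq0 F => h; field.
  have -> : n.+1%:Z = 1 + n%:Z by lia.
  by apply: vgeM => //; right; rewrite ord_unif.
exists (fun i => unif F ^ (- i.1%:Z) * dval i.2) => x k.
have [c hc] := vge_exists x; have {}hc := hc c (leqnn _).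
have hx : vge (unif F ^ c%:Z * x) 0.
  rewrite (_ : 0 = c%:Z + - c%:Z); last by rewrite subrr.
  by apply: vgeM => //; right; rewrite ord_unifXz.
have [l hl] := hO `|(k + c%:Z)%R|%N _ hx; exists (c, l) => /=.
have -> : x - unif F ^ (- c%:Z) * dval l = unif F ^ (- c%:Z) * (unif F ^ c%:Z * x - dval l).
  by rewrite mulrBr mulrA -expfzDr ?unif_neq0// addNr expr0z mul1r.
have := vgeM (vge_ord (unif F ^ (- c%:Z))) hl; rewrite ord_unifXz.
by apply: vge_le; lia.
Qed.

Definition vopen m (U : set (vec F m)) := forall x, U x ->
  exists n : nat, forall y, (forall i, vge (y i - x i) n%:Z) -> U y.

(** An open set is the union of the boxes it contains with centre in the dense sequence and integral
    radius, and these are countably many. *)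
Lemma vopen_measurable m (U : set (vec F m)) : vopen U -> @measurable _ (TT m) U.
Proof.
move=> oU; have [d hd] := dense_seq.
pose I := ({ffun 'I_m -> nat * seq nat} * nat)%type.
pose bx (i : I) : set (vec F m) := box (fun k => d (i.1 k)) (fun _ => i.2%:Z).
pose A (n : nat) : set (vec F m) :=
  if unpickle n is Some i then (if `[< bx i `<=` U >] then bx i else set0) else set0.
have -> : U = \bigcup_n A n.
  apply/seteqP; split=> x; last first.
    move=> [n _]; rewrite /A; case: unpickle => [i|//].
    by case: ifP => // /asboolP h /h.
  move=> Ux; have [n hn] := oU x Ux.
  pose q := [ffun k => projT1 (cid (hd (x k) n%:Z))].
  have hq k : vge (x k - d (q k)) n%:Z by rewrite /q ffunE; case: cid.
  pose i : I := (q, n); exists (pickle i) => //; rewrite /A pickleK.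
  have -> : `[< bx i `<=` U >] = true.
    apply/asboolP => y hy; apply: hn => k.
    have -> : y k - x k = (y k - d (q k)) - (x k - d (q k)) by ring.
    by apply: vgeB => //; exact: hy.
  by move=> k; exact: hq.
apply: bigcupT_measurable => n; rewrite /A; case: unpickle => [i|]; last exact: (@measurable0 _ (TT m)).
by case: ifP => _; [exact: box_measurable|exact: (@measurable0 _ (TT m))].
Qed.

Definition cont m (g : (nat -> F) -> F) := forall z (k : int), exists n : nat,
  forall z', (forall i, (i < m)%N -> vge (z' i - z i) n%:Z) -> vge (g z' - g z) k.

Lemma cont_sum m (I : Type) (r : seq I) (g : I -> (nat -> F) -> F) :
  (forall i, cont m (g i)) -> cont m (fun z => \sum_(i <- r) g i z).
Proof.
move=> hg z k; elim: r => [|i r [n hn]].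
  by exists 0%N => z' _; rewrite !big_nil subrr; left.
have [n' hn'] := hg i z k; exists (maxn n n') => z' hz; rewrite !big_cons opprD addrACA.
apply: vgeD; [apply: hn'|apply: hn] => l lm; apply: vge_le (hz l lm); lia.
Qed.

Lemma cont_mul m g h : cont m g -> cont m h -> cont m (fun z => g z * h z).
Proof.
move=> hg hh z k.
have [n1 h1] := hg z (k - lf_ord (h z)).
have [n2 h2] := hh z (Num.max (lf_ord (h z)) (k - lf_ord (g z))).
exists (maxn n1 n2) => z' hz.
have {}h1 : vge (g z' - g z) (k - lf_ord (h z)).
  by apply: h1 => l lm; apply: vge_le (hz l lm); lia.
have {}h2 : vge (h z' - h z) (Num.max (lf_ord (h z)) (k - lf_ord (g z))).
  by apply: h2 => l lm; apply: vge_le (hz l lm); lia.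
have -> : g z' * h z' - g z * h z = (g z' - g z) * ((h z' - h z) + h z) + g z * (h z' - h z) by ring.
apply: vgeD.
  have -> : k = (k - lf_ord (h z)) + lf_ord (h z) by ring.
  by apply: vgeM => //; apply: vgeD => //; apply: vge_le h2; rewrite le_max lexx.
have -> : k = lf_ord (g z) + (k - lf_ord (g z)) by ring.
by apply: vgeM => //; apply: vge_le h2; rewrite le_max lexx orbT.
Qed.

Lemma cont_cst m c : cont m (fun _ => c).
Proof. by move=> z k; exists 0%N => z' _; rewrite subrr; left. Qed.

Lemma cont_exp m g l : cont m g -> cont m (fun z => g z ^+ l).
Proof.
move=> hg; elim: l => [|l IH]; first exact: cont_cst.
have -> : (fun z => g z ^+ l.+1) = (fun z => g z * g z ^+ l).
  by apply/funext => z; rewrite exprS.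
exact: cont_mul.
Qed.

Lemma cont_ev (K : fieldType) (j : {rmorphism K -> F}) m (P : ip K m) :
  cont m (fun z => ev j m z P).
Proof.
elim: m P => [|m IH] P; first exact: cont_cst.
have e z : ev j m.+1 z P = \sum_(0 <= l < size P) ev j m z P`_l * z m ^+ l.
  rewrite evS (@horner_coef_wide _ (size P)) ?size_poly//.
  by rewrite big_mkord; apply: eq_bigr => i _; rewrite coef_map.
have -> : (fun z => ev j m.+1 z P) =
    (fun z => \sum_(0 <= l < size P) ev j m z P`_l * z m ^+ l) by apply/funext.
apply: cont_sum => l; apply: cont_mul.
  move=> z k; have [n hn] := IH P`_l z k; exists n => z' hz; apply: hn => i im.
  by apply: hz; apply: ltnW.
by apply: cont_exp => z k; exists `|k|%N => z' /(_ m (ltnSn m)); apply: vge_le; lia.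
Qed.

Lemma vge_ev_measurable (K : fieldType) (j : {rmorphism K -> F}) m (P : ip K m) c k :
  @measurable _ (TT m) [set x | vge (ev j m (vz x) P - c) k].
Proof.
apply: vopen_measurable => x /= hx; have [n hn] := cont_ev j P (vz x) k.
exists n => y hy.
have -> : ev j m (vz y) P - c = (ev j m (vz y) P - ev j m (vz x) P) + (ev j m (vz x) P - c) by ring.
by apply: vgeD => //; apply: hn => i im; have := hy (Ordinal im); rewrite -!vz_ord.
Qed.

End Density.

Section MatchSets.
Variables (K F : NALocalField0) (j : vext K F) (m : nat).
Local Notation TT := (g_sigma_algebraType (boxes F m)).
Local Notation e := (vx_e j)%:Z.

Lemma mt_measurable (N : nat) (s : int) (a : K) (P : ip K m) :
  @measurable _ TT [set x | mt j N s a (ev j m (vz x) P)].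
Proof.
have [->|a0] := eqVneq a 0.
  have -> : [set x : TT | mt j N s 0 (ev j m (vz x) P)] =
      \bigcap_n [set x : TT | vge (ev j m (vz x) P - 0) n%:Z].
    apply/seteqP; split=> x /=.
      by move=> [u [_ e0]] n _ /=; rewrite e0 mulr0 rmorph0 mul0r subr0; left.
    move=> h; have e0 : ev j m (vz x) P = 0.
      by apply: vge_eq0 => k; have := h `|k|%N I; rewrite /= subr0; apply: vge_le; lia.
    change (mt j N s 0 (ev j m (vz x) P)); rewrite e0; exact: mt_zero.
  by apply: bigcapT_measurable => n; exact: vge_ev_measurable.
have -> : [set x : TT | mt j N s a (ev j m (vz x) P)] =
   [set x : TT | vge (ev j m (vz x) P - j (unif K ^ s * a)) (e * (lf_ord a + s + N%:Z))].
  apply/seteqP; split=> x /= h; first exact: mt_err h (vge_ord _).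
  exact: mt_intro.
exact: vge_ev_measurable.
Qed.

(* [x] matches, up to the shift [s], the point [z] on the pairs (polynomial, precision) of [Phi]. *)
Definition match_on (Phi : seq (ip K m * nat)) (s : ip K m -> int) (z : nat -> K)
    (x : vec F m) : Prop :=
  forall p, p \in Phi -> mt j p.2 (s p.1) (ev (idv K) m z p.1) (ev j m (vz x) p.1).

Lemma match_on_measurable Phi s z : @measurable _ TT [set x | match_on Phi s z x].
Proof.
elim: Phi => [|p Phi IH].
  have -> : [set x : TT | match_on [::] s z x] = setT by apply/seteqP; split.
  exact: measurableT.
have -> : [set x : TT | match_on (p :: Phi) s z x] =
   [set x : TT | mt j p.2 (s p.1) (ev (idv K) m z p.1) (ev j m (vz x) p.1)] `&`
   [set x : TT | match_on Phi s z x].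
  apply/seteqP; split=> x /=.
    by move=> h; split; [apply: h; rewrite mem_head|move=> r hr; apply: h; rewrite in_cons hr orbT].
  by move=> [h1 h2] r; rewrite in_cons => /orP[/eqP->//|/h2].
by apply: measurableI => //; exact: mt_measurable.
Qed.

End MatchSets.

(** * Measures of classes *)

Section Classes.
Variables (K : NALocalField0) (R : realType).
Local Notation TT F m := (g_sigma_algebraType (boxes F m)).
Local Notation q F := ((lf_q F)%:R : R).
Local Notation evK m z := (ev (idv K) m z).

Lemma mtid_ord N (a b : K) : (0 < N)%N -> mt (idv K) N 0 a b -> lf_ord a = lf_ord b.
Proof.
move=> N0 h; have [a0|a0] := eqVneq a 0; last by rewrite (mt_ord N0 a0 h) mul1r addr0.
by have := mt_eq0 N0 h; rewrite a0 eqxx => /eqP ->.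
Qed.

Definition class m (Phi : seq (ip K m * nat)) (x : vec K m) : set (vec K m) :=
  [set x2 | match_on (idv K) Phi (fun _ => 0) (vz x) x2].

Lemma class_refl m (Phi : seq (ip K m * nat)) x : class Phi x x.
Proof. by move=> p _; exists 0; split; [left|rewrite /= expr0z mul1r addr0 mulr1]. Qed.

Lemma ev_vinit (F : NALocalField0) (j : {rmorphism K -> F}) m (x : vec F m.+1) P :
  ev j m (vz x) P = ev j m (vz (vinit x : vec F m)) P.
Proof.
apply: ev_ext => i im; rewrite -{1}(vcons_eta x).
exact: (vz_vcons_lt (vinit x : vec F m) (vlast x) im).
Qed.

Lemma ev_vcons (F : NALocalField0) (j : {rmorphism K -> F}) m (x : vec F m) t P :
  ev j m (vz (vcons x t : vec F m.+1)) P = ev j m (vz x) P.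
Proof. by rewrite ev_vinit vinitK. Qed.

Lemma evS_vcons (F : NALocalField0) (j : {rmorphism K -> F}) m (x : vec F m) t P :
  ev j m.+1 (vz (vcons x t : vec F m.+1)) P = (map_poly (ev j m (vz x)) P).[t ord0].
Proof.
rewrite evS vz_vcons_max; congr (horner _ _); apply/polyP => i; rewrite !coef_map.
exact: ev_vcons.
Qed.

Lemma int_min (X : Type) (Q : X -> Prop) (f : X -> int) (b : int) :
  (exists x, Q x) -> (forall x, Q x -> b <= f x) ->
  exists x, Q x /\ forall y, Q y -> f x <= f y.
Proof.
move=> [x0 q0] hb.
have ex : exists n, `[< exists x, Q x /\ f x = b + n%:Z >].
  exists `|(f x0 - b)%R|%N; apply/asboolP; exists x0; split=> //.
  by have := hb _ q0; lia.
case: (ex_minnP ex) => n /asboolP[x [qx fx]] hmin; exists x; split=> // y qy.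
have := hmin `|(f y - b)%R|%N; have := hb _ qy => hy.
have h : `[< exists z, Q z /\ f z = b + `|(f y - b)%R|%N%:Z >].
  by apply/asboolP; exists y; split=> //; lia.
by move=> /(_ h); lia.
Qed.

Lemma null_base m (mu : {measure set (TT K m.+1) -> \bar R})
    (mu' : {measure set (TT K m) -> \bar R}) (mu1 : {measure set (TT K 1) -> \bar R})
    (A : set (TT K m.+1)) (A' : set (TT K m)) :
  haar_measure mu -> haar_measure mu' -> haar_measure mu1 ->
  measurable A -> measurable A' -> (forall x, A x -> A' (vinit x)) -> mu' A' = 0%E -> mu A = 0%E.
Proof.
move=> hmu hmu' hmu1 mA mA' hA h0.
have [h1 [h2 ->]] := haar_fubini hmu hmu' hmu1 mA.
have e x : ~ A' x -> mu1 (fibre A x) = 0%E.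
  move=> nA; have -> : fibre A x = set0; last exact: measure0.
  by apply/seteqP; split=> // t /= /hA; rewrite vinitK.
rewrite (_ : (\int[mu']_x mu1 (fibre A x))%E = (\int[mu']_(x in A') mu1 (fibre A x))%E).
  apply: null_set_integral => //; exact: measurable_funTS.
rewrite [RHS]integral_mkcond; apply: eq_integral => x _; rewrite patchE.
by case: ifPn => // /negP xA; apply: e => /mem_set.
Qed.

(** The null alternative covers the classes on which some coordinate is a root of a nonzero
    polynomial over the preceding ones; on the others [kap] measures the volume on both sides. *)
Definition classes_spec m (Phi : seq (ip K m * nat)) (V : zmodType) (L : seq (V -> int))
    (T : int) (kap : V -> int) (sh : V -> ip K m -> int) (C : nat) (B : R) : Prop :=
  forall x : vec K m,
   (forall mu : {measure set (TT K m) -> \bar R}, haar_measure mu ->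
      mu (class Phi x) = 0%E) \/
   exists o : V, [/\
     forall p, p \in Phi -> sh o p.1 = lf_ord (evK m (vz x) p.1),
     forall mu : {measure set (TT K m) -> \bar R}, haar_measure mu ->
       (mu (class Phi x) <= (B * q K ^ (- kap o))%:E)%E &
     forall (F : NALocalField0) (j : vext K F) (mu : {measure set (TT F m) -> \bar R}) v,
       haar_measure mu -> adm L T o v ->
       ((q F ^ (- ((vx_e j)%:Z * (kap o + kap v + C%:Z))))%:E <=
         mu [set x' | match_on j Phi (sh v) (vz x) x'])%E].

(** Induction on m, the last coordinate being treated by [level]. Above each point of the smaller
    class the fibre lies in boundedly many balls around roots, and above each shifted point it
    contains a ball of comparable radius. *)
Lemma classes m (Phi0 : seq (ip K m)) (N : nat) : (0 < N)%N ->
  exists (Phi : seq (ip K m * nat)) (V : zmodType) (L : seq (V -> int)) (T : int)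
    (kap : V -> int) (sh : V -> ip K m -> int) (C : nat) (B : R),
  [/\ forall P, P \in Phi0 -> (P, N) \in Phi, forall p, p \in Phi -> (0 < p.2)%N,
      0 < T, allp (@addform _) L &
   [/\ addform kap, forall u v, sh (u + v) = sh u + sh v, 0 <= B &
      classes_spec Phi L T kap sh C B]].
Proof.
elim: m Phi0 N => [|m IH] Phi0 N N_gt0.
  exists [seq (P, N) | P <- Phi0], (ip K 0 -> int), [seq (fun v => v P) | P <- Phi0].
  (* In dimension 0 the polynomials are constants; T exceeds all their orders, so that an admissible
     shift leaves them fixed. *)
  exists (\sum_(P <- Phi0) `|lf_ord (evK 0 (fun _ => 0) P)| + 1), (fun _ => 0), id, 0%N, 1.
  split=> //.
  - by move=> P h; apply: map_f.
  - by move=> p /mapP[P _ ->].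
  - by rewrite ltr_wpDl// sumr_ge0.
  - by rewrite allp_map; apply/allp_mem => P _ u v.
  split=> // x; right; exists (fun P => lf_ord (evK 0 (vz x) P)); split=> //.
    move=> mu hmu; rewrite mul1r oppr0 expr0z.
    apply: (@le_trans _ _ (mu (box x (fun _ => 0)))); last by rewrite hmu big_ord0 oppr0 expr0z.
    apply: le_measure; rewrite ?inE; [exact: match_on_measurable|exact: box_measurable|].
    by move=> y _ [].
  move=> F j mu v hmu; rewrite /adm allp_map => /allp_mem hv.
  rewrite !addr0 mulr0 oppr0 expr0z.
  apply: (@le_trans _ _ (mu (box (fun _ => 0) (fun _ => 0)))); first by rewrite hmu big_ord0 oppr0 expr0z.
  apply: le_measure; rewrite ?inE; [exact: box_measurable|exact: match_on_measurable|].
  move=> y _ p /mapP[P PPhi ->] /=.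
  have [_ _ h] := hv P PPhi; rewrite h; last first.
    rewrite (big_rem P PPhi) /=.
    apply: (@le_lt_trans _ _ `|lf_ord (P : K)|) => //.
    by rewrite -addrA ltrDl ltr_wpDl// sumr_ge0.
  by have := mt_sh j N 0 (P : K); rewrite expr0z mul1r.
have [Q [Psi [N' [W [L1 [T1 [kap1 [C1 [[hsub XQ] [N'0 T10] hL1 hkap1 hlev]]]]]]]]] :=
  @level (ip K m) K Phi0 N N_gt0.
(* The coefficients are included so that a polynomial of Q vanishes identically either at every
   point of the smaller class or at none. *)
pose Psi2 := Psi ++ flatten [seq (P : seq _) | P : {poly ip K m} <- Q].
have [Phi' [V' [L' [T' [kap' [sh' [C' [B' [hPsi hlevels T'0 hL' [hkap' hsh' B'0 hspec]]]]]]]]]] :=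
  IH Psi2 N' N'0.
pose Phi : seq (ip K m.+1 * nat) :=
  [seq (P : ip K m.+1, N) | P <- Q] ++ [seq ((p.1)%:P : ip K m.+1, p.2) | p <- Phi'].
pose V := (V' * W * (ip K m.+1 -> int))%type.
pose kap (v : V) := kap' v.1.1 + kap1 v.1.2.
pose sh (v : V) : ip K m.+1 -> int := v.2.
pose f1 f (v : V) : int := f v.1.1.
pose f2 f (v : V) : int := f (sh' v.1.1, v.1.2, v.2).
pose f3 (p : ip K m * nat) (v : V) : int := v.2 ((p.1)%:P : ip K m.+1) - sh' v.1.1 p.1.
pose L := [seq f1 f | f <- L'] ++ [seq f2 f | f <- L1] ++ [seq f3 p | p <- Phi'].
pose T := Num.max T' T1.
pose D := (\sum_(P <- Q) size (P : {poly ip K m}))%N.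
exists Phi, V, L, T, kap, sh, (C' + C1)%N, (D%:R * B'); split.
- by move=> P PP; rewrite mem_cat; apply/orP; left; apply/mapP; exists P => //; apply: hsub.
- move=> p; rewrite mem_cat => /orP[/mapP[P _ ->]//|/mapP[p' hp' ->]]; exact: hlevels.
- by rewrite lt_max T'0.
- rewrite !allp_cat !allp_map; split; [|split].
  + by apply: allp_impl hL' => f hf u v; rewrite /f1 -hf.
  + by apply: allp_impl hL1 => f hf u v; rewrite /f2 -hf hsh'.
  + apply/allp_mem => p _ u v; rewrite /f3 !(pair_add1, pair_add2, fct_addE) hsh' fct_addE; ring.
split=> //.
- by move=> u v; rewrite /kap !(pair_add1, pair_add2) hkap' hkap1; ring.
- by rewrite mulr_ge0.
move=> x; pose x0 : vec K m := vinit x.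
pose A := class Phi x; pose A' := class Phi' x0.
have mA : @measurable _ (TT K m.+1) A by exact: match_on_measurable.
have mA' : @measurable _ (TT K m) A' by exact: match_on_measurable.
have hAA' y : A y -> A' (vinit y).
  move=> hy p hp; have hp' : ((p.1)%:P : ip K m.+1, p.2) \in Phi.
    by rewrite mem_cat; apply/orP; right; apply/mapP; exists p.
  have : mt (idv K) p.2 0 (evK m.+1 (vz x) ((p.1)%:P : ip K m.+1))
    (evK m.+1 (vz y) ((p.1)%:P : ip K m.+1)) := hy _ hp'.
  by rewrite !evC !ev_vinit.
have hAQ y P : A y -> P \in Q -> mt (idv K) N 0 (evK m.+1 (vz x) P) (evK m.+1 (vz y) P).
  by move=> hy hP; apply: (hy (P, N)); rewrite mem_cat; apply/orP; left; apply/mapP; exists P.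
have [hnull|[v0 [hv0 hup0 hlw0]]] := hspec x0.
  left=> mu hmu; have [mu' hmu'] := haar_init hmu; have [mu1 hmu1] := haar_last hmu.
  exact: (null_base hmu hmu' hmu1 mA mA' hAA' (hnull _ hmu')).
have phiE (y : vec K m.+1) P : evK m.+1 (vz y) P =
    (map_poly (evK m (vz (vinit y : vec K m))) P).[y ord_max].
  by rewrite -{1}(vcons_eta y) evS_vcons.
(* Vanishing of P is constant on the class: if one point of the class has a root of P as last
   coordinate, all have, and the fibres are finite. *)
have [[y [P [yA PQ [P0 Py]]]]|hroot] := pselect (exists y P, [/\ A y, P \in Q &
    isroot P (evK m (vz (vinit y : vec K m))) (y ord_max)]).
  left=> mu hmu; have [mu' hmu'] := haar_init hmu; have [mu1 hmu1] := haar_last hmu.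
  apply: (haar_null (D := size P) hmu hmu' hmu1 mA) => z.
  have [[t zA]|nz] := pselect (exists t, A (vcons z t)); last first.
    by exists [::]; split=> // t ht; case: nz; exists t.
  pose pz := map_poly (evK m (vz z)) P.
  have pz0 : pz != 0.
    apply: contraNneq P0 => pz0; apply/eqP/polyP => i; rewrite coef0 coef_map.
    have := congr1 (fun p : {poly K} => p`_i) pz0; rewrite coef0 coef_map => ci.
    have [si|si] := leqP (size P) i; first by rewrite nth_default//; exact: rmorph0.
    have hc : (P`_i, N') \in Phi'.
      apply: hPsi; rewrite mem_cat; apply/orP; right; apply/flattenP.
      by exists (P : seq _); [apply/mapP; exists P|apply: mem_nth].
    have h1 := hAA' _ yA _ hc; have := hAA' _ zA _ hc; rewrite vinitK => h2.
    apply/eqP; rewrite (mt_eq0 N'0 h1) -(mt_eq0 N'0 h2) /=; exact/eqP.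
  have [s [ss hs]] := roots_seq pz0; exists s; split.
    by apply: leq_trans (ltnW ss) (size_map_le _ _).
  move=> t' zA'; apply: hs; apply/rootP; rewrite /pz -evS_vcons.
  have h1 := hAQ _ _ yA PQ; have h2 := hAQ _ _ zA' PQ.
  by apply/eqP; rewrite (mt_eq0 N_gt0 h2) -(mt_eq0 N_gt0 h1) phiE; apply/eqP/rootP.
right.
pose lev (y : vec K m.+1) (w : W) :=
  let phi := evK m (vz (vinit y : vec K m)) in let b := y ord_max in
  [/\ exists a, [/\ exists Q1, Q1 \in Q /\ isroot Q1 phi a, kap1 w = lf_ord (b - a) & b != a],
    b != 0 /\ lf_ord b <= kap1 w &
   forall (oA : ip K m -> int) (oB : {poly ip K m} -> int),
     (forall a, a \in Psi -> oA a = lf_ord (phi a)) ->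
     (forall P, P \in Q -> oB P = lf_ord ((map_poly phi P).[b])) ->
   forall (F : NALocalField0) (j : vext K F) (phi' : {rmorphism ip K m -> F})
     (s : ip K m -> int) (u : W) (tau : {poly ip K m} -> int),
     (forall a, a \in Psi -> mt j N' (s a) (phi a) (phi' a)) ->
     adm L1 T1 (oA, w, oB) (s, u, tau) ->
   exists y' : F, forall y'', vge (y'' - y') ((vx_e j)%:Z * (kap1 w + kap1 u + C1%:Z)) ->
     forall P, P \in Q -> mt j N (tau P) ((map_poly phi P).[b]) ((map_poly phi' P).[y''])].
have hlev' y : A y -> exists w, lev y w.
  move=> yA; have [[P [PQ hP]]|//] := hlev (evK m (vz (vinit y : vec K m))) (y ord_max).
  by case: hroot; exists y, P.
have ord_last y : A y -> lf_ord (y ord_max) = lf_ord (x ord_max).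
  move=> yA; have := hAQ y _ yA XQ; rewrite !phiE !map_polyX !hornerX.
  by move=> /(mtid_ord N_gt0).
(* The radius [kap1 w] varies with the point of the class, but is bounded below by the order of the
   last coordinate, which is constant. A point with the largest ball serves for both estimates. *)
have [[xs ws] [/= [xsA hws] hmin]] : exists p : vec K m.+1 * W, (A p.1 /\ lev p.1 p.2) /\
    forall p2, (A p2.1 /\ lev p2.1 p2.2) -> kap1 p.2 <= kap1 p2.2.
  apply: (@int_min (vec K m.+1 * W)%type (fun p => A p.1 /\ lev p.1 p.2) (fun p => kap1 p.2) (lf_ord (x ord_max))).
    by have [w hw] := hlev' x (@class_refl _ Phi x); exists (x, w); split=> //; exact: class_refl.
  by move=> [y w] /= [/ord_last <- [_ []]].
exists (v0, ws, fun P => lf_ord (evK m.+1 (vz x) P)); split=> //.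
  move=> mu hmu; have [mu' hmu'] := haar_init hmu; have [mu1 hmu1] := haar_last hmu.
  apply: le_trans (haar_upper (D := D) (k := kap1 ws) hmu hmu' hmu1 mA mA' hAA' _) _.
    move=> z zA'; have [s [ss hs]] := roots_all (map (map_poly (evK m (vz z))) Q).
    exists s; split.
      apply: leq_trans ss _; rewrite big_map; apply: leq_sum => P _; exact: size_map_le.
    move=> t zA; have [w hw] := hlev' _ zA.
    have [[a [ha ka _]] _ _] := hw; exists a.
      by apply: hs; apply/rootin_map; move: ha; rewrite vinitK.
    rewrite -(vcons_max z t); right; rewrite -ka.
    exact: (hmin (vcons z t : vec K m.+1, w)).
  apply: le_trans (lee_pmul _ _ (lexx _) (hup0 _ hmu')) _.
  - by rewrite lee_fin mulr_ge0// exprz_ge0// ltW// qR_gt0.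
  - exact: measure_ge0.
  rewrite -EFinM lee_fin /kap /= opprD expfzDr ?gt_eqF ?qR_gt0//.
  by rewrite le_eqVlt; apply/orP; left; apply/eqP; ring.
move=> F j mu [[v' u] tau] hmu.
rewrite /adm !allp_cat !allp_map => -[ad1 [ad2 /allp_mem ad3]].
have [mu' hmu'] := haar_init hmu; have [mu1 hmu1] := haar_last hmu.
pose AF' : set (TT F m) := [set x' | match_on j Phi' (sh' v') (vz x0) x'].
have mAF' : measurable AF' by exact: match_on_measurable.
have hlow := hlw0 F j mu' v' hmu' (adm_le T'0 (T := T) (ltac:(by rewrite le_max lexx)) ad1).
apply: (@le_trans _ _ ((q F ^ (- ((vx_e j)%:Z * (kap1 ws + kap1 u + C1%:Z))))%:E * mu' AF')%E).
  apply: le_trans (lee_pmul _ _ (lexx _) hlow); last 2 first.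
  - by rewrite lee_fin exprz_ge0// ltW// qR_gt0.
  - by rewrite lee_fin exprz_ge0// ltW// qR_gt0.
  rewrite -EFinM -expfzDr ?gt_eqF ?qR_gt0// lee_fin le_eqVlt; apply/orP; left; apply/eqP.
  by congr (_ ^ _); rewrite /kap PoszD /=; ring.
apply: (haar_lower hmu hmu' hmu1 (match_on_measurable _ _ _ _) mAF') => x' hx'.
have [_ _ hws3] := hws.
have xs0 := hAA' _ xsA.
have hPsi' a : a \in Psi -> (a, N') \in Phi'.
  by move=> ha; apply: hPsi; rewrite mem_cat ha.
have [||||y' hy'] := hws3 (sh' v0) (fun P => lf_ord (evK m.+1 (vz x) P)) _ _ F j
    (ev j m (vz x')) (sh' v') u tau.
- move=> a ha; rewrite (hv0 _ (hPsi' _ ha)) /=.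
  exact: (mtid_ord N'0 (xs0 _ (hPsi' _ ha))).
- by move=> P PQ; rewrite -phiE; apply: (mtid_ord N_gt0); apply: hAQ.
- move=> a ha; apply: (mt_comp (mtid_sym N'0 (xs0 _ (hPsi' _ ha)))).
  exact: hx' (hPsi' _ ha).
- by apply: (adm_le T10 (T := T)); [rewrite le_max lexx orbT|exact: ad2].
exists y' => t ht p; rewrite mem_cat => /orP[/mapP[P PQ ->]|/mapP[p' hp' ->]].
  apply: (mt_comp (hAQ _ _ xsA PQ)); rewrite phiE evS_vcons.
  exact: (hy' _ ht).
change (mt j p'.2 (tau ((p'.1)%:P : ip K m.+1)) (evK m.+1 (vz x) ((p'.1)%:P : ip K m.+1))
  (ev j m.+1 (vz (vcons x' t : vec F m.+1)) ((p'.1)%:P : ip K m.+1))).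
have h3 : adm1 T (lf_ord (evK m.+1 (vz x) ((p'.1)%:P : ip K m.+1)) - sh' v0 p'.1)
  (tau ((p'.1)%:P : ip K m.+1) - sh' v' p'.1) := ad3 _ hp'.
move: h3; rewrite !evC (ev_vcons j x' t p'.1) !(ev_vinit (idv K)) hv0// subrr.
have T0 : 0 < T by rewrite lt_max T'0.
move=> /(adm1_zero T0)/eqP; rewrite subr_eq0 => /eqP ->; exact: hx'.
Qed.

End Classes.

(** * Sums over cones *)

Lemma allp_In (X : Type) (Q : X -> Prop) s x : allp Q s -> List.In x s -> Q x.
Proof. by elim: s => //= y s IH [qy /IH h] [<-//|]. Qed.

(** Dickson's lemma. Let M bound the first coordinate d on a basis for the other coordinates.
    Elements with d >= M are dominated by that basis; for each of the finitely many values of d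
    below M the induction hypothesis gives another one. *)
Lemma dickson (X : Type) (ds : seq (X -> nat)) (S : X -> Prop) :
  exists B : seq X, allp S B /\
    forall x, S x -> exists b, List.In b B /\ allp (fun d => d b <= d x)%N ds.
Proof.
elim: ds S => [|d ds IH] S.
  have [[x Sx]|nS] := pselect (exists x, S x); last first.
    by exists [::]; split=> // x Sx; case: nS; exists x.
  by exists [:: x]; split=> //= y _; exists x; split=> //; left.
have [B [SB hB]] := IH S.
have [M hM] : exists M, forall b, List.In b B -> (d b <= M)%N.
  elim: B {SB hB} => [|b B [M hM]]; first by exists 0%N.
  exists (maxn (d b) M) => c [<-|/hM h]; first exact: leq_maxl.
  by rewrite leq_max h orbT.
have [B' [SB' hB']] : exists B', allp S B' /\ forall x, S x -> (d x < M)%N ->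
    exists b, List.In b B' /\ allp (fun d => d b <= d x)%N (d :: ds).
  elim: M {hM} => [|M [B' [SB' hB']]]; first by exists [::]; split.
  have [B2 [SB2 hB2]] := IH (fun x => S x /\ d x = M).
  exists (B' ++ B2); split.
    by rewrite allp_cat; split=> //; apply: allp_impl SB2 => x [].
  move=> x Sx; rewrite ltnS leq_eqVlt => /orP[/eqP dx|dx].
    have [b [bB hb]] := hB2 x (conj Sx dx); exists b; split.
      by apply: List.in_or_app; right.
    by split=> //; rewrite dx; case: (allp_In SB2 bB) => _ ->.
  have [b [bB hb]] := hB' x Sx dx; exists b; split=> //.
  by apply: List.in_or_app; left.
exists (B ++ B'); split; first by rewrite allp_cat.
move=> x Sx; have [dx|dx] := ltnP (d x) M.
  have [b [bB hb]] := hB' x Sx dx; exists b; split=> //.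
  by apply: List.in_or_app; right.
have [b [bB hb]] := hB x Sx; exists b; split; first by apply: List.in_or_app; left.
by split=> //; apply: leq_trans dx; apply: hM.
Qed.

Section Cone.
Variables (E : zmodType) (G : seq (E -> int)).
Hypothesis addG : allp (@addform _) G.

Definition cone (v : E) : Prop := allp (fun g => 0 <= g v) G.
Definition lineal (v : E) : Prop := allp (fun g => g v = 0) G.

Lemma addform0 (g : E -> int) : addform g -> g 0 = 0.
Proof. by move=> hg; have := hg 0 0; rewrite addr0; lia. Qed.

Lemma addformN (g : E -> int) v : addform g -> g (- v) = - g v.
Proof. by move=> hg; have := hg v (- v); rewrite subrr addform0//; lia. Qed.

Lemma addformB (g : E -> int) u v : addform g -> g (u - v) = g u - g v.
Proof. by move=> hg; rewrite hg addformN. Qed.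

Lemma addformMn (g : E -> int) v n : addform g -> g (v *+ n) = n%:Z * g v.
Proof.
move=> hg; elim: n => [|n IH]; first by rewrite mulr0n addform0// mul0r.
by rewrite mulrS hg IH; lia.
Qed.

Lemma allp_and (X : Type) (Q1 Q2 Q : X -> Prop) s : (forall x, Q1 x -> Q2 x -> Q x) ->
  allp Q1 s -> allp Q2 s -> allp Q s.
Proof. by move=> h; elim: s => //= x s IH [a1 /IH b1] [a2 /b1 b2]; split=> //; exact: h. Qed.

(** Gordan's lemma up to lineality: subtracting a minimal nonzero element stays in the cone and
    lowers the total weight. The group E need not be finitely generated; only the values of finitely
    many forms count, and the rest goes into v0. *)
Lemma cone_gen : exists hs : seq E, allp cone hs /\
  forall v, cone v -> exists (n : nat -> nat) (v0 : E), lineal v0 /\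
    v = \sum_(i < size hs) (nth 0 hs i) *+ n i + v0.
Proof.
pose ds := [seq (fun v => `|g v|%N) | g <- G].
pose w v := (\sum_(g <- G) `|g v|)%N.
have [hs [hhs hd]] := dickson ds (fun v => cone v /\ (0 < w v)%N).
exists hs; split; first by apply: allp_impl hhs => v [].
move=> v; move: {2}(w v) (leqnn (w v)) => M; elim: M v => [|M IH] v hw cv.
  exists (fun _ => 0%N), v; split; last by rewrite big1 ?add0r// => i _; rewrite mulr0n.
  move: hw; rewrite /w /lineal; elim: (G) => //= g s IHs; rewrite big_cons => h.
  by split; [lia|apply: IHs; lia].
have [w0|w0] := posnP (w v).
  by apply: IH; rewrite ?w0.
have [h [hin]] := hd v (conj cv w0); rewrite allp_map => hle.
have [ch wh] := allp_In hhs hin.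
have cvh : cone (v - h).
  apply: (allp_and _ addG (allp_and (fun g a b => conj a b) hle (allp_and (fun g a b => conj a b) cv ch))).
  by move=> g hg [h1 [h2 h3]]; rewrite addformB//; lia.
have wvh : (w (v - h)%R < w v)%N.
  have : (w (v - h)%R + w h = w v)%N.
    rewrite /w -big_split /=; move: addG hle cv ch; rewrite /cone; elim: (G) => [|g s IHs] /=.
      by rewrite !big_nil.
    move=> [a1 a2] [b1 b2] [c1 c2] [d1 d2]; rewrite !big_cons IHs//; congr (_ + _)%N.
    by rewrite addformB//; lia.
  by lia.
have [n [v0 [hv0 e]]] := IH (v - h) (ltac:(by lia)) cvh.
have [k kl hk] : exists2 k, (k < size hs)%N & h = nth 0 hs k.
  elim: (hs) hin => //= a s IHs [->|/IHs[k kl ->]]; first by exists 0%N.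
  by exists k.+1.
exists (fun i => n i + (i == k))%N, v0; split=> //.
have -> : v = (v - h) + h by rewrite subrK.
rewrite e addrAC; congr (_ + _).
under [RHS]eq_bigr do rewrite mulrnDr.
rewrite big_split /=; congr (_ + _).
rewrite (bigD1 (Ordinal kl))//= eqxx mulr1n big1 ?addr0//.
by move=> i ik; rewrite (_ : (i : nat) == k = false) ?mulr0n//; apply: contraNF ik => /eqP e'; apply/eqP/val_inj.
Qed.

Section Sum.
Variables (R : realType) (q : R) (Z : zmodType) (lam : E -> R) (key : E -> Z) (D : E -> Prop) (C : int).
Hypothesis q1 : 1 < q.
Hypothesis addlam : forall u v, lam (u + v) = lam u + lam v.
Hypothesis addkey : forall u v, key (u + v) = key u + key v.
Hypothesis boundD : forall o, D o -> allp (fun g => - C <= g o) G.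
Hypothesis lam_cone : forall o v, D o -> cone v -> 0 <= lam v /\ (key v != 0 -> 0 < lam v).

Let lam0 : lam 0 = 0.
Proof. by have := addlam 0 0; rewrite addr0; lra. Qed.
Let key0 : key 0 = 0.
Proof. by have := addkey 0 0; rewrite addr0 => /eqP; rewrite -subr_eq0 opprD addrA subrr sub0r oppr_eq0 => /eqP. Qed.
Let lamMn v n : lam (v *+ n) = lam v *+ n.
Proof. by elim: n => [|n IH]; rewrite ?mulr0n// !mulrS addlam IH. Qed.
Let keyMn v n : key (v *+ n) = key v *+ n.
Proof. by elim: n => [|n IH]; rewrite ?mulr0n// !mulrS addkey IH. Qed.

(** Both v and -v lie in the cone, so [lam] vanishes at v, and a nonzero key would make it
    positive. *)
Let lam_lineal o v : D o -> lineal v -> lam v = 0 /\ key v = 0.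
Proof.
move=> Do hv; have cv : cone v by apply: allp_impl hv => g ->.
have cNv : cone (- v).
  by apply: (allp_and _ addG hv) => g hg h; rewrite addformN// h oppr0.
have lamN : lam (- v) = - lam v by have := addlam v (- v); rewrite subrr lam0; lra.
have [h1 h2] := lam_cone Do cv; have [h3 _] := lam_cone Do cNv.
have e : lam v = 0 by lra.
by split=> //; apply/eqP; apply: contraT => /h2; rewrite e ltxx.
Qed.

(** A point of D minus a Dickson-minimal one lies in the cone and decomposes by [cone_gen]. The
    lineal part changes neither [lam] nor [key]; generators with key 0 are dropped, which can only
    decrease [lam]. *)
Lemma represent : exists (bs hs : seq E),
  allp D bs /\ allp (fun h => 0 < lam h) hs /\
  forall o, D o -> exists (b : nat) (n : nat -> nat), [/\ (b < size bs)%N,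
    key o = key (nth 0 bs b) + \sum_(i < size hs) key (nth 0 hs i) *+ n i &
    lam (nth 0 bs b) + \sum_(i < size hs) lam (nth 0 hs i) *+ n i <= lam o].
Proof.
have [[p0 Dp0]|nD] := pselect (exists o, D o); last first.
  by exists [::], [::]; split=> //; split=> // o Do; case: nD; exists o.
have [hs0 [chs0 gen]] := cone_gen.
have [bs [Dbs hbs]] := dickson [seq (fun o => `|(g o + C)%R|%N) | g <- G] D.
pose hs := [seq h <- hs0 | key h != 0].
exists bs, hs; split=> //; split.
  rewrite /hs; elim: (hs0) chs0 => //= h s IHs [ch /IHs hr]; case: ifP => //= kh.
  by split=> //; case: (lam_cone Dp0 ch) => _; apply.
move=> o Do; have [b [bin]] := hbs o Do; rewrite allp_map => hle.
have [k kl hk] : exists2 k, (k < size bs)%N & b = nth 0 bs k.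
  elim: (bs) bin => //= a s IHs [->|/IHs[k kl ->]]; first by exists 0%N.
  by exists k.+1.
have Db := allp_In Dbs bin.
have cob : cone (o - b).
  apply: (allp_and _ addG (allp_and (fun g a b => conj a b) hle
    (allp_and (fun g a b => conj a b) (boundD Do) (boundD Db)))).
  by move=> g hg [h1 [h2 h3]]; rewrite addformB//; lia.
have [n [v0 [hv0 e]]] := gen _ cob; have [l0 k0] := lam_lineal Do hv0.
have key_sum m s (f : nat -> nat) : key (\sum_(i < m) (nth 0 s i) *+ f i) = \sum_(i < m) key (nth 0 s i) *+ f i.
  by elim: m => [|m IH]; rewrite ?big_ord0// !big_ord_recr /= addkey keyMn IH.
have lam_sum m s (f : nat -> nat) : lam (\sum_(i < m) (nth 0 s i) *+ f i) = \sum_(i < m) lam (nth 0 s i) *+ f i.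
  by elim: m => [|m IH]; rewrite ?big_ord0// !big_ord_recr /= addlam lamMn IH.
have eo : o = b + (\sum_(i < size hs0) (nth 0 hs0 i) *+ n i + v0) by rewrite -e addrC subrK.
have [n' [hk' hl']] : exists n' : nat -> nat,
    \sum_(i < size hs0) key (nth 0 hs0 i) *+ n i = \sum_(i < size hs) key (nth 0 hs i) *+ n' i /\
    \sum_(i < size hs) lam (nth 0 hs i) *+ n' i <= \sum_(i < size hs0) lam (nth 0 hs0 i) *+ n i.
  rewrite /hs; elim: (hs0) chs0 (n) => [|h s IHs] /= chs n1.
    by exists n1; rewrite !big_ord0.
  have [n' [h1 h2]] := IHs chs.2 (fun i => n1 i.+1); have [lh _] := lam_cone Dp0 chs.1.
  case: ifP => kh; last first.
    exists n'; rewrite !big_ord_recl /= (eqP (negbFE kh)) mul0rn add0r; split=> //.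
    by apply: le_trans h2 _; rewrite lerDr mulrn_wge0.
  exists (fun i => if i is i'.+1 then n' i' else n1 0%N); rewrite /= !big_ord_recl /=; split.
    by congr (_ + _).
  by rewrite lerD2l.
exists k, n'; split=> //.
  by rewrite {1}eo !addkey k0 addr0 key_sum hk' hk.
by rewrite {1}eo !addlam l0 addr0 lam_sum -hk lerD2l.
Qed.

Lemma cone_sum : exists B : R, forall (I : eqType) (l : seq I) (om : I -> E),
  uniq l -> (forall i, i \in l -> D (om i)) ->
  (forall i i', i \in l -> i' \in l -> key (om i) = key (om i') -> i = i') ->
  \sum_(i <- l) q `^ (- lam (om i)) <= B.
Proof.
have [bs [hs [Dbs [lhs rep]]]] := represent.
have q0 : 0 < q := lt_trans ltr01 q1.
pose x i := q `^ (- lam (nth 0 hs i)).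
have x0 i : 0 <= x i by rewrite powR_ge0.
have x1 i : (i < size hs)%N -> x i < 1.
  move=> hi; have lh : 0 < lam (nth 0 hs i).
    move: i hi; elim: (hs) lhs => //= h s IHs [h1 /IHs h2] [|i]//=; exact: h2.
  rewrite lt_neqAle /x powR_eq1 gt_eqF// [q < 0]ltNge ltW//= oppr_eq0 gt_eqF//=.
  by rewrite -[X in _ <= X](powRr0 q) ler_powR ?oppr_le0// ltW.
pose geo : R := \prod_(i < size hs) (1 - x i)^-1.
exists (\sum_(b < size bs) q `^ (- lam (nth 0 bs b)) * geo) => I l om ul lD linj.
have ch i : exists bn : nat * (nat -> nat), i \in l -> [/\ (bn.1 < size bs)%N,
    key (om i) = key (nth 0 bs bn.1) + \sum_(k < size hs) key (nth 0 hs k) *+ bn.2 k &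
    lam (nth 0 bs bn.1) + \sum_(k < size hs) lam (nth 0 hs k) *+ bn.2 k <= lam (om i)].
  have [il|nil] := boolP (i \in l); last by exists (0%N, fun _ => 0%N).
  by have [b [n h]] := rep _ (lD i il); exists (b, n).
have [c hc] := choice ch.
(* Bounds the multiplicities over the finite list, so that the codes lie in a finite type; the final
   bound is free of M. *)
pose M := (\max_(i <- l) \max_(k < size hs) (c i).2 k).+1.
have cM i k : i \in l -> (k < size hs)%N -> ((c i).2 k < M)%N.
  move=> il kh; rewrite ltnS.
  apply: leq_trans (@leq_bigmax_seq _ l xpredT (fun i => \max_(k < size hs) (c i).2 k)%N i il isT).
  exact: (@leq_bigmax _ (fun k : 'I_(size hs) => (c i).2 k) (Ordinal kh)).
case: (posnP (size bs)) => [bs0|bs_gt0].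
  rewrite big_seq big1 ?sumr_ge0// => [b _|i /hc[]]; last by rewrite bs0.
  by rewrite mulr_ge0 ?powR_ge0// prodr_ge0// => i _; rewrite invr_ge0 subr_ge0 ltW// x1.
case: (size bs) bs_gt0 hc => // nb _ hc.
pose FT := ('I_nb.+1 * {ffun 'I_(size hs) -> 'I_M})%type.
pose code i : FT := (inord (c i).1, [ffun k : 'I_(size hs) => inord ((c i).2 (nat_of_ord k))]).
pose W (f : FT) := q `^ (- lam (nth 0 bs f.1)) * \prod_(k < size hs) x k ^+ f.2 k.
have W0 f : 0 <= W f by rewrite mulr_ge0 ?powR_ge0// prodr_ge0// => k _; rewrite exprn_ge0.
apply: (@le_trans _ _ (\sum_(i <- l) W (code i))).
  rewrite big_seq [leRHS]big_seq; apply: ler_sum => i il.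
  have [h1 h2 h3] := hc i il; rewrite /W /code /=.
  apply: (@le_trans _ _ (q `^ (- (lam (nth 0 bs (c i).1) + \sum_(k < size hs) lam (nth 0 hs k) *+ (c i).2 k)))).
    by rewrite ler_powR ?lerN2// ltW.
  rewrite opprD powRD; last by rewrite (gt_eqF q0) implybT.
  rewrite inordK// ler_wpM2l ?powR_ge0//.
  rewrite le_eqVlt; apply/orP; left; apply/eqP.
  have -> : \prod_(k < size hs) x k ^+ [ffun k0 : 'I_(size hs) => inord ((c i).2 k0) : 'I_M] k =
     \prod_(k < size hs) x k ^+ (c i).2 k.
    by apply: eq_bigr => k _; rewrite ffunE inordK// cM.
  elim: (size hs) => [|m IH]; first by rewrite !big_ord0 oppr0 powRr0.
  rewrite !big_ord_recr /= opprD powRD; last by rewrite (gt_eqF q0) implybT.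
  rewrite IH; congr (_ * _).
  by rewrite /x -powR_mulrn ?powR_ge0// -powRrM mulNr mulr_natr.
have ucode : uniq (map code l).
  rewrite map_inj_in_uniq// => i i' il il' e; apply: linj => //.
  have [h1 h2 _] := hc i il; have [h1' h2' _] := hc i' il'.
  have e1 : (c i).1 = (c i').1.
    by have := congr1 (fun f : FT => nat_of_ord f.1) e; rewrite /= !inordK.
  rewrite h2 h2' e1; congr (_ + _); apply: eq_bigr => k _.
  have := congr1 (fun f : FT => nat_of_ord (f.2 k)) e.
  by rewrite /= !ffunE !inordK ?cM// => ->.
rewrite -(big_map code xpredT W) (big_uniq _ ucode) big_mkcond /=.
apply: (@le_trans _ _ (\sum_(f : FT) W f)).
  by apply: ler_sum => f _; case: ifP.
rewrite -(pair_big xpredT xpredT (fun b f => W (b, f))) /=.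
apply: ler_sum => b _; rewrite /W /= -mulr_sumr ler_wpM2l ?powR_ge0//.
rewrite -(bigA_distr_bigA (fun k (a : 'I_M) => x (nat_of_ord k) ^+ a)).
apply: ler_prod => k _; rewrite sumr_ge0 => [|a _]; last by rewrite exprn_ge0.
have xk := x1 k (ltn_ord k).
have xp : 0 < 1 - x k by rewrite subr_gt0.
rewrite -(ler_pM2l xp) mulfV ?gt_eqF// -[1 - x k]opprB mulNr -subrX1 opprB.
by rewrite lerBlDr lerDl exprn_ge0.
Qed.

End Sum.
End Cone.

(** * Atomic formulas in terms of orders *)

Section OrderAtoms.
Variable F : NALocalField0.
Implicit Types (x y : F).

Lemma ord_le0P y : ord_le 0 y <-> y = 0.
Proof. by split=> [[//|[]//]|->]; left. Qed.

Lemma not_ord_leP x y : ~ ord_le x y <-> y != 0 /\ vge x (lf_ord y + 1).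
Proof.
split=> [h|[y0 hx]].
  have y0 : y != 0 by apply/eqP => y0; apply: h; left.
  split=> //; have [->|x0] := eqVneq x 0; first by left.
  right; rewrite -ltzD1 ltrD2r ltNge; apply/negP => xy; apply: h; right.
  by split=> //; apply/eqP.
move=> [/eqP|[/eqP x0 hxy]]; first by rewrite (negPf y0).
by have := vge_ordP x0 hx; lia.
Qed.

Lemma in_MP x : in_M (@lf_ord F) x <-> vge x 1.
Proof. by split=> -[h|h]; [left|right|left|right]. Qed.

Lemma rv_eqP N x y : (0 < N)%N -> rv_eq N x y <->
  (x = 0 /\ y = 0) \/ [/\ x <> 0, y <> 0 & vge (x - y) (lf_ord (N%:R * y) + 1)].
Proof.
move=> N0; have n0 := natr_neq0 F N0; rewrite /rv_eq; split.
  move=> [h|[x0 [y0 [z [/in_MP hz e]]]]]; [by left|right; split=> //].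
  have y0' : y != 0 by apply/eqP.
  have -> : x - y = (N%:R * y) * z.
    by rewrite -[X in X - y](divfK y0' x) e; ring.
  exact: vgeM.
move=> [h|[x0 y0 h]]; [by left|right; split=> //; split=> //].
have y0' : y != 0 by apply/eqP.
have ny : N%:R * y != 0 by rewrite mulf_neq0.
exists ((x - y) / (N%:R * y)); split; first by apply/in_MP/vge_divl.
by field; rewrite y0' n0.
Qed.

Lemma rv_eq_atoms N x y : (0 < N)%N -> rv_eq N x y <->
  (ord_le 0 x /\ ord_le 0 y) \/ (~ ord_le 0 x /\ ~ ord_le 0 y /\ ~ ord_le (x - y) (N%:R * y)).
Proof.
move=> N0; rewrite rv_eqP// !ord_le0P not_ord_leP; have n0 := natr_neq0 F N0.
split=> [[h|[x0 y0 h]]|[h|[x0 [y0 [_ h]]]]]; [by left|right|by left|right] => //.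
by split=> //; split=> //; split=> //; rewrite mulf_neq0//; apply/eqP.
Qed.

Lemma rv_eq_refl N x : rv_eq N x x.
Proof.
have [->|/eqP x0] := eqVneq x 0; first by left.
right; split=> //; split=> //; exists 0; split; first by left.
by rewrite divff ?mulr0 ?addr0//; apply/eqP.
Qed.

Lemma rv_eq_err N x y k : (0 < N)%N -> rv_eq N x y -> vge y k ->
  vge (x - y) (lf_ord (N%:R : F) + k + 1).
Proof.
move=> N0 /(rv_eqP _ _ N0)[[-> ->] _|[x0 y0 h] hk]; first by rewrite subrr; left.
have y0' : y != 0 by apply/eqP.
apply: vge_le h; rewrite lf_ordM ?natr_neq0//; have := vge_ordP y0' hk; lia.
Qed.

Lemma rv_eq_intro N x y : (0 < N)%N -> y != 0 -> vge (x - y) (lf_ord (N%:R * y) + 1) -> rv_eq N x y.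
Proof.
move=> N0 y0 h; have n0 := natr_neq0 F N0; apply/rv_eqP => //; right; split=> //; last exact/eqP.
have [h' _] : y + (x - y) != 0 /\ lf_ord (y + (x - y)) = lf_ord y.
  apply: ord_dom => //; apply: vge_le h; rewrite lf_ordM//.
  by have := vge_ordP n0 (vge_natr F N); lia.
by apply/eqP; move: h'; rewrite addrC subrK.
Qed.

(** An error a + b - c smaller than N times one of the three terms can be absorbed into that term.
    Conversely the three perturbations are smaller than N times the term of least order. *)
Lemma oplus_atoms N a b c : (0 < N)%N ->
  (exists x1 x2 x3 : F, [/\ rv_eq N x1 a, rv_eq N x2 b, rv_eq N x3 c & x1 + x2 = x3]) <->
  ord_le 0 (a + b - c) \/ (~ ord_le 0 a /\ ~ ord_le (a + b - c) (N%:R * a)) \/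
  (~ ord_le 0 b /\ ~ ord_le (a + b - c) (N%:R * b)) \/
  (~ ord_le 0 c /\ ~ ord_le (a + b - c) (N%:R * c)).
Proof.
move=> N0; have n0 := natr_neq0 F N0; rewrite !ord_le0P !not_ord_leP; split; last first.
  move=> [/eqP|[[/eqP x0 [_ h]]|[[/eqP x0 [_ h]]|[/eqP x0 [_ h]]]]].
  - by rewrite subr_eq0 => /eqP e; exists a, b, c; split=> //; exact: rv_eq_refl.
  - exists (c - b), b, c; split; try exact: rv_eq_refl; last by rewrite subrK.
    by apply: rv_eq_intro => //; rewrite -opprB; apply: vgeN; rewrite opprB addrA.
  - exists a, (c - a), c; split; try exact: rv_eq_refl; last by rewrite addrC subrK.
    apply: rv_eq_intro => //; rewrite -opprB; apply: vgeN.
    by have -> : b - (c - a) = a + b - c by ring.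
  - by exists a, b, (a + b); split; try exact: rv_eq_refl; last by []; apply: rv_eq_intro.
move=> [x1 [x2 [x3 [h1 h2 h3 e]]]].
have eE : a + b - c = - (x1 - a) - (x2 - b) + (x3 - c) by rewrite -e; ring.
have key k : vge a k -> vge b k -> vge c k ->
    vge (a + b - c) (lf_ord (N%:R : F) + k + 1).
  move=> ha hb hc; rewrite eE; apply: vgeD; last exact: rv_eq_err h3 hc.
  by apply: vgeB; [apply: vgeN; exact: rv_eq_err h1 ha|exact: rv_eq_err h2 hb].
have fin (w : F) : w != 0 -> vge a (lf_ord w) -> vge b (lf_ord w) -> vge c (lf_ord w) ->
    w <> 0 /\ N%:R * w != 0 /\ vge (a + b - c) (lf_ord (N%:R * w) + 1).
  move=> w0 ha hb hc; split; first exact/eqP.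
  by rewrite mulf_neq0//; split=> //; rewrite lf_ordM//; exact: key.
have [a0|a0] := eqVneq a 0; have [b0|b0] := eqVneq b 0; have [c0|c0] := eqVneq c 0.
- by left; rewrite a0 b0 c0 addr0 subr0.
- by right; right; right; apply: fin => //; [rewrite a0|rewrite b0]; left.
- by right; right; left; apply: fin => //; [rewrite a0|rewrite c0]; left.
- right; right; have [bc|/ltW cb] := leP (lf_ord b) (lf_ord c).
    by left; apply: fin => //; [rewrite a0; left|right].
  by right; apply: fin => //; [rewrite a0; left|right].
- by right; left; apply: fin => //; [rewrite b0|rewrite c0]; left.
- right; have [ac|/ltW ca] := leP (lf_ord a) (lf_ord c).
    by left; apply: fin => //; [rewrite b0; left|right].
  by right; right; apply: fin => //; [right|rewrite b0; left].
- right; have [ab|/ltW ba] := leP (lf_ord a) (lf_ord b).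
    by left; apply: fin => //; [right|rewrite c0; left].
  by right; left; apply: fin => //; [right|rewrite c0; left].
- right; have [ab|/ltW ba] := leP (lf_ord a) (lf_ord b).
    have [ac|/ltW ca] := leP (lf_ord a) (lf_ord c).
      by left; apply: fin => //; right.
    by right; right; apply: fin => //; right=> //; apply: le_trans ab.
  have [bc|/ltW cb] := leP (lf_ord b) (lf_ord c).
    by right; left; apply: fin => //; right.
  by right; right; apply: fin => //; right=> //; apply: le_trans ba.
Qed.

Section Pnd.
Variables (N d : nat) (x : F) (a : 'I_d.+1 -> F).
Hypothesis N_gt0 : (0 < N)%N.
Hypothesis x0 : x != 0.
Let n := lf_ord (N%:R : F).
Let A (i : 'I_d.+1) := a i * x ^+ i.
Let G := \sum_(i < d.+1) A i.
Let G1 := \sum_(i < d.+1) A i *+ i.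

Let n0 : (N%:R : F) != 0. Proof. exact: natr_neq0. Qed.
Let n_ge0 : 0 <= n. Proof. exact: (vge_ordP n0 (vge_natr F N)). Qed.

(** The substitution x (1 + u) moves the approximate root to 1; S is the expansion in u, with
    coefficients S_0 = G and S_1 = G1. *)
Let P := \poly_(i < d.+1) A (inord i).
Let S := \poly_(l < size P) P^`N(l).[1].

Let PE (t : F) : P.[t] = \sum_(i < d.+1) A i * t ^+ i.
Proof. by rewrite horner_poly; apply: eq_bigr => i _; rewrite inord_val. Qed.

Let SE (u : F) : S.[u] = P.[1 + u].
Proof. by rewrite horner_poly (taylor _ _ (leqnn _)). Qed.

Let S0 : S`_0 = G.
Proof.
rewrite -horner_coef0 SE addr0 PE; apply: eq_bigr => i _.
by rewrite expr1n mulr1.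
Qed.

Let Scoef l : S`_l = P^`N(l).[1].
Proof. by rewrite coef_poly; case: ltnP => // h; rewrite nderivn_poly0// horner0. Qed.

Let S1 : S`_1 = G1.
Proof.
rewrite Scoef -[P^`N(1).[1]]mulr1 -{1}[1]add0r.
rewrite (@deriv_taylor _ P 0 1 d.+1); last exact: size_poly.
apply: eq_bigr => i _; congr (_ *+ _).
rewrite /tterm expr1n mulr1 horner_coef0 coef_nderivn addn0 binn mulr1n coef_poly.
by rewrite ltn_ord inord_val.
Qed.

Let Svge mu l : (forall i, vge (A i) mu) -> vge S`_l mu.
Proof.
move=> h; rewrite Scoef horner_coef; apply: vge_sum => i _.
rewrite expr1n mulr1 coef_nderivn; apply: vgeMn; rewrite coef_poly.
by case: ifP => _ //; left.
Qed.

Let min_ord : (exists i : 'I_d.+1, (0 < i)%N && (A i != 0)) ->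
  exists i : 'I_d.+1, [/\ (0 < i)%N, A i != 0 &
    forall k : 'I_d.+1, (0 < k)%N -> vge (A k) (lf_ord (A i))].
Proof.
move=> [i0 hi0].
have [i /andP[i1 i2] hi] := @arg_minP _ _ _ i0
   (fun i : 'I_d.+1 => (0 < i)%N && (A i != 0)) (fun i => lf_ord (A i)) hi0.
exists i; split=> // k k0; have [->|ak] := eqVneq (A k) 0; first by left.
by right; apply: hi; rewrite k0.
Qed.

Let sum0 : \sum_(i < d.+1 | (i : nat) != 0%N) A i + A ord0 = G.
Proof. by rewrite /G [RHS](bigD1 ord0)//= addrC. Qed.

Let G1x : \sum_(i < d) (i.+1)%:R * a (lift ord0 i) * x ^+ i * x = G1.
Proof.
rewrite /G1 big_ord_recl mulr0n add0r; apply: eq_bigr => i _.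
by rewrite /A lift0 exprSr -mulr_natl; ring.
Qed.

(** The terms at the approximate root sum to zero up to order 2 ord N + mu + 1, where mu is the
    least order of a term of positive degree. As ord G1 <= ord N + mu, the first-order expansion at
    1 gives ord G > ord N + ord G1. *)
Lemma Pnd_fwd : Pnd N x a ->
  (forall i, A i = 0) \/ ((exists i : 'I_d.+1, (0 < i)%N /\ A i <> 0) /\
  (forall i : 'I_d.+1, (0 < i)%N -> ord_le G1 (N%:R * A i)) /\ ~ ord_le G (N%:R * G1)).
Proof.
move=> [_ [h2 [xt [hxt [z [hz sz]]]]]].
have [h|h] := pselect (exists i : 'I_d.+1, (0 < i)%N && (A i != 0)); last first.
  left; have A0 (i : 'I_d.+1) : (0 < i)%N -> A i = 0.
    by move=> i0; apply/eqP/negPn/negP => ai; apply: h; exists i; rewrite i0.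
  have a0 (i : 'I_d.+1) : (0 < i)%N -> a i = 0.
    by move=> /A0/eqP; rewrite mulf_eq0 expf_eq0 (negPf x0) andbF orbF => /eqP.
  have z0 (i : 'I_d.+1) : (0 < i)%N -> z i = 0.
    by move=> i0; have := hz i; rewrite a0// mul0r => -[[]//|[_ []]].
  have zz : z ord0 = 0.
    by move: sz; rewrite (bigD1 ord0)//= big1 ?addr0// => i i0; apply: z0; rewrite lt0n.
  move=> i; have [i0|] := posnP i; last exact: A0.
  have -> : i = ord0 by apply: val_inj.
  have := hz ord0; rewrite zz expr0 mulr1 => -[[_ e]|[]//].
  by rewrite /A e mul0r.
right; have [i1 [i1_gt0 Ai1 hmin]] := min_ord h.
set mu := lf_ord (A i1) in hmin.
have hole (i : 'I_d.+1) : (0 < i)%N -> ord_le G1 (N%:R * A i).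
  case: (unliftP ord0 i) => [k ->|->//] _.
  have := h2 (fun i => (i.+1)%:R * a (lift ord0 i) * x ^+ i) (fun i => rv_eq_refl N _) k.
  have e : x * (a (lift ord0 k) * x ^+ k * N%:R) = N%:R * A (lift ord0 k).
    by rewrite /A lift0 exprS; ring.
  have eG : (\sum_(k < d) (k.+1)%:R * a (lift ord0 k) * x ^+ k) * x = G1.
    by rewrite mulr_suml G1x.
  move=> [h0|[s0 hs]]; first by left; rewrite -e h0 mulr0.
  have [h0|h0] := eqVneq (a (lift ord0 k) * x ^+ k * N%:R) 0; first by left; rewrite -e h0 mulr0.
  right; rewrite -e -eG; split; first by apply/eqP; rewrite mulf_neq0//; apply/eqP.
  have s0' : \sum_(k < d) (k.+1)%:R * a (lift ord0 k) * x ^+ k != 0 by apply/eqP.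
  by rewrite (lf_ordM s0' x0) (lf_ordM x0 h0) addrC lerD2l.
split; first by exists i1; split=> //; apply/eqP.
split=> //; apply/not_ord_leP.
have NA : N%:R * A i1 != 0 by rewrite mulf_neq0.
have [G1_0 oG1] : G1 != 0 /\ lf_ord G1 <= n + mu.
  case: (hole i1 i1_gt0) => [/eqP|[/eqP g0]]; first by rewrite (negPf NA).
  by rewrite lf_ordM.
split; first by rewrite mulf_neq0.
have xt0 : xt != 0 by case: hxt => [[_ /eqP]|[/eqP]//]; rewrite (negPf x0).
have xerr := rv_eq_err N_gt0 hxt (vge_ord x).
pose u := xt / x - 1; have xtE : xt = x * (1 + u) by rewrite /u; field.
have hu : vge u (n + 1).
  have -> : u = (xt - x) / x by rewrite /u; field.
  by apply: vge_divl => //; apply: vge_le xerr; rewrite /n; lia.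
have [u1 ou1] : 1 + u != 0 /\ lf_ord (1 + u) = 0 by apply: (ord_unit _ hu); lia.
pose B i := A i * (1 + u) ^+ i.
have BE i : a i * xt ^+ i = B i by rewrite /B /A xtE exprMn; ring.
have vB i k : vge (A i) k -> vge (B i) k.
  move=> h'; rewrite -[k]addr0; apply: vgeM => //.
  by rewrite -(mulr0 i%:Z); apply: vgeX; right; rewrite ou1.
have N2 : (0 < N ^ 2)%N by rewrite expn_gt0 N_gt0.
have on2 : lf_ord ((N ^ 2)%:R : F) = n + n.
  by rewrite natrX expr2 lf_ordM.
have sumB k : (forall i, vge (A i) k) -> vge (\sum_(i < d.+1) B i) (n + n + k + 1).
  move=> hk; have -> : \sum_(i < d.+1) B i = - \sum_(i < d.+1) (z i - B i).
    by rewrite sumrB sz sub0r opprK.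
  apply: vgeN; apply: vge_sum => i _; rewrite -on2.
  by apply: rv_eq_err N2 _ (vB _ _ (hk i)); rewrite -BE.
(* Otherwise the constant term would be the only one of least order, and the terms could not sum to
   something small. *)
have hA0 : vge (A ord0) mu.
  apply: contrapT => /not_vge[A0 oA0].
  have hk i : vge (A i) (lf_ord (A ord0)).
    have [i0|i0] := posnP i; last by apply: vge_le (hmin i i0); lia.
    by have -> : i = ord0 by apply: val_inj.
  have B0 : B ord0 = A ord0 by rewrite /B expr0 mulr1.
  have := sumB _ hk; rewrite (bigD1 ord0)//= B0 => hs.
  have hr : vge (\sum_(i < d.+1 | i != ord0) B i) (lf_ord (A ord0) + 1).
    apply: vge_sum => i i0; apply: vB; apply: (vge_le (k := mu)); first by lia.
    by apply: hmin; rewrite lt0n.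
  have : vge (A ord0) (lf_ord (A ord0) + 1).
    rewrite -{1}[A ord0](addrK (\sum_(i < d.+1 | i != ord0) B i)).
    by apply: vgeB => //; apply: vge_le hs; lia.
  by move=> /(vge_ordP A0); lia.
have hA i : vge (A i) mu.
  have [i0|i0] := posnP i; last exact: hmin.
  by have -> : i = ord0 by apply: val_inj.
have S_u : S.[u] = \sum_(i < d.+1) B i by rewrite SE PE.
have := @poly_diff F S mu (n + 1) (n + 1) u 0 (fun l => Svge l hA) (ltac:(lia)) hu.
rewrite subr0 => /(_ (or_introl erefl) hu); rewrite horner_coef0 S0 S1 S_u => hd.
have -> : G = \sum_(i < d.+1) B i - G1 * u - (\sum_(i < d.+1) B i - G - G1 * u) by ring.
rewrite lf_ordM// -/n; apply: vgeB; first apply: vgeB.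
- by apply: vge_le (sumB _ hA); lia.
- by apply: vge_le (vgeM (vge_ord G1) hu); lia.
- by apply: vge_le hd; lia.
Qed.

(** Hensel's lemma for S with radius ord N + 1 > ord G1 - mu yields an exact root x (1 + u), with
    the same image as x in RV_N. *)
Lemma Pnd_bwd :
  (forall i, A i = 0) \/ ((exists i : 'I_d.+1, (0 < i)%N /\ A i <> 0) /\
  (forall i : 'I_d.+1, (0 < i)%N -> ord_le G1 (N%:R * A i)) /\ ~ ord_le G (N%:R * G1)) ->
  Pnd N x a.
Proof.
move=> hyp; split; first exact/eqP.
case: hyp => [A0|[[i0 [i0_gt0 /eqP Ai0]] [hole /not_ord_leP[NG1 hG]]]].
  have a0 i : a i = 0.
    by have /eqP := A0 i; rewrite mulf_eq0 expf_eq0 (negPf x0) andbF orbF => /eqP.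
  split; first by move=> y _ i; left; rewrite a0 !mul0r.
  exists x; split; first exact: rv_eq_refl.
  exists (fun=> 0); split; last by rewrite big1.
  by move=> i; left; rewrite a0 mul0r.
have G1_0 : G1 != 0 by apply: contraNneq NG1 => ->; rewrite mulr0.
have [i1 [i1_gt0 Ai1 hmin]] : exists i : 'I_d.+1, [/\ (0 < i)%N, A i != 0 &
    forall k : 'I_d.+1, (0 < k)%N -> vge (A k) (lf_ord (A i))].
  by apply: min_ord; exists i0; rewrite i0_gt0.
set mu := lf_ord (A i1) in hmin.
have NA : N%:R * A i1 != 0 by rewrite mulf_neq0.
have oG1 : lf_ord G1 <= n + mu.
  case: (hole i1 i1_gt0) => [/eqP|[_]]; first by rewrite (negPf NA).
  by rewrite lf_ordM.
have vG1 : vge G1 mu.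
  apply: vge_sum => i _; have [->|ip] := posnP i; first by rewrite mulr0n; left.
  by apply: vgeMn; apply: hmin.
have muG1 := vge_ordP G1_0 vG1.
split.
  move=> y hy i.
  have sy : vge ((\sum_(k < d) y k) * x - G1) (lf_ord G1 + 1).
    rewrite -{1}G1x mulr_suml -sumrB; apply: vge_sum => k _.
    rewrite -mulrBl; set c := (k.+1)%:R * a (lift ord0 k) * x ^+ k.
    have cx : vge (c * x) mu.
      have -> : c * x = A (lift ord0 k) *+ k.+1.
        by rewrite /c /A lift0 exprSr -mulr_natl; ring.
      by apply: vgeMn; apply: hmin; rewrite lift0.
    have [c0|c0] := eqVneq c 0.
      have := hy k; rewrite -/c c0 => -[[-> _]|[_ [//]]].
      by rewrite subrr mul0r; left.
    have cx0 : c * x != 0 by rewrite mulf_neq0.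
    have h1 := vge_ordP cx0 cx; rewrite lf_ordM// in h1.
    have := vgeM (rv_eq_err N_gt0 (hy k) (vge_ord c)) (vge_ord x); rewrite -/c.
    by apply: vge_le; rewrite -/n; lia.
  have [s0 os] : (\sum_(k < d) y k) * x != 0 /\ lf_ord ((\sum_(k < d) y k) * x) = lf_ord G1.
    by have := ord_dom G1_0 sy; rewrite addrC subrK.
  have s0' : \sum_(k < d) y k != 0 by apply: contraNneq s0 => ->; rewrite mul0r.
  have e : a (lift ord0 i) * x ^+ i * N%:R * x = N%:R * A (lift ord0 i).
    by rewrite /A lift0 exprSr; ring.
  have [b0|b0] := eqVneq (a (lift ord0 i) * x ^+ i * N%:R) 0; first by left.
  right; split; first exact/eqP.
  have : lf_ord G1 <= lf_ord (N%:R * A (lift ord0 i)).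
    case: (hole (lift ord0 i)) => [|/eqP|[]//]; first by rewrite lift0.
    by rewrite -e mulf_eq0 (negPf b0) (negPf x0).
  by rewrite -e -os (lf_ordM s0' x0) (lf_ordM b0 x0) lerD2r.
have hA0 : vge (A ord0) mu.
  rewrite -[A ord0](addKr (\sum_(i < d.+1 | (i : nat) != 0%N) A i)) sum0 addrC.
  apply: vgeB; first by apply: vge_le hG; rewrite lf_ordM// -/n; lia.
  by apply: vge_sum => i ip; apply: hmin; rewrite lt0n.
have hA i : vge (A i) mu.
  have [ip|ip] := posnP i; last exact: hmin.
  by have -> : i = ord0 by apply: val_inj.
have [||||||u [hu1 hu2]] := @hensel F S mu (lf_ord G1 - mu) (n + 1).
- by move=> l; apply: Svge.
- by rewrite S1.
- by rewrite S1; lia.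
- by lia.
- by lia.
- by rewrite S0; apply: vge_le hG; rewrite lf_ordM// -/n; lia.
exists (x * (1 + u)); split.
  apply: rv_eq_intro => //; rewrite mulrDr mulr1 addrC addKr lf_ordM//.
  by apply: vge_le (vgeM (vge_ord x) hu2); rewrite -/n; lia.
exists (fun i => a i * (x * (1 + u)) ^+ i); split; first by move=> i; exact: rv_eq_refl.
by rewrite -[RHS]hu1 SE PE; apply: eq_bigr => i _; rewrite exprMn /A; ring.
Qed.

End Pnd.

Lemma Pnd_atoms N d (x : F) (a : 'I_d.+1 -> F) : (0 < N)%N ->
  Pnd N x a <-> ~ ord_le 0 x /\ ((forall i, ord_le 0 (a i * x ^+ i)) \/
   ((exists i : 'I_d.+1, (0 < i)%N /\ ~ ord_le 0 (a i * x ^+ i)) /\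
    (forall i : 'I_d.+1, (0 < i)%N ->
        ord_le (\sum_(k < d.+1) a k * x ^+ k *+ k) (N%:R * (a i * x ^+ i))) /\
    ~ ord_le (\sum_(k < d.+1) a k * x ^+ k)
        (N%:R * (\sum_(k < d.+1) a k * x ^+ k *+ k)))).
Proof.
move=> N0; split=> [h|[/ord_le0P/eqP x0 h]].
  have x0 : x != 0 by apply/eqP; case: h.
  split; first by move/ord_le0P/eqP; rewrite (negPf x0).
  case: (Pnd_fwd N0 x0 h) => [h'|[[i [i0 hi]] h']].
    by left=> i; apply/ord_le0P; exact: h'.
  by right; split=> //; exists i; split=> // /ord_le0P.
apply: Pnd_bwd => //; case: h => [h|[[i [i0 hi]] h]].
  by left=> i; apply/ord_le0P; exact: h.
by right; split=> //; exists i; split=> // h0; apply: hi; apply/ord_le0P.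
Qed.

End OrderAtoms.

(* The free variables [0 .. m] keep their indices; the other valued-field variables and all
   the RV-variables are interleaved beyond [m]. *)
Definition vidx (m i : nat) : nat := if (i <= m)%N then i else (m.+1 + i.*2)%N.
Definition ridx (m n i : nat) : nat := (m.+1 + (choice.pickle (n, i)).*2.+1)%N.

Lemma idx_env (T : Type) (m : nat) (venv : nat -> T) (renv : nat -> nat -> T) :
  exists z : nat -> T, (forall i, z (vidx m i) = venv i) /\
    forall n i, z (ridx m n i) = renv n i.
Proof.
pose g (k : nat) : T := if odd k then
    (if choice.unpickle k./2 is Some p then renv p.1 p.2 else venv 0) else venv k./2.
exists (fun k => if (k <= m)%N then venv k else g (k - m.+1)%N); split=> [i|n i].
  rewrite /vidx; case: (leqP i m) => h /=; first by rewrite h.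
  by rewrite ifF ?addKn /g ?odd_double ?doubleK//; lia.
by rewrite /ridx ifF ?addKn /g /= ?odd_double ?uphalf_double ?pickleK//; lia.
Qed.

Section Terms.
Variables (P : Type) (K : NALocalField0) (par : P -> K) (m M : nat).
Local Notation A := (ip K M).
Implicit Types t : vterm P.

Fixpoint polv t : A :=
  match t with
  | VVar i => ivar K M (vidx m i)
  | VPar c => icst M (par c)
  | VZero => 0
  | VOne => 1
  | VAdd a b => polv a + polv b
  | VOpp a => - polv a
  | VMul a b => polv a * polv b
  end.

Fixpoint polr n (t : rterm P n) : A :=
  match t with
  | RVar n i => ivar K M (ridx m n i)
  | RZero _ => 0
  | ROne _ => 1
  | RMul _ a b => polr a * polr b
  | Rrv _ s => polv s
  | Rrvr _ _ _ s => polr s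
  end.

(** The pairs follow the right-hand sides of [rv_eq_atoms], [oplus_atoms] and [Pnd_atoms]; a first
    entry 0 encodes the vanishing of the second. *)
Fixpoint atoms (f : qformula P) : seq (A * A) :=
  match f with
  | FTrue | FFalse => [::]
  | VEq s t => [:: (0, polv s - polv t)]
  | REq n a b => [:: (0, polr a); (0, polr b); (polr a - polr b, (n.+1)%:R * polr b)]
  | RDvd n a b => [:: (polr a, polr b)]
  | ROplus n a b c => let s := polr a + polr b - polr c in
      [:: (0, s); (0, polr a); (0, polr b); (0, polr c);
          (s, (n.+1)%:R * polr a); (s, (n.+1)%:R * polr b); (s, (n.+1)%:R * polr c)]
  | RPred n d xi zs => let X i := polr (zs i) * polr xi ^+ i in
      let G := \sum_(k < d.+1) X k in let G1 := \sum_(k < d.+1) X k *+ k in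
      [:: (0, polr xi), (G, (n.+1)%:R * G1) & [seq (0, X i) | i <- index_enum 'I_d.+1]] ++
      [seq (G1, (n.+1)%:R * X i) | i <- index_enum 'I_d.+1]
  | FNot g => atoms g
  | FAnd g h | FOr g h => atoms g ++ atoms h
  end.

Section Value.
Variables (F : NALocalField0) (psi : {rmorphism A -> F}).
Definition vpar c : F := psi (icst M (par c)).
Definition venv_of i : F := psi (ivar K M (vidx m i)).
Definition renv_of n i : F := psi (ivar K M (ridx m n i)).

Lemma polvE t : psi (polv t) = veval vpar venv_of t.
Proof.
elim: t => //=.
- exact: rmorph0.
- exact: rmorph1.
- by move=> a <- b <-; exact: rmorphD.
- by move=> a <-; exact: rmorphN.
- by move=> a <- b <-; exact: rmorphM.
Qed.

Lemma polrE n (t : rterm P n) : psi (polr t) = reval vpar venv_of renv_of t.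
Proof.
elim: t => //=.
- by move=> _; exact: rmorph0.
- by move=> _; exact: rmorph1.
- by move=> k a <- b <-; exact: rmorphM.
- by move=> _ s; exact: polvE.
Qed.

End Value.

Lemma qsat_atoms (F1 F2 : NALocalField0) (psi1 : {rmorphism A -> F1})
    (psi2 : {rmorphism A -> F2}) (f : qformula P) :
  allp (fun pq => ord_le (psi1 pq.1) (psi1 pq.2) <-> ord_le (psi2 pq.1) (psi2 pq.2)) (atoms f) ->
  qsat (vpar psi1) (venv_of psi1) (renv_of psi1) f <->
  qsat (vpar psi2) (venv_of psi2) (renv_of psi2) f.
Proof.
have rE (F : NALocalField0) (psi : {rmorphism A -> F}) :
  ((psi 0 = 0)%R * (forall n, psi n%:R = n%:R)%R * (forall a b, psi (a - b) = psi a - psi b)%R *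
   (forall a b, psi (a + b) = psi a + psi b)%R * (forall a b, psi (a * b) = psi a * psi b)%R *
   (forall a n, psi (a ^+ n) = psi a ^+ n)%R * (forall a n, psi (a *+ n) = psi a *+ n)%R)%type.
  do 6 ?[apply: pair]; [exact: rmorph0|exact: rmorph_nat|exact: rmorphB|exact: rmorphD|
    exact: rmorphM|move=> a n|move=> a n]; [exact: rmorphXn|exact: rmorphMn].
have rS (F : NALocalField0) (psi : {rmorphism A -> F}) k (X : 'I_k -> A) :
  psi (\sum_(i < k) X i) = \sum_(i < k) psi (X i) by exact: rmorph_sum.
elim: f => //=.
- move=> s t [+ _]; rewrite !rE !polvE !ord_le0P => h.
  by split=> e; apply/subr0_eq/h; rewrite e subrr.
- move=> n a b [+ [+ [+ _]]]; rewrite !rE !polrE => h1 h2 h3.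
  by rewrite !rv_eq_atoms// h1 h2 h3.
- by move=> n a b [+ _]; rewrite !polrE.
- move=> n a b c [+ [+ [+ [+ [+ [+ [+ _]]]]]]]; rewrite !rE !polrE.
  move=> h1 h2 h3 h4 h5 h6 h7; rewrite !oplus_atoms//.
  by rewrite h1 h2 h3 h4 h5 h6 h7.
- move=> n d xi zs [h1 [h2]]; rewrite allp_cat !allp_map => -[h3 h4].
  have h3' i : ord_le 0 (psi1 (polr (zs i)) * psi1 (polr xi) ^+ i) <->
     ord_le 0 (psi2 (polr (zs i)) * psi2 (polr xi) ^+ i).
    by have /allp_mem/(_ i (mem_index_enum _)) /= := h3; rewrite !rE.
  have h4' i : ord_le (psi1 (\sum_(k < d.+1) polr (zs k) * polr xi ^+ k *+ k))
         (psi1 (n.+1%:R * (polr (zs i) * polr xi ^+ i))) <->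
     ord_le (psi2 (\sum_(k < d.+1) polr (zs k) * polr xi ^+ k *+ k))
         (psi2 (n.+1%:R * (polr (zs i) * polr xi ^+ i))).
    by have /allp_mem/(_ i (mem_index_enum _)) := h4.
  have eG (F : NALocalField0) (psi : {rmorphism A -> F}) :
      psi (\sum_(k < d.+1) polr (zs k) * polr xi ^+ k) =
      \sum_(k < d.+1) psi (polr (zs k)) * psi (polr xi) ^+ k.
    by rewrite rS; apply: eq_bigr => k _; rewrite !rE.
  have eG1 (F : NALocalField0) (psi : {rmorphism A -> F}) :
      psi (\sum_(k < d.+1) polr (zs k) * polr xi ^+ k *+ k) =
      \sum_(k < d.+1) psi (polr (zs k)) * psi (polr xi) ^+ k *+ k.
    by rewrite rS; apply: eq_bigr => k _; rewrite !rE.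
  have e (F : NALocalField0) (psi : {rmorphism A -> F}) :
      (fun i => reval (vpar psi) (venv_of psi) (renv_of psi) (zs i)) =
      (fun i => psi (polr (zs i))) by apply/funext => i; rewrite polrE.
  rewrite !e -!polrE !Pnd_atoms//.
  move: h1 h2; rewrite /= !rE !eG !eG1 => -> ->.
  have -> : (forall i, ord_le 0 (psi1 (polr (zs i)) * psi1 (polr xi) ^+ i)) <->
            (forall i, ord_le 0 (psi2 (polr (zs i)) * psi2 (polr xi) ^+ i)).
    by split=> h i; apply/h3'.
  have -> : (exists i : 'I_d.+1, (0 < i)%N /\ ~ ord_le 0 (psi1 (polr (zs i)) * psi1 (polr xi) ^+ i)) <->
            (exists i : 'I_d.+1, (0 < i)%N /\ ~ ord_le 0 (psi2 (polr (zs i)) * psi2 (polr xi) ^+ i)).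
    by split=> -[i [i0 hi]]; exists i; split=> // h; apply: hi; apply/h3'.
  suff -> : (forall i : 'I_d.+1, (0 < i)%N ->
        ord_le (\sum_(k < d.+1) psi1 (polr (zs k)) * psi1 (polr xi) ^+ k *+ k)
          (n.+1%:R * (psi1 (polr (zs i)) * psi1 (polr xi) ^+ i))) <->
      (forall i : 'I_d.+1, (0 < i)%N ->
        ord_le (\sum_(k < d.+1) psi2 (polr (zs k)) * psi2 (polr xi) ^+ k *+ k)
          (n.+1%:R * (psi2 (polr (zs i)) * psi2 (polr xi) ^+ i))) by [].
  by split=> h i i0; have := h4' i; rewrite !eG1 !rE => h5; apply/h5/h.
- by move=> g IH /IH ->.
- by move=> g IHg h IHh /allp_cat[/IHg -> /IHh ->].
- by move=> g IHg h IHh /allp_cat[/IHg -> /IHh ->].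
Qed.

End Terms.

Section FinitelyManyVariables.
Variables (P : Type) (K : NALocalField0) (par : P -> K) (m : nat).

Definition agree (B : nat) (z z' : nat -> K) := forall i, (i < B)%N -> z i = z' i.

Let agree_le B B' z z' : (B <= B')%N -> agree B' z z' -> agree B z z'.
Proof. by move=> h hz i iB; apply: hz; apply: leq_trans h. Qed.

Local Notation rnv z := (fun n i => z (ridx m n i)).

Lemma veval_agree t : exists B, forall z z', agree B z z' ->
  veval par (z \o vidx m) t = veval par (z' \o vidx m) t.
Proof.
elim: t => [i|c||| a [Ba ha] b [Bb hb]|a [Ba ha]|a [Ba ha] b [Bb hb]];
  try by exists 0%N.
- by exists (vidx m i).+1 => z z' h /=; apply: h.
- exists (Ba + Bb)%N => z z' h /=; congr (_ + _); [apply: ha|apply: hb];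
    by apply: agree_le h; lia.
- by exists Ba => z z' h /=; rewrite (ha _ z').
- exists (Ba + Bb)%N => z z' h /=; congr (_ * _); [apply: ha|apply: hb];
    by apply: agree_le h; lia.
Qed.

Lemma reval_agree n (t : rterm P n) : exists B, forall z z', agree B z z' ->
  reval par (z \o vidx m) (rnv z) t = reval par (z' \o vidx m) (rnv z') t.
Proof.
elim: t => [k i|k|k|k a [Ba ha] b [Bb hb]|k s|k l h s [B hB]]; try by exists 0%N.
- by exists (ridx m k i).+1 => z z' h /=; apply: h.
- exists (Ba + Bb)%N => z z' h /=; congr (_ * _); [apply: ha|apply: hb];
    by apply: agree_le h; lia.
- by have [B hB] := veval_agree s; exists B.
- by exists B.
Qed.

(** A formula reads finitely many variables, so its truth can be decided inside [ip K M] for a large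
    M. *)
Lemma qsat_agree (f : qformula P) : exists B, forall z z', agree B z z' ->
  qsat par (z \o vidx m) (rnv z) f <-> qsat par (z' \o vidx m) (rnv z') f.
Proof.
elim: f => [||s t|n a b|n a b|n a b c|n d xi zs|g [B hB]|g [Bg hg] h [Bh hh]
   |g [Bg hg] h [Bh hh]]; try by exists 0%N.
- have [B1 h1] := veval_agree s; have [B2 h2] := veval_agree t.
  exists (B1 + B2)%N => z z' h /=; rewrite (h1 z z') ?(h2 z z')//; by apply: agree_le h; lia.
- have [B1 h1] := reval_agree a; have [B2 h2] := reval_agree b.
  exists (B1 + B2)%N => z z' h /=; rewrite (h1 z z') ?(h2 z z')//; by apply: agree_le h; lia.
- have [B1 h1] := reval_agree a; have [B2 h2] := reval_agree b.
  exists (B1 + B2)%N => z z' h /=; rewrite (h1 z z') ?(h2 z z')//; by apply: agree_le h; lia.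
- have [B1 h1] := reval_agree a; have [B2 h2] := reval_agree b; have [B3 h3] := reval_agree c.
  exists (B1 + B2 + B3)%N => z z' h /=.
  by rewrite (h1 z z') ?(h2 z z') ?(h3 z z')//; apply: agree_le h; lia.
- have [B1 h1] := reval_agree xi; have /choice[B2 h2] := fun i => reval_agree (zs i).
  exists (B1 + \sum_(i < d.+1) B2 i)%N => z z' h /=.
  rewrite (h1 z z'); last by apply: agree_le h; lia.
  have -> // : (fun i => reval par (z \o vidx m) (rnv z) (zs i)) =
     (fun i => reval par (z' \o vidx m) (rnv z') (zs i)).
  apply/funext => i; apply: h2; apply: agree_le h.
  by rewrite (bigD1 i)//= addnCA leq_addr.
- by exists B => z z' h /=; rewrite (hB z z').
- by exists (Bg + Bh)%N => z z' h' /=; rewrite (hg z z') ?(hh z z')//; apply: agree_le h'; lia.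
- by exists (Bg + Bh)%N => z z' h' /=; rewrite (hg z z') ?(hh z z')//; apply: agree_le h'; lia.
Qed.

End FinitelyManyVariables.

(** * Classes for a definable function *)

Lemma residues_mod (K : NALocalField0) (n : nat) :
  exists s : seq K, forall x, vge x 0 -> exists2 y, y \in s & vge (x - y) n%:Z.
Proof.
have [r [_ [_ [_ hr]]]] := lf_residue K.
elim: n => [|n [s hs]]; first by exists [:: 0] => x hx; exists 0; rewrite ?mem_head ?subr0.
exists [seq y + unif K * z | y <- r, z <- s] => x hx.
have [y yr hy] := hr x hx.
have hm : vge ((x - y) / unif K) 0.
  apply: vge_divl; first exact: unif_neq0.
  by rewrite ord_unif; case: hy => h; [left|right].
have [z zs hz] := hs _ hm; exists (y + unif K * z); first by apply: allpairs_f.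
have -> : x - (y + unif K * z) = unif K * ((x - y) / unif K - z).
  by have := unif_neq0 K => h; field.
have -> : n.+1%:Z = 1 + n%:Z by lia.
by apply: vgeM => //; right; rewrite ord_unif.
Qed.

(** The residue of a / unif^(ord a) modulo unif^N takes finitely many values and, together with the
    order, determines the leading term to precision N. *)
Lemma angular_component (K : NALocalField0) (N : nat) :
  exists (k : nat) (ac : K -> 'I_k.+1), forall a b, a != 0 -> b != 0 ->
    lf_ord a = lf_ord b -> ac a = ac b -> mt (idv K) N 0 a b.
Proof.
have [s hs] := residues_mod K N.
have /choice[r hr] : forall a : K, exists y, a != 0 ->
    y \in s /\ vge (a / unif K ^ lf_ord a - y) N%:Z.
  move=> a; have [a0|a0] := eqVneq a 0; first by exists 0.
  have [|y ys hy] := hs (a / unif K ^ lf_ord a); last by exists y.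
  by apply: vge_divl; [exact: unifXz_neq0|rewrite ord_unifXz ?add0r ?addr0; exact: vge_ord].
exists (size s), (fun a => inord (index (r a) s)) => a b a0 b0 oab /(congr1 val).
have [[ra ha] [rb hb]] := (hr a a0, hr b b0).
rewrite /= !inordK ?ltnS ?index_size// => eab.
have rab : r a = r b by rewrite -(nth_index 0 ra) eab nth_index.
apply: mt_intro => //; rewrite /= expr0z mul1r.
have := unifXz_neq0 K (lf_ord a) => u0.
have -> : b - a = (b / unif K ^ lf_ord a - r a - (a / unif K ^ lf_ord a - r a)) * unif K ^ lf_ord a.
  by field.
rewrite mul1r addr0 [_ + N%:Z]addrC; apply: vgeM; last by right; rewrite ord_unifXz.
by apply: vgeB => //; rewrite rab oab.
Qed.

Section FunctionData.
Variables (P : Type) (K : NALocalField0) (R : realType) (par : P -> K) (m : nat).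
Variable phi : qformula P.
Local Notation TT F m := (g_sigma_algebraType (boxes F m)).
Local Notation q F := ((lf_q F)%:R : R).
Local Notation evK m z := (ev (idv K) m z).

Definition shift_data (Phi : seq (ip K m * nat)) (E : zmodType) (L : seq (E -> int)) (T : int)
    (kap : E -> int) (sh : E -> ip K m -> int) (lf : E -> int) (C : nat) (B : R)
    (x : vec K m) (y : K) (o : E) : Prop :=
  [/\ forall p, p \in Phi -> sh o p.1 = lf_ord (evK m (vz x) p.1),
     lf o = lf_ord y,
     forall mu : {measure set (TT K m) -> \bar R}, haar_measure mu ->
       (mu (class Phi x) <= (B * q K ^ (- kap o))%:E)%E &
     forall (F : NALocalField0) (j : vext K F) v, adm L T o v ->
       (forall mu : {measure set (TT F m) -> \bar R}, haar_measure mu ->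
        ((q F ^ (- ((vx_e j)%:Z * (kap o + kap v + C%:Z))))%:E <=
         mu [set x' | match_on j Phi (sh v) (vz x) x'])%E) /\
       forall x' : vec F m, match_on j Phi (sh v) (vz x) x' -> exists y',
         def_graph (fun c => j (par c)) m phi x' y' /\ mt j 1 (lf v) y y'].

Definition fun_spec (Phi : seq (ip K m * nat)) (E : zmodType) (L : seq (E -> int)) (T : int)
    (kap : E -> int) (sh : E -> ip K m -> int) (lf : E -> int) (C : nat) (B : R) : Prop :=
  forall x y, def_graph par m phi x y ->
  (forall x', class Phi x x' -> exists y', def_graph par m phi x' y' /\ mt (idv K) 1 0 y y') /\
  ((forall mu : {measure set (TT K m) -> \bar R}, haar_measure mu -> mu (class Phi x) = 0%E) \/
   exists o : E, shift_data Phi L T kap sh lf C B x y o).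

(** An admissible shift of a difference of orders never changes whether it is nonnegative, and
    matching preserves vanishing. *)
Lemma ord_le_mt (F : NALocalField0) (j : vext K F) T (a b : K) (a' b' : F) s t : 0 < T ->
  mt j 1 s a a' -> mt j 1 t b b' -> adm1 T (lf_ord b - lf_ord a) (t - s) ->
  ord_le a b <-> ord_le a' b'.
Proof.
move=> T0 ha hb [h1 h2 h3]; have e0 := vx_gt0 j.
have za := mt_eq0 (ltn0Sn 0) ha; have zb := mt_eq0 (ltn0Sn 0) hb.
have [b0|b0] := eqVneq b 0.
  by move: zb; rewrite b0 eqxx => /eqP ->; split; left.
have b'0 : b' != 0 by rewrite zb.
have [a0|a0] := eqVneq a 0.
  move: za; rewrite a0 eqxx => /eqP ->.
  by rewrite !ord_le0P; split=> /eqP; rewrite ?(negPf b0) ?(negPf b'0).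
have a'0 : a' != 0 by rewrite za.
have oa := mt_ord (ltn0Sn 0) a0 ha; have ob := mt_ord (ltn0Sn 0) b0 hb.
have hd : (lf_ord a <= lf_ord b) = (lf_ord a + s <= lf_ord b + t) by lia.
have hd' : (lf_ord a <= lf_ord b) = (lf_ord a' <= lf_ord b').
  by rewrite hd oa ob ler_pM2l.
split=> -[/eqP|[_ h]]; rewrite ?(negPf b0) ?(negPf b'0)//; right; split; try exact/eqP.
  by rewrite -hd'.
by rewrite hd'.
Qed.

(** The classes are taken for the polynomials that [forth_multi] needs to transfer value and
    witnesses. The forms [fm] compare the two sides of each atom, so that the formula remains true
    after the shift. *)
Lemma function_data : exists (Phi : seq (ip K m * nat)) (E : zmodType) (L : seq (E -> int))
    (T : int) (kap : E -> int) (sh : E -> ip K m -> int) (lf : E -> int) (C : nat) (B : R),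
  [/\ forall p, p \in Phi -> (0 < p.2)%N, 0 < T, allp (@addform _) L, addform kap &
   [/\ addform lf, forall u v, sh (u + v) = sh u + sh v, 0 <= B &
      fun_spec Phi L T kap sh lf C B]].
Proof.
have [d0 hd0] := qsat_agree par m phi.
(* Only variables below d0 are read; the successor ensures that the output variable m lies below
   M. *)
pose d := d0.+1; pose M := (d + m)%N.
pose at_ := atoms par m M phi.
pose Phi1 := ivar K M m :: [seq pq.1 | pq <- at_] ++ [seq pq.2 | pq <- at_].
have [Psi [N' [W [L1 [T1 [N'0 T10 addL1 hforth]]]]]] := @forth_multi K m d Phi1 1 (ltn0Sn 0).
have [Phi [V [L [T [kap [sh [C [B [hPhi Phi_gt0 T0 addL [addk addsh B0 hcl]]]]]]]]]] :=
  classes R Psi N'0.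
pose E := (V * W * (ip K M -> int))%type.
pose p1 (v : E) := v.1.1; pose p2 (v : E) := (sh v.1.1, v.1.2, v.2).
pose fm (pq : ip K M * ip K M) (v : E) : int := v.2 pq.2 - v.2 pq.1.
exists Phi, E, ([seq f \o p1 | f <- L] ++ [seq f \o p2 | f <- L1] ++ [seq fm pq | pq <- at_]),
  (Num.max T T1), (kap \o p1), (fun v => sh v.1.1), (fun v => v.2 (ivar K M m)), C, B.
have T1m : T1 <= Num.max T T1 by rewrite le_max lexx orbT.
have Tm : T <= Num.max T T1 by rewrite le_max lexx.
have Tm0 : 0 < Num.max T T1 by rewrite lt_max T0.
split=> //.
- rewrite !allp_cat !allp_map; split; [|split].
  + by apply: allp_impl addL => f hf u v; rewrite /= -hf.
  + apply: allp_impl addL1 => f hf u v; rewrite /= -hf; congr f.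
    by rewrite /p2 /= addsh.
  + by apply/allp_mem => pq _ u v; rewrite /fm !(pair_add2, fct_addE); ring.
- by move=> u v; rewrite /= -addk.
split=> //;
first by move=> u v; rewrite -addsh.
move=> x y [venv [renv [hx [hy hsat]]]].
have [z [hz1 hz2]] := idx_env m venv renv.
have zx i : (i < m)%N -> z i = vz x i.
  move=> im; rewrite -[i]/(val (Ordinal im)) vz_ord -hx -hz1 /vidx /=.
  by rewrite (ltnW im).
have ex (Q : ip K m) : evK m z Q = evK m (vz x) Q by apply: ev_ext => i im; apply: zx.
have zy : z m = y by rewrite -hy -hz1 /vidx leqnn.
have mM : (m < M)%N by rewrite /M /d; lia.
have evy : evK M z (ivar K M m) = y by rewrite ev_ivar.
have satK : qsat (vpar par (evK M z)) (venv_of m (evK M z)) (renv_of m (evK M z)) phi.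
  have -> : vpar par (evK M z) = par by apply/funext => c; rewrite /vpar ev_icst.
  have ag : agree d0 (fun i => evK M z (ivar K M i)) z.
    by move=> i id0; rewrite ev_ivar// /M /d; lia.
  apply/(hd0 _ _ ag).
  have -> : z \o vidx m = venv by apply/funext.
  by have -> : (fun n i => z (ridx m n i)) = renv by apply/funext => n; apply/funext.
have [w hw] := hforth z.
pose oB (Q : ip K M) := lf_ord (evK M z Q).
have transfer (F : NALocalField0) (j : vext K F) (x' : vec F m) s oA u tau :
   (forall a, a \in Psi -> oA a = lf_ord (evK m (vz x) a)) ->
   (forall a, a \in Psi -> mt j N' (s a) (evK m (vz x) a) (ev j m (vz x') a)) ->
   adm L1 T1 (oA, w, oB) (s, u, tau) ->
   allp (fun pq => adm1 (Num.max T T1) (oB pq.2 - oB pq.1) (tau pq.2 - tau pq.1)) at_ ->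
   exists y', def_graph (fun c => j (par c)) m phi x' y' /\ mt j 1 (tau (ivar K M m)) y y'.
  move=> hoA hs hadm hat.
  have [||z'' [hz'' hm]] := hw oA oB _ (fun _ _ => erefl) F j (vz x') s u tau _ hadm.
  - by move=> a aP; rewrite ex hoA.
  - by move=> a aP; rewrite ex; apply: hs.
  exists (z'' m); split; last first.
    have := hm _ (mem_head _ _); rewrite evy.
    by rewrite (ev_ivar j z'' mM).
  exists (venv_of m (ev j M z'')), (renv_of m (ev j M z'')).
  split; first move=> i.
    by rewrite /venv_of /vidx (ltnW (ltn_ord i)) ev_ivar ?(ltn_trans (ltn_ord i) mM)// hz''// vz_ord.
  split; first by rewrite /venv_of /vidx leqnn ev_ivar.
  have -> : (fun c => j (par c)) = vpar par (ev j M z'').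
    by apply/funext => c; rewrite /vpar ev_icst.
  move: satK; apply: (proj1 (@qsat_atoms P K par m M K F _ _ phi _)).
  rewrite -/at_; apply/allp_mem => pq pqa; move/allp_mem/(_ pq pqa): hat.
  by apply: ord_le_mt => //; apply: hm; rewrite inE mem_cat map_f ?orbT.
split.
  (* Over K itself the zero shift is admissible: the function is defined on the whole class of x,
     and its leading term is constant there. *)
  move=> x' hx'; apply: (transfer K (idv K) x' (fun=> 0) (fun a => lf_ord (evK m (vz x) a)) 0 (fun=> 0)) => //.
  - by move=> a aP; apply: (hx' (a, N')); apply: hPhi.
  - apply: allp_impl (addL1) => f hf; suff -> : f (fun=> 0, 0, fun=> 0) = 0 by split.
    exact: (addform0 hf).
  - by apply/allp_mem => pq _; rewrite subrr; split.
case: (hcl x) => [h|[w0 [ho1 ho2 ho3]]]; [by left|right].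
exists (w0, w, oB); split => //=; first by rewrite /oB evy.
move=> F j v; rewrite /adm !allp_cat !allp_map => -[ad1 [ad2 ad3]]; split.
  by move=> mu hmu; apply: ho3 => //; apply: (adm_le T0 Tm).
move=> x' hx'; apply: (transfer F j x' (sh v.1.1) (sh w0) v.1.2 v.2).
- by move=> a aP; apply: (ho1 (a, N')); apply: hPhi.
- by move=> a aP; apply: (hx' (a, N')); apply: hPhi.
- apply: (adm_le T10 T1m).
  by apply: allp_impl ad2.
- by apply: allp_impl ad3.
Qed.

End FunctionData.

(** * Integrals *)

Section ClassEnumeration.
Variables (K : NALocalField0) (m : nat) (Phi : seq (ip K m * nat)).
Local Notation val_ x p := (ev (idv K) m (vz x) p.1).

(** Vanishing and angular components form a finite pattern. Pattern and orders together are
    countable data that determine the class, and a representative is chosen for each code occurring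
    in X. *)
Lemma class_enum (X : set (vec K m)) : exists (S : finType) (pat : vec K m -> S)
    (A : nat -> Prop) (r : nat -> vec K m),
  [/\ forall n, A n -> X (r n),
      forall x, X x -> exists2 n, A n & class Phi (r n) x,
      forall x x' p, pat x = pat x' -> p \in Phi -> (val_ x p == 0) = (val_ x' p == 0) &
      forall n n', A n -> A n' -> pat (r n) = pat (r n') ->
        (forall p, p \in Phi -> val_ (r n) p != 0 ->
           lf_ord (val_ (r n) p) = lf_ord (val_ (r n') p)) -> n = n'].
Proof.
pose N := (\sum_(p <- Phi) p.2)%N.
have hN p : p \in Phi -> (p.2 <= N)%N.
  by move=> pP; rewrite /N (big_rem p)//= leq_addr.
have [k [ac hac]] := angular_component K N.
pose nt := nth (0, 0%N) Phi.
pose pat (x : vec K m) := [ffun i : 'I_(size Phi) => (val_ x (nt i) == 0, ac (val_ x (nt i)))].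
(* The order of a vanishing value is replaced by 0, so that it does not distinguish codes. *)
pose od (x : vec K m) := [ffun i : 'I_(size Phi) =>
  if val_ x (nt i) == 0 then 0 else lf_ord (val_ x (nt i))].
pose code x := choice.pickle (pat x, od x).
have patP x x' p : pat x = pat x' -> p \in Phi ->
    (val_ x p == 0) = (val_ x' p == 0) /\ ac (val_ x p) = ac (val_ x' p).
  move=> + pP; have ip : (index p Phi < size Phi)%N by rewrite index_mem.
  by move=> /ffunP/(_ (Ordinal ip)); rewrite !ffunE /nt /= nth_index// => -[].
have codeP x x' : code x = code x' -> class Phi x x'.
  move=> /(pcan_inj choice.pickleK)[hp ho] p pP; have [hz ha] := patP _ _ _ hp pP.
  have ip : (index p Phi < size Phi)%N by rewrite index_mem.
  have := congr1 (fun f : {ffun _} => f (Ordinal ip)) ho.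
  rewrite !ffunE /nt /= nth_index//.
  have [x0|x0] := eqVneq (val_ x p) 0.
    by move: hz; rewrite x0 eqxx => /esym/eqP -> _; exact: mt_zero.
  have x'0 : val_ x' p != 0 by rewrite -hz.
  rewrite (negPf x'0) => oE; apply: (mt_le (hN p pP)); exact: hac.
pose A n := exists2 x, X x & code x = n.
have /choice[r hr] : forall n, exists x, A n -> X x /\ code x = n.
  move=> n; have [[x Xx hx]|h] := pselect (A n); first by exists x.
  by exists (fun=> 0) => /h.
exists _, pat, A, r; split.
- by move=> n /hr[].
- move=> x Xx; exists (code x); first by exists x.
  by apply: codeP; apply: (hr _ _).2; exists x.
- by move=> x x' p hp pP; case: (patP _ _ _ hp pP).
- move=> n n' /hr[_ hn] /hr[_ hn'] hp ho; rewrite -hn -hn' /code hp; congr (choice.pickle (_, _)).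
  apply/ffunP => i; rewrite !ffunE.
  have pP : nt i \in Phi by apply: mem_nth.
  have [<- _] := patP _ _ _ hp pP; case: ifP => // /negbT h; exact: ho.
Qed.

End ClassEnumeration.

Section Integrand.
Variables (P : Type) (K : NALocalField0) (R : realType) (par : P -> K) (m : nat).
Variables (phiX phiF : qformula P).
Hypothesis fdef : is_def_fun par m phiX phiF.
Local Notation TT F m := (g_sigma_algebraType (boxes F m)).
Local Notation q F := ((lf_q F)%:R : R).
Local Notation X := (def_set par m phiX).
Local Notation f := (def_fun par m phiF).

Lemma def_funP x y : def_graph par m phiF x y <-> X x /\ f x = y.
Proof.
have [h1 h2] := fdef x.
have hy y0 : def_graph par m phiF x y0 -> def_graph par m phiF x (f x).
  move=> hy0; rewrite /def_fun; case: xgetP => [z -> //|/(_ y0)]; exact.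
split=> [h|[/h1[y0 /hy h] <-]] //; split; first by apply/h1; exists y.
by apply: h2 (hy y h) h.
Qed.

Definition integrand (s : R) (x : vec K m) : \bar R := ((absK R (f x)) `^ s)%:E.

Lemma integrand_ge0 s x : (0 <= integrand s x)%E.
Proof. by rewrite lee_fin powR_ge0. Qed.

Lemma integrandE s x : f x != 0 ->
  integrand s x = (q K `^ (- (s * (lf_ord (f x))%:~R)))%:E.
Proof.
move=> y0; congr EFin; rewrite /absK (negPf y0).
rewrite -powR_intmul ?ltW ?qR_gt0// -powRrM; congr (_ `^ _).
by rewrite mulrNz mulNr mulrC.
Qed.

Lemma integrand0 s x : 0 < s -> f x = 0 -> integrand s x = 0%E.
Proof. by move=> s0 y0; rewrite /integrand /absK y0 eqxx powR0// gt_eqF. Qed.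

Section Data.
Variables (Phi : seq (ip K m * nat)) (E : zmodType) (L : seq (E -> int)) (T : int).
Variables (kap : E -> int) (sh : E -> ip K m -> int) (lf : E -> int) (C : nat) (B : R).
Hypothesis hspec : fun_spec par phiF Phi L T kap sh lf C B.

Lemma absK_mt (a b : K) : mt (idv K) 1 0 a b -> absK R b = absK R a.
Proof.
move=> h; rewrite /absK (mt_eq0 (ltn0Sn 0) h); case: ifP => // /negbT a0.
by rewrite (mtid_ord (ltn0Sn 0) h).
Qed.

Lemma class_const s x x' : X x -> class Phi x x' -> X x' /\ integrand s x' = integrand s x.
Proof.
move=> Xx; have [+ _] := hspec ((def_funP x (f x)).2 (conj Xx erefl)).
move=> /[apply] -[y' [/def_funP[Xx' <-] h]]; split=> //.
by rewrite /integrand (absK_mt h).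
Qed.

Lemma class_measurable x : @measurable _ (TT K m) (class Phi x).
Proof. exact: match_on_measurable. Qed.

Section Enum.
Variables (A : nat -> Prop) (r : nat -> vec K m).
Hypothesis Ar : forall n, A n -> X (r n).
Hypothesis rA : forall x, X x -> exists2 n, A n & class Phi (r n) x.

Definition piece n : set (TT K m) := [set x | A n /\ class Phi (r n) x].

Lemma piece_measurable n : measurable (piece n).
Proof.
have [An|An] := pselect (A n).
  have -> : piece n = class Phi (r n) by apply/seteqP; split=> [x []|x].
  exact: class_measurable.
by have -> : piece n = set0 by apply/seteqP; split=> [x []|x].
Qed.

Lemma pieces : X = \bigcup_n piece n.
Proof.
apply/seteqP; split=> [x /rA[n An h]|x [n _ [/Ar h /(class_const 1 h)[]//]]].
by exists n.
Qed.

Lemma piece_integrand s n : {in piece n, integrand s =1 cst (integrand s (r n))}.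
Proof. by move=> x /set_mem[/Ar h /(class_const s h)[]]. Qed.

Lemma pieces_measurable s : @measurable _ (TT K m) X /\
  measurable_fun (X : set (TT K m)) (integrand s : TT K m -> \bar R).
Proof.
rewrite pieces; split; first by apply: bigcupT_measurable => n; exact: piece_measurable.
apply/measurable_fun_bigcup => n; first exact: piece_measurable.
apply: (eq_measurable_fun (cst (integrand s (r n)))); last exact: measurable_cst.
by move=> x xn; rewrite (piece_integrand s xn).
Qed.

End Enum.

End Data.

Lemma integrand_measurable s : @measurable _ (TT K m) X /\
  measurable_fun (X : set (TT K m)) (integrand s : TT K m -> \bar R).
Proof.
have [Phi [E [L [T [kap [sh [lf [C [B [h1 _ _ _ [_ _ _ h2]]]]]]]]]]] :=
  function_data R par m phiF.
have [S [pat [A [r [hA hr _ _]]]]] := @class_enum K m Phi X.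
exact: (pieces_measurable h2 hA hr).
Qed.

End Integrand.
Arguments def_funP {P K par m phiX phiF} fdef x y.

(** * Consequences of integrability along a ray of shifts *)

Section Growth.
Variables (P : Type) (F : NALocalField0) (R : realType) (par : P -> F) (m : nat).
Variables (phiX phiF : qformula P).
Hypothesis fdef : is_def_fun par m phiX phiF.
Local Notation TT := (g_sigma_algebraType (boxes F m)).
Local Notation q := ((lf_q F)%:R : R).
Local Notation X := (def_set par m phiX).
Local Notation f := (def_fun par m phiF).
Variables (mu : {measure set TT -> \bar R}) (s : R).
Local Notation g := (integrand (R := R) par phiF s : TT -> \bar R).
Hypothesis int_fin : (\int[mu]_(x in (X : set TT)) g x < +oo)%E.

Variables (Om : nat -> set TT) (e : nat) (oy lv ko kv : int).
Hypothesis e_gt0 : (0 < e)%N.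
Hypothesis Om_measurable : forall n, measurable (Om n).
Hypothesis Om_ord : forall n x, Om n x ->
  [/\ X x, f x != 0 & lf_ord (f x) = e%:Z * (oy + n%:Z * lv)].
Hypothesis Om_large : forall n, ((q ^ (- (e%:Z * (ko + n%:Z * kv))))%:E <= mu (Om n))%E.

Let lam : R := kv%:~R + s * lv%:~R.
Let c0 : R := ko%:~R + s * oy%:~R.

Let Om_sub n : Om n `<=` (X : set TT).
Proof. by move=> x /Om_ord[]. Qed.

Let Om_int n : ((q `^ (- (e%:R * (c0 + n%:R * lam))))%:E <= \int[mu]_(x in Om n) g x)%E.
Proof.
rewrite (eq_integral (cst (q `^ (- (s * (e%:Z * (oy + n%:Z * lv))%:~R)))%:E)); last first.
  by move=> x /set_mem/Om_ord[_ y0 oE]; rewrite integrandE// oE.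
rewrite integral_cst//; apply: le_trans (lee_wpmul2l _ (Om_large n)).
  rewrite -EFinM lee_fin -powR_intmul ?(ltW (qR_gt0 F R))// -powRD; last first.
    by rewrite (gt_eqF (qR_gt0 F R)) implybT.
  rewrite le_eqVlt; apply/orP; left; apply/eqP; congr (_ `^ _).
  by rewrite /lam /c0 !(mulrzDr, intrM, intrD, mulrNz, rmorphN) /=; ring.
by rewrite lee_fin powR_ge0.
Qed.

Let Om_le n : (\int[mu]_(x in Om n) g x <= \int[mu]_(x in (X : set TT)) g x)%E.
Proof.
have [mX mg] := integrand_measurable fdef s.
apply: ge0_subset_integral => // x _; exact: integrand_ge0.
Qed.

Let I := fine (\int[mu]_(x in (X : set TT)) g x).
Let IE : (\int[mu]_(x in (X : set TT)) g x)%E = I%:E.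
Proof.
rewrite /I fineK// ge0_fin_numE//; apply: integral_ge0 => x _; exact: integrand_ge0.
Qed.

(** Each [Om n] contributes at least q^(- e (c0 + n lam)) to a finite integral; for negative [lam]
    this already exceeds any bound by the estimate exp t >= 1 + t. *)
Lemma growth_ge0 : 0 <= lam.
Proof.
rewrite leNgt; apply/negP => lam0.
have hq : 0 < ln q by rewrite ln_gt0// qR_gt1.
have e0 : 0 < (e%:R : R) by rewrite ltr0n.
pose t := e%:R * - lam * ln q.
have t0 : 0 < t by rewrite !mulr_gt0// oppr_gt0.
pose n := (Num.truncn ((`|I| + e%:R * `|c0| * ln q) / t)).+1.
have hn : `|I| + e%:R * `|c0| * ln q < n%:R * t.
  by rewrite -ltr_pdivrMr// truncnS_gt.
have := le_trans (Om_int n) (Om_le n); rewrite IE lee_fin => h.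
have : 1 + (- (e%:R * (c0 + n%:R * lam))) * ln q <= I.
  apply: le_trans h; rewrite /powR gt_eqF ?qR_gt0//.
  exact: expR_ge1Dx.
have h1 := ler_norm I; have h2 := ler_norm c0.
have h3 : e%:R * c0 * ln q <= e%:R * `|c0| * ln q.
  by apply: ler_wpM2r; [exact: ltW|apply: ler_wpM2l => //; exact: ltW].
have -> : - (e%:R * (c0 + n%:R * lam)) * ln q = n%:R * t - e%:R * c0 * ln q.
  by rewrite /t; ring.
lra.
Qed.

(** For [lam] = 0 infinitely many disjoint sets would each contribute at least the same positive
    amount [dl]. *)
Lemma growth_gt0 : trivIset setT Om -> 0 < lam.
Proof.
move=> tO; rewrite lt_neqAle growth_ge0 andbT; apply/negP => /eqP lam0.
pose dl := q `^ (- (e%:R * c0)).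
have dl0 : 0 < dl by rewrite powR_gt0// qR_gt0.
have [mX mg] := integrand_measurable fdef s.
have mU : measurable (\bigcup_n Om n) by apply: bigcupT_measurable.
have sU : \bigcup_n Om n `<=` (X : set TT) by move=> x [n _]; exact: Om_sub.
pose n := (Num.truncn (`|I| / dl)).+1.
have hn : `|I| < n%:R * dl by rewrite -ltr_pdivrMr// truncnS_gt.
have : ((n%:R * dl)%:E <= I%:E)%E.
  rewrite -IE; apply: le_trans (ge0_subset_integral mu mU mX mg _ sU); last first.
    by move=> x _; exact: integrand_ge0.
  rewrite ge0_integral_bigcup//; last 2 first.
  - exact: measurable_funS mX sU mg.
  - by move=> x _; exact: integrand_ge0.
  apply: le_trans (nneseries_lim_ge n _); last first.
    by move=> k _ _; apply: integral_ge0 => x _; exact: integrand_ge0.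
  have -> : (n%:R * dl)%:E = (\sum_(0 <= k < n) dl%:E)%E.
    by rewrite sumEFin sumr_const_nat subn0 mulr_natl.
  apply: lee_sum => k _; apply: le_trans (Om_int k).
  by rewrite -lam0 mulr0 addr0.
rewrite lee_fin; have := ler_norm I; lra.
Qed.

End Growth.

Lemma allp_nthP (X : Type) (d : X) (Q : X -> Prop) (s : seq X) :
  allp Q s <-> forall i : 'I_(size s), Q (nth d s i).
Proof.
split; first by elim: s => [|x s IH] /= => [_ []//|[Qx /IH h] [[|i] hi] //]; exact: (h (Ordinal _)).
elim: s => //= x s IH h; split; first exact: (h ord0).
by apply: IH => i; have := h (lift ord0 i).
Qed.

(** * Cones of admissible shifts *)

Section SignedForms.
Variables (E : zmodType) (L : seq (E -> int)) (T : int).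
Hypothesis addL : allp (@addform _) L.
Hypothesis T_gt0 : 0 < T.
Local Notation I := ('I_(size L)).
Let f (i : I) : E -> int := nth (fun=> 0) L i.

Definition signs (o : E) : {ffun I -> bool * bool} := [ffun i => (T <= f i o, f i o <= - T)].

(* Admissible shifts from a point [o] only depend on [signs o] and form a cone. *)
Definition signed_forms (t : {ffun I -> bool * bool}) : seq (E -> int) :=
  [seq f i | i <- enum I & ~~ (t i).2] ++ [seq (fun v => - f i v) | i <- enum I & ~~ (t i).1].

Let fadd i : addform (f i).
Proof. by have /(allp_nthP (fun=> 0)) := addL; apply. Qed.

Lemma signed_forms_add t : allp (@addform _) (signed_forms t).
Proof.
rewrite /signed_forms allp_cat !allp_map; split; apply/allp_mem => i _ //.
by move=> u v; rewrite fadd opprD.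
Qed.

Lemma signed_forms_bound o : allp (fun g => - T <= g o) (signed_forms (signs o)).
Proof.
rewrite /signed_forms allp_cat !allp_map; split; apply/allp_mem => i;
  rewrite mem_filter ffunE /= => /andP[h _]; lia.
Qed.

(** A form that is small at o occurs with both signs, hence vanishes on the cone; a large one occurs
    only with the permitted sign. *)
Lemma signed_forms_adm o v n : cone (signed_forms (signs o)) v -> adm L T o (v *+ n).
Proof.
rewrite /cone /signed_forms allp_cat !allp_map => -[/allp_mem h1 /allp_mem h2].
apply/(allp_nthP (fun=> 0)) => i; rewrite -/(f i) (addformMn _ _ (fadd i)).
have {}h1 : ~~ (f i o <= - T) -> 0 <= f i v.
  by move=> h; apply: h1; rewrite mem_filter ffunE /= h mem_enum.
have {}h2 : ~~ (T <= f i o) -> 0 <= - f i v.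
  by move=> h; apply: h2; rewrite mem_filter ffunE /= h mem_enum.
split=> h.
- by apply: mulr_ge0 => //; apply: h1; lia.
- by apply: mulr_ge0_le0 => //; have := h2; lia.
- by have -> : f i v = 0; [have := h1; have := h2; lia|rewrite mulr0].
Qed.

End SignedForms.

(** * Descent of integrability from F to K *)

Section Descent.
Variables (P : Type) (K F : NALocalField0) (j : vext K F) (R : realType).
Variables (par : P -> K) (m : nat) (phiX phiF : qformula P).
Let parF c : F := j (par c).
Hypothesis fdefK : is_def_fun par m phiX phiF.
Hypothesis fdefF : is_def_fun parF m phiX phiF.
Local Notation TT F := (g_sigma_algebraType (boxes F m)).
Local Notation q F := ((lf_q F)%:R : R).
Local Notation X := (def_set par m phiX).
Local Notation f := (def_fun par m phiF).
Variables (muK : {measure set (TT K) -> \bar R}) (muF : {measure set (TT F) -> \bar R}).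
Hypotheses (hmuK : haar_measure muK) (hmuF : haar_measure muF).
Variable s : R.
Hypothesis s_gt0 : 0 < s.
Hypothesis int_fin :
  (\int[muF]_(x in (def_set parF m phiX : set (TT F))) integrand parF phiF s x < +oo)%E.

Section Data.
Variables (Phi : seq (ip K m * nat)) (E : zmodType) (L : seq (E -> int)) (T : int).
Variables (kap : E -> int) (sh : E -> ip K m -> int) (lf : E -> int) (C : nat) (B : R).
Hypothesis Phi_gt0 : forall p, p \in Phi -> (0 < p.2)%N.
Hypothesis T_gt0 : 0 < T.
Hypothesis addL : allp (@addform _) L.
Hypothesis addkap : addform kap.
Hypothesis addlf : addform lf.
Hypothesis addsh : forall u v, sh (u + v) = sh u + sh v.
Hypothesis B_ge0 : 0 <= B.
Hypothesis hspec : fun_spec par phiF Phi L T kap sh lf C B.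
Local Notation val_ x p := (ev (idv K) m (vz x) p.1).
Local Notation data x o := (shift_data par phiF Phi L T kap sh lf C B x (f x) o).
Let lam (v : E) : R := (kap v)%:~R + s * (lf v)%:~R.

Let shMn v n Q : sh (v *+ n) Q = n%:Z * sh v Q.
Proof. by apply: (addformMn (g := fun v => sh v Q)) => u w; rewrite addsh. Qed.

(** The multiples of v give sets over F on which the order of f is constant and varies linearly with
    n. They are disjoint as soon as v moves the order of some polynomial not vanishing at x, since
    then the orders over F differ. *)
Lemma shift_growth x o v : X x -> f x != 0 -> data x o -> (forall n, adm L T o (v *+ n)) ->
  0 <= lam v /\ ((exists p, [/\ p \in Phi, val_ x p != 0 & sh v p.1 != 0]) -> 0 < lam v).
Proof.
move=> Xx y0 [_ _ _ hd] hadm.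
pose Om n : set (TT F) := [set x' | match_on j Phi (sh (v *+ n)) (vz x) x'].
have mOm n : measurable (Om n) by exact: match_on_measurable.
have hO n x' : Om n x' -> [/\ def_set parF m phiX x', def_fun parF m phiF x' != 0 &
     lf_ord (def_fun parF m phiF x') = (vx_e j)%:Z * (lf_ord (f x) + n%:Z * lf v)].
  move=> hx'; have [_ /(_ x' hx')[y' [hy' hm]]] := hd F j _ (hadm n).
  have [Xx' yE] := (def_funP fdefF _ _).1 hy'; rewrite -yE in hm.
  split=> //; first by rewrite (mt_eq0 (ltn0Sn 0) hm).
  by rewrite (mt_ord (ltn0Sn 0) y0 hm) (addformMn _ _ addlf).
have hL n : ((q F ^ (- ((vx_e j)%:Z * (kap o + C%:Z + n%:Z * kap v))))%:E <= muF (Om n))%E.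
  have [/(_ muF hmuF) h _] := hd F j _ (hadm n); apply: le_trans h.
  by rewrite lee_fin (addformMn _ _ addkap) addrAC.
split; first exact: (growth_ge0 fdefF int_fin (vx_e0 j) mOm hO hL).
move=> [p [pP vp sp]]; apply: (growth_gt0 fdefF int_fin (vx_e0 j) mOm hO hL).
apply/trivIsetP => n n' _ _ nn'; apply/seteqP; split=> // x' [/(_ p pP) h /(_ p pP) h'].
have := mt_ord (Phi_gt0 pP) vp h; rewrite (mt_ord (Phi_gt0 pP) vp h') !shMn.
have e0 : (vx_e j)%:Z != 0 by rewrite gt_eqF// vx_gt0.
move=> /(mulfI e0)/addrI/(mulIf sp)[] e; by rewrite e eqxx in nn'.
Qed.

Section Enum.
Variables (S : finType) (pat : vec K m -> S) (A : nat -> Prop) (r : nat -> vec K m).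
Hypothesis Ar : forall n, A n -> X (r n).
Hypothesis rA : forall x, X x -> exists2 n, A n & class Phi (r n) x.
Hypothesis pat0 : forall x x' p, pat x = pat x' -> p \in Phi ->
  (val_ x p == 0) = (val_ x' p == 0).
Hypothesis r_inj : forall n n', A n -> A n' -> pat (r n) = pat (r n') ->
  (forall p, p \in Phi -> val_ (r n) p != 0 ->
     lf_ord (val_ (r n) p) = lf_ord (val_ (r n') p)) -> n = n'.
Variable om : nat -> E.
Let good n := A n /\ f (r n) != 0 /\ data (r n) (om n).
Let ptn n := (pat (r n), signs L T (om n)).

(** With pattern and signs fixed, all points share one cone of shifts and one set of vanishing
    polynomials, which puts the sum in the form of [cone_sum]. *)
Lemma pattern_sum t : exists Bt, forall l : seq nat, uniq l ->
  (forall n, n \in l -> good n /\ ptn n = t) -> \sum_(n <- l) q K `^ (- lam (om n)) <= Bt.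
Proof.
have [[n0 [[An0 [y0 d0]] t0]]|hno] := pselect (exists n, good n /\ ptn n = t); last first.
  exists 0 => -[|n l] _ h; first by rewrite big_nil.
  by case: hno; exists n; apply: h; rewrite mem_head.
pose D o := exists n, [/\ good n, ptn n = t & o = om n].
(* Only polynomials of Phi not vanishing on this pattern are kept: their orders separate classes of
   the same pattern, and their shifts are those that [shift_growth] detects. *)
pose key (v : E) : ip K m -> int := fun Q =>
  if [exists i : 'I_(size Phi), (nth (0, 0%N) Phi i).1 == Q] && (ev (idv K) m (vz (r n0)) Q != 0)
  then sh v Q else 0.
have keyE v p : p \in Phi -> key v p.1 = if val_ (r n0) p != 0 then sh v p.1 else 0.
  move=> pP; rewrite /key; case: existsP => //= -[].
  have ip : (index p Phi < size Phi)%N by rewrite index_mem.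
  by exists (Ordinal ip); rewrite /= nth_index.
have [||||Bt hBt] := @cone_sum E (@signed_forms E L t.2) (signed_forms_add addL t.2) R (q K)
   _ lam key D T (qR_gt1 K R).
- by move=> u v; rewrite /lam addkap addlf !intrD; ring.
- move=> u v; apply/funext => Q; rewrite fct_addE /key; case: ifP => _ //.
  by rewrite addsh.
- by move=> o [n [_ <- ->]]; exact: signed_forms_bound.
- move=> o v [n [[An [yn dn]] tE _]]; rewrite -tE => cv.
  have hadm k : adm L T (om n) (v *+ k) by exact: signed_forms_adm cv.
  have [h1 h2] := shift_growth (Ar An) yn dn hadm; split=> // kv; apply: h2.
  apply: contrapT => hne; move/eqP: kv; apply; apply/funext => Q.
  rewrite /key; case: ifP => // /andP[/existsP[i /eqP <-] vQ].
  apply: contrapT => /eqP sQ; apply: hne; exists (nth (0, 0%N) Phi i); split=> //.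
    exact: mem_nth.
  rewrite (@pat0 _ (r n0))// ?mem_nth//.
  by move: tE t0 => <- [].
exists Bt => l ul hl; apply: hBt => // [n nl|n n' nl n'l ek].
  by have [gn tn] := hl n nl; exists n.
have [[An [yn [dn _ _ _]]] tn] := hl n nl; have [[An' [yn' [dn' _ _ _]]] tn'] := hl n' n'l.
apply: r_inj => // [|p pP vp]; first by move: tn; rewrite -tn' => -[].
have := congr1 (fun k => k p.1) ek; rewrite /= !keyE// -(@pat0 (r n)) ?vp//.
  by rewrite dn// dn'.
by move: tn; rewrite -t0 => -[].
Qed.

Hypothesis data_om : forall n, (exists o, data (r n) o) -> data (r n) (om n).
Local Notation g := (integrand (R := R) par phiF s : TT K -> \bar R).
(** Pieces may overlap; [seqDU] makes them disjoint and keeps their union. *)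
Let D := seqDU (piece Phi A r : nat -> set (TT K)).
Let b n : R := if `[< good n >] then B * q K `^ (- lam (om n)) else 0.

Let D_measurable n : measurable (D n).
Proof. by apply: seqDU_measurable => k; exact: piece_measurable. Qed.

Let D_piece n x : D n x -> piece Phi A r n x.
Proof. by apply: subset_seqDU. Qed.

Let D_integral n : (\int[muK]_(x in D n) g x <= (b n)%:E)%E.
Proof.
have b0 : 0 <= b n by rewrite /b; case: ifP => // _; rewrite mulr_ge0 ?powR_ge0.
have [An|An] := pselect (A n); last first.
  have -> : D n = set0.
    by apply/seteqP; split=> // x Dx; have [] := D_piece Dx.
  by rewrite integral_set0 lee_fin.
rewrite (eq_integral (cst (g (r n)))); last first.
  move=> x /set_mem/D_piece xn; apply: (piece_integrand fdefK hspec Ar s).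
  exact/mem_set.
rewrite integral_cst//; have [y0|y0] := eqVneq (f (r n)) 0.
  by rewrite integrand0// mul0e lee_fin.
have Dle : (muK (D n) <= muK (class Phi (r n)))%E.
  apply: le_measure; rewrite ?inE//; first exact: class_measurable.
  by move=> x Dx; have [] := D_piece Dx.
have [d|no] : (exists o, data (r n) o) \/ ~ exists o, data (r n) o by exact: EM.
  have dn := data_om d; rewrite integrandE// /b asboolT//.
  have [_ lfE up _] := dn.
  apply: le_trans (lee_wpmul2l _ (le_trans Dle (up muK hmuK))) _.
    by rewrite lee_fin powR_ge0.
  rewrite -EFinM lee_fin mulrCA -powR_intmul ?(ltW (qR_gt0 K R))// -powRD; last first.
    by rewrite (gt_eqF (qR_gt0 K R)) implybT.
  rewrite /lam lfE; set x1 := (X in _ `^ X); set x2 := (X in _ <= _ * _ `^ X).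
  by have -> : x1 = x2 by rewrite /x1 /x2 mulrNz; ring.
have [_ [h|//]] := hspec ((def_funP fdefK _ _).2 (conj (Ar An) erefl)).
have -> : muK (D n) = 0%E.
  by apply/eqP; rewrite eq_le measure_ge0 andbT -(h muK hmuK).
by rewrite mule0 lee_fin.
Qed.

Lemma pieces_integral : (\int[muK]_(x in (X : set (TT K))) g x < +oo)%E.
Proof.
have /choice[Bt hBt] := pattern_sum.
have sumb N : \sum_(0 <= n < N) b n <= B * \sum_t Bt t.
  rewrite /b -big_mkcond/= -mulr_sumr; apply: ler_wpM2l => //.
  (* Patterns and signs lie in a finite type, so the bounds [Bt] can be added up. *)
  rewrite (partition_big ptn predT)//=; apply: ler_sum => t _.
  rewrite -big_filter; apply: hBt; first by rewrite filter_uniq// iota_uniq.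
  by move=> n; rewrite mem_filter => /andP[/andP[/asboolP gn /eqP tn] _].
have [mX mg] := integrand_measurable fdefK s.
have XE : (X : set (TT K)) = \bigcup_n D n.
  by rewrite (pieces fdefK hspec Ar rA) (seqDU_bigcup_eq (piece Phi A r)).
have g0 x : (0 <= g x)%E by exact: integrand_ge0.
rewrite XE ge0_integral_bigcup//; last 2 first.
- by rewrite -XE.
- exact: trivIset_seqDU.
apply: (@le_lt_trans _ _ (B * \sum_t Bt t)%:E); last exact: ltry.
apply: lime_le.
  by apply: is_cvg_nneseries => n _ _; apply: integral_ge0.
apply: nearW => N; apply: le_trans (_ : (\sum_(0 <= n < N) (b n)%:E <= _)%E).
  by apply: lee_sum => n _; exact: D_integral.
by rewrite sumEFin lee_fin.
Qed.

End Enum.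
End Data.

Lemma integrable_descent : (\int[muK]_(x in (X : set (TT K))) integrand par phiF s x < +oo)%E.
Proof.
have [Phi [E [L [T [kap [sh [lf [C [B [h1 h2 h3 h4 [h5 h6 h7 h8]]]]]]]]]]] :=
  function_data R par m phiF.
have [S [pat [A [r [hA hr hp hi]]]]] := @class_enum K m Phi X.
have /choice[om hom] : forall n, exists o,
    (exists o, shift_data par phiF Phi L T kap sh lf C B (r n) (f (r n)) o) ->
    shift_data par phiF Phi L T kap sh lf C B (r n) (f (r n)) o.
  move=> n; have [[w hw]|no] := EM (exists o,
    shift_data par phiF Phi L T kap sh lf C B (r n) (f (r n)) o).
    by exists w.
  by exists 0 => /no.
exact: (pieces_integral h1 h2 h3 h4 h5 h6 h7 h8 hA hr hp hi hom).
Qed.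

End Descent.

(** * Comparison of the indices *)

Section Index.
Variables (P : Type) (K L : NALocalField0) (j : {rmorphism K -> L}) (R : realType).
Variables (par : P -> K) (m : nat) (phiX phiF : qformula P).

Lemma ind_descent (muK : {measure set (g_sigma_algebraType (boxes K m)) -> \bar R})
    (muL : {measure set (g_sigma_algebraType (boxes L m)) -> \bar R}) :
  finite_ext j -> is_def_fun par m phiX phiF ->
  is_def_fun (fun c => j (par c)) m phiX phiF -> haar_measure muK -> haar_measure muL ->
  (ind_K muL (def_set (fun c => j (par c)) m phiX) (def_fun (fun c => j (par c)) m phiF)
    <= ind_K muK (def_set par m phiX) (def_fun par m phiF))%E.
Proof.
move=> [_ [e [e0 he]]] dK dL hK hL.
pose v : vext K L := Vext e0 he.
rewrite /ind_K; set SL := [set s | _ /\ _]; set SK := [set s | _ /\ _].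
have sub : SL `<=` SK.
  move=> s [s0 hs]; split=> //.
  exact: (@integrable_descent _ K L v R par m phiX phiF dK dL muK muL hK hL s s0 hs).
case: asboolP => [SL0|_].
  rewrite asboolT; last by case: SL0 => s /sub; exists s.
  by apply: le_ereal_sup; apply: image_subset.
(* With no exponent over L its index is 0, below any positive exponent over K. *)
case: asboolP => // -[s Ks]; apply: (@le_trans _ _ s%:E).
  by rewrite lee_fin ltW//; case: Ks.
by apply: ereal_sup_ubound; exists s.
Qed.

End Index.

(** Products of two spanning families span, and ramification indices multiply; this makes L an
    extension of K0 in the case with parameters. *)
Lemma finite_ext_comp (K0 K L : NALocalField0) (i : {rmorphism K0 -> K})
    (j : {rmorphism K -> L}) : finite_ext i -> finite_ext j -> finite_ext (j \o i).
Proof.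
move=> [[a ha] [e [e0 he]]] [[b hb] [e' [e'0 he']]]; split; last first.
  exists (e' * e)%N; split=> [|x x0]; first by rewrite muln_gt0 e'0.
  by rewrite /= he' ?fmorph_eq0// he// PoszM mulrA.
pose s := [seq j x * y | x <- a, y <- b]; exists s.
pose spanned (y : L) := exists c : 'I_(size s) -> K0, y = \sum_(k < size s) j (i (c k)) * s`_k.
have sD y z : spanned y -> spanned z -> spanned (y + z).
  move=> [c ->] [c' ->]; exists (fun k => c k + c' k).
  by rewrite -big_split /=; apply: eq_bigr => k _; rewrite !rmorphD mulrDl.
have s0 : spanned 0.
  by exists (fun=> 0); rewrite big1// => k _; rewrite !rmorph0 mul0r.
have sZ x y : spanned y -> spanned (j (i x) * y).
  move=> [c ->]; exists (fun k => x * c k); rewrite mulr_sumr.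
  by apply: eq_bigr => k _; rewrite !rmorphM mulrA.
have smem y : y \in s -> spanned y.
  move=> ys; have iy : (index y s < size s)%N by rewrite index_mem.
  exists (fun k => (k == Ordinal iy)%:R); rewrite (bigD1 (Ordinal iy))//= big1 => [|k /negPf ->].
    by rewrite eqxx !rmorph1 mul1r nth_index// addr0.
  by rewrite !rmorph0 mul0r.
have ssum (I : Type) (r : seq I) (G : I -> L) : (forall k, spanned (G k)) ->
    spanned (\sum_(k <- r) G k).
  by move=> h; apply: (big_ind spanned).
move=> y; have [c ->] := hb y; apply: (ssum) => k; have [c' ->] := ha (c k).
rewrite rmorph_sum mulr_suml; apply: ssum => l; rewrite rmorphM -mulrA.
by apply/sZ/smem/allpairs_f; rewrite mem_nth.
Qed.
Theorem theorem7p6 (R : realType) :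
  (* (a) existential formulas without parameters; K any non-Archimedean
     local field of characteristic zero *)
  (forall (m : nat) (phiX phiF : qformula void),
     (forall F : NALocalField0,
        is_def_fun (fun c : void => match c return F with end) m phiX phiF) ->
     forall (K L : NALocalField0) (j : {rmorphism K -> L}), finite_ext j ->
     forall (muK : {measure set (g_sigma_algebraType (boxes K m)) -> \bar R})
            (muL : {measure set (g_sigma_algebraType (boxes L m)) -> \bar R}),
       haar_measure muK -> haar_measure muL ->
       (ind_K muL
          (def_set (fun c : void => match c return L with end) m phiX)
          (def_fun (fun c : void => match c return L with end) m phiF)
        <= ind_K muK
          (def_set (fun c : void => match c return K with end) m phiX)
          (def_fun (fun c : void => match c return K with end) m phiF))%E)
  /\
  (* (b) existential formulas with parameters from a fixed non-Archimedean
     local field K0 of characteristic zero; K any finite extension of K0 *)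
  (forall (K0 : NALocalField0) (m : nat) (phiX phiF : qformula K0),
     (forall (F : NALocalField0) (i : {rmorphism K0 -> F}), finite_ext i ->
        is_def_fun i m phiX phiF) ->
     forall (K : NALocalField0) (i : {rmorphism K0 -> K}), finite_ext i ->
     forall (L : NALocalField0) (j : {rmorphism K -> L}), finite_ext j ->
     forall (muK : {measure set (g_sigma_algebraType (boxes K m)) -> \bar R})
            (muL : {measure set (g_sigma_algebraType (boxes L m)) -> \bar R}),
       haar_measure muK -> haar_measure muL ->
       (ind_K muL (def_set (fun c : K0 => j (i c)) m phiX)
                  (def_fun (fun c : K0 => j (i c)) m phiF)
        <= ind_K muK (def_set i m phiX) (def_fun i m phiF))%E).
Proof.
split=> [m phiX phiF fdef K L j ext muK muL hK hL|K0 m phiX phiF fdef K i exti L j extj muK muL hK hL].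
  (* A map out of [void] is unique, so the empty parameter map into L factors through j. *)
  have e : (fun c : void => match c return L with end) =
           (fun c : void => j (match c return K with end)) by apply/funext => -[].
  by rewrite e; apply: ind_descent => //; rewrite -e.
apply: ind_descent => //; first exact: fdef.
exact: (fdef L (j \o i) (finite_ext_comp exti extj)).
Qed.
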